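(* Fix a finite relational schema $\sigma$ and integers $d \geq 2$ and $t \geq 0$. Let $\mathbf{C}_d^t$ be the class of all $\sigma$-databases of degree at most $d$ and tree-width at most $t$. Then every property $\mathbf{P} \subseteq \mathbf{C}_d^t$ definable by a CMSO sentence on $\mathbf{C}_d^t$ (i.e. $\mathbf{P}=\{\mathcal{D}\in\mathbf{C}_d^t \mid \mathcal{D}\models\phi\}$ for some CMSO sentence $\phi$ over $\sigma$) is uniformly testable on $\mathbf{C}_d^t$ with constant time complexity in the $\operatorname{BDRD}_{+/-}$ model.
   Context: A schema $\sigma$ is a finite set of relation names, each with an arity in $\mathbb{N}_{\geq 1}$. A $\sigma$-database $\mathcal{D}=(D,R_1^{\mathcal{D}},\dots)$ has a finite domain $D$ (identified with $[n]=\{1,\dots,n\}$, hence linearly ordered) and, for each $R\in\sigma$, a relation $R^{\mathcal{D}}\subseteq D^{\operatorname{ar}(R)}$. The Gaifman graph of $\mathcal{D}$ has vertex set $D$ and an edge between distinct $a,b$ whenever some tuple of some relation contains both. The degree of an element is the total number of tuples in all relations containing it; the degree of $\mathcal{D}$ is the maximum degree of its elements. The tree-width of $\mathcal{D}$ is the tree-width of its Gaifman graph. Classes of databases are closed under isomorphism; a property is an isomorphism-closed class of databases. CMSO is monadic second-order logic extended by modular counting quantifiers $\exists^m$ ($\exists^m x\,\phi$ holds iff the number of elements satisfying $\phi$ is divisible by $m$). $\operatorname{BDRD}_{+/-}$ distance: for databases $\mathcal{D},\mathcal{D}'$ of degree at most $d$, $\operatorname{dist}_{+/-}(\mathcal{D},\mathcal{D}')$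 is the minimum number of modifications applied to $\mathcal{D}$ and $\mathcal{D}'$ to make them isomorphic, where a modification is inserting a new element, deleting an element (and all tuples containing it), inserting a tuple, or deleting a tuple. For $\epsilon\in[0,1]$, $\mathcal{D},\mathcal{D}'$ are $\epsilon$-close if $\operatorname{dist}_{+/-}(\mathcal{D},\mathcal{D}')\leq \epsilon d\min\{|D|,|D'|\}$, else $\epsilon$-far; $\mathcal{D}$ is $\epsilon$-close to a property $\mathbf{P}$ if it is $\epsilon$-close to some member of $\mathbf{P}$, else $\epsilon$-far from $\mathbf{P}$. Testing: an algorithm has oracle access to an input database $\mathcal{D}$ on $n$ elements: it receives $n$ and may ask oracle queries $(R,i,j)$ with $R\in\sigma$, $i\leq n$, $j\leq \deg(\mathcal{D})$, answered in constant time by the $j$-th tuple (in lexicographic order) of $R^{\mathcal{D}}$ containing the $i$-th element, or $\bot$ if none exists. For a property $\mathbf{P}\subseteq\mathbf{C}$ and $\epsilon\in(0,1]$, an $\epsilon$-tester for $\mathbf{P}$ on $\mathbf{C}$ is a probabilistic algorithm with oracle access to $\mathcal{D}\in\mathbf{C}$ that accepts with probability at least $2/3$ if $\mathcal{D}\in\mathbf{P}$ and rejects with probability at least $2/3$ if $\mathcal{D}$ is $\epsilon$-far from $\mathbf{P}$. Its query complexity is the maximum number of oracle queries. $\mathbf{P}$ is uniformly testable on $\mathbf{C}$ in time $f(n)$ if for every $\epsilon\in(0,1]$ there is an $\epsilon$-tester for $\mathbf{P}$ on $\mathbf{C}$, working for all $n$, with query complexity independent of $n$ and running time $f(n)$ on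 inputs with $n$ elements; constant time means $f$ is constant. Running times are measured on a RAM with uniform cost (arithmetic and random sampling in constant time). *)

(* Defs.v *)
From Stdlib Require Import Reals.
From mathcomp Require Import all_boot.

Set Implicit Arguments.
Unset Strict Implicit.
Unset Printing Implicit Defensive.

(* A schema is given by k relation names 'I_k and an arity map ar.     *)
(* A database with domain [n] (represented as 'I_n, element i+1 of     *)
(* the paper = ordinal i) assigns to each R a set of ar(R)-tuples.     *)

Definition dbase (k : nat) (ar : 'I_k -> nat) (n : nat) :=
  forall R : 'I_k, {set (ar R).-tuple 'I_n}.

Record pdb (k : nat) (ar : 'I_k -> nat) := PDB {
  dom : nat;
  rels : dbase ar dom }.

Arguments PDB {k ar dom} rels.

Definition deg_el k (ar : 'I_k -> nat) n (D : dbase ar n) (a : 'I_n) : nat :=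
  \sum_(R : 'I_k) #|[set u in D R | a \in (u : seq 'I_n)]|.

Definition deg_le k (ar : 'I_k -> nat) (d : nat) (D : pdb ar) : Prop :=
  forall a : 'I_(dom D), deg_el (rels D) a <= d.

Definition gaifman k (ar : 'I_k -> nat) n (D : dbase ar n) : rel 'I_n :=
  fun a b => (a != b) &&
    [exists R : 'I_k, [exists u in D R, (a \in (u : seq 'I_n)) && (b \in (u : seq 'I_n))]].

Definition is_tree (m : nat) (e : rel 'I_m) : Prop :=
  [/\ 0 < m,
      (forall x y, e x y = e y x),
      (forall x, ~~ e x x),
      (forall x y, connect e x y) &
      #|[set p : 'I_m * 'I_m | e p.1 p.2]| = (m.-1).*2 ].

Definition tree_decomposition n (G : rel 'I_n) (m : nat) (e : rel 'I_m)
  (B : 'I_m -> {set 'I_n}) : Prop :=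
  [/\ is_tree e,
      (forall v : 'I_n, exists i, v \in B i),
      (forall u v : 'I_n, G u v -> exists i, (u \in B i) && (v \in B i)) &
      (forall (v : 'I_n) (i j : 'I_m), v \in B i -> v \in B j ->
          connect [rel x y | [&& e x y, v \in B x & v \in B y]] i j) ].

Definition treewidth_le n (G : rel 'I_n) (t : nat) : Prop :=
  exists (m : nat) (e : rel 'I_m) (B : 'I_m -> {set 'I_n}),
    tree_decomposition G e B /\ forall i, #|B i| <= t.+1.

Definition class_C k (ar : 'I_k -> nat) (d t : nat) (D : pdb ar) : Prop :=
  deg_le d D /\ treewidth_le (gaifman (rels D)) t.

Inductive formula (k : nat) (ar : 'I_k -> nat) : Type :=
| FRel (R : 'I_k) (xs : (ar R).-tuple nat)
| FEq (x y : nat)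
| FIn (x X : nat)
| FNot (f : formula ar)
| FAnd (f g : formula ar)
| FOr (f g : formula ar)
| FEx (x : nat) (f : formula ar)
| FExS (X : nat) (f : formula ar)
| FMod (m : nat) (x : nat) (f : formula ar).

Arguments FEq {k ar}.
Arguments FIn {k ar}.

Definition upd (T : Type) (s : nat -> T) (x : nat) (v : T) : nat -> T :=
  fun y => if y == x then v else s y.

Fixpoint sat k (ar : 'I_k -> nat) n (D : dbase ar n)
  (fo : nat -> nat) (so : nat -> {set 'I_n}) (f : formula ar) : bool :=
  match f with
  | FRel R xs => [exists u in D R, map (@nat_of_ord n) u == map fo xs]
  | FEq x y => fo x == fo y
  | FIn x X => [exists i in so X, nat_of_ord i == fo x]
  | FNot g => ~~ sat D fo so g
  | FAnd g h => sat D fo so g && sat D fo so h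
  | FOr g h => sat D fo so g || sat D fo so h
  | FEx x g => [exists i : 'I_n, sat D (upd fo x (nat_of_ord i)) so g]
  | FExS X g => [exists S : {set 'I_n}, sat D fo (upd so X S) g]
  | FMod m x g => m %| #|[set i : 'I_n | sat D (upd fo x (nat_of_ord i)) so g]|
  end.

Fixpoint free_fo k (ar : 'I_k -> nat) (f : formula ar) : seq nat :=
  match f with
  | FRel _ xs => tval xs
  | FEq x y => [:: x; y]
  | FIn x _ => [:: x]
  | FNot g => free_fo g
  | FAnd g h | FOr g h => free_fo g ++ free_fo h
  | FEx x g | FMod _ x g => [seq y <- free_fo g | y != x]
  | FExS _ g => free_fo g
  end.

Fixpoint free_so k (ar : 'I_k -> nat) (f : formula ar) : seq nat :=
  match f with
  | FRel _ _ | FEq _ _ => [::]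
  | FIn _ X => [:: X]
  | FNot g => free_so g
  | FAnd g h | FOr g h => free_so g ++ free_so h
  | FEx _ g | FMod _ _ g => free_so g
  | FExS X g => [seq Y <- free_so g | Y != X]
  end.

Definition sentence k (ar : 'I_k -> nat) (f : formula ar) : bool :=
  (free_fo f == [::]) && (free_so f == [::]).

(* satisfaction of a sentence (the assignments are irrelevant for sentences) *)
Definition models k (ar : 'I_k -> nat) (D : pdb ar) (f : formula ar) : bool :=
  sat (rels D) (fun _ => 0) (fun _ => set0) f.

Definition iso k (ar : 'I_k -> nat) (D E : pdb ar) : Prop :=
  exists f : 'I_(dom D) -> 'I_(dom E),
    bijective f /\
    forall (R : 'I_k) (u : (ar R).-tuple 'I_(dom D)),
      (u \in rels D R) = (map_tuple f u \in rels E R).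

(* inserting a new element (placed last), deleting an element a (and all
   tuples containing it; the remaining elements are renumbered in order),
   inserting a tuple, deleting a tuple *)
Inductive modif k (ar : 'I_k -> nat) : pdb ar -> pdb ar -> Prop :=
| ModInsElem n (D : dbase ar n) (E : dbase ar n.+1) :
    (forall R, E R = [set map_tuple (widen_ord (leqnSn n)) u | u in D R]) ->
    modif (PDB D) (PDB E)
| ModDelElem n (D : dbase ar n.+1) (E : dbase ar n) (a : 'I_n.+1) :
    (forall R, E R = [set u | map_tuple (lift a) u \in D R]) ->
    modif (PDB D) (PDB E)
| ModInsTuple n (D E : dbase ar n) (R : 'I_k) (u : (ar R).-tuple 'I_n) :
    (forall R', R' != R -> E R' = D R') -> E R = D R :|: [set u] ->
    modif (PDB D) (PDB E)
| ModDelTuple n (D E : dbase ar n) (R : 'I_k) (u : (ar R).-tuple 'I_n) :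
    (forall R', R' != R -> E R' = D R') -> E R = D R :\ u ->
    modif (PDB D) (PDB E).

Fixpoint reach k (ar : 'I_k -> nat) (j : nat) (D E : pdb ar) : Prop :=
  match j with
  | 0 => D = E
  | j'.+1 => exists F, modif D F /\ reach j' F E
  end.

Definition dist_le k (ar : 'I_k -> nat) (D D' : pdb ar) (b : nat) : Prop :=
  exists (i j : nat) (E E' : pdb ar),
    i + j <= b /\ reach i D E /\ reach j D' E' /\ iso E E'.

Definition eps_close k (ar : 'I_k -> nat) (d : nat) (eps : R) (D D' : pdb ar) : Prop :=
  exists b : nat, dist_le D D' b /\
    Rle (INR b) (Rmult (Rmult eps (INR d)) (INR (minn (dom D) (dom D')))).

Definition eps_far_from k (ar : 'I_k -> nat) (d : nat) (eps : R)
  (P : pdb ar -> Prop) (D : pdb ar) : Prop :=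
  ~ (exists D', P D' /\ eps_close d eps D D').

(* Query (R, i, j) (R a relation index, 1 <= i <= n, 1 <= j) returns    *)
(* the j-th tuple, in lexicographic order, of R^D containing the i-th  *)
(* element, elements written as 1..n; None (= bottom) otherwise.       *)

Fixpoint lexle (s t : seq nat) : bool :=
  match s, t with
  | [::], _ => true
  | _ :: _, [::] => false
  | x :: s', y :: t' => (x < y) || ((x == y) && lexle s' t')
  end.

Definition oracle k (ar : 'I_k -> nat) (D : pdb ar) (r i j : nat) : option (seq nat) :=
  match (insub r : option 'I_k), (insub i.-1 : option 'I_(dom D)) with
  | Some R, Some a =>
      if (0 < i) && (0 < j) then
        let l := sort lexle
                   [seq [seq (nat_of_ord x).+1 | x <- tval u]
                   | u <- enum (rels D R) & a \in (tval u)] in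
        if j <= size l then Some (nth [::] l j.-1) else None
      else None
  | _, _ => None
  end.

(* Probabilistic RAM with oracle access, uniform cost.                  *)
(* Registers are indexed by nat and hold nat; register 0 initially     *)
(* holds n, all others 0.  Each executed instruction costs one unit.    *)

Inductive instr : Type :=
| IConst (a c : nat)
| IAdd (a b c : nat)
| ISub (a b c : nat)              (* r[a] := r[b] - r[c] (truncated) *)
| IMul (a b c : nat)
| IDiv (a b c : nat)              (* r[a] := r[b] / r[c] (0 if r[c]=0) *)
| IMod (a b c : nat)
| ILoad (a b : nat)
| IStore (a b : nat)
| IJz (a l : nat)
| IRand (a b : nat)               (* r[a] := uniform in {0,..,r[b]-1} (0 if r[b]=0) *)
| IQuery (a r i j : nat)          (* oracle query (r[r], r[i], r[j]); r[a] := 1 and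
                                     r[a+1..a+len] := answer tuple, or r[a] := 0 *)
| IAccept
| IReject.

Record config := Config { pc : nat; mem : nat -> nat }.

Definition setr (m : nat -> nat) (a v : nat) : nat -> nat := upd m a v.

Definition write_answer (m : nat -> nat) (a : nat) (ans : option (seq nat)) : nat -> nat :=
  match ans with
  | None => setr m a 0
  | Some s => fun x => if x == a then 1
                      else if (a < x) && (x <= a + size s) then nth 0 s (x - a).-1
                      else m x
  end.

(* deterministic successor configuration (for all instructions except
   IRand, IAccept, IReject) *)
Definition det_step k (ar : 'I_k -> nat) (D : pdb ar) (ins : instr) (c : config) : config :=
  let m := mem c in let p := pc c in
  match ins with
  | IConst a v => Config p.+1 (setr m a v)
  | IAdd a b c' => Config p.+1 (setr m a (m b + m c'))
  | ISub a b c' => Config p.+1 (setr m a (m b - m c'))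
  | IMul a b c' => Config p.+1 (setr m a (m b * m c'))
  | IDiv a b c' => Config p.+1 (setr m a (m b %/ m c'))
  | IMod a b c' => Config p.+1 (setr m a (m b %% m c'))
  | ILoad a b => Config p.+1 (setr m a (m (m b)))
  | IStore a b => Config p.+1 (setr m (m a) (m b))
  | IJz a l => if m a == 0 then Config l m else Config p.+1 m
  | IQuery a r i j => Config p.+1 (write_answer m a (oracle D (m r) (m i) (m j)))
  | _ => c
  end.

Definition rand_vals (v : nat) : seq nat := if v == 0 then [:: 0] else iota 0 v.

(* probability that the program halts with output b within `fuel` steps
   (falling off the program counts as rejecting) *)
Fixpoint prob_out k (ar : 'I_k -> nat) (prog : seq instr) (D : pdb ar) (b : bool)
  (fuel : nat) (c : config) : R :=
  match fuel with
  | 0 => R0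
  | fuel'.+1 =>
    match nth IReject prog (pc c) with
    | IAccept => if b then R1 else R0
    | IReject => if b then R0 else R1
    | IRand a bb =>
        let vs := rand_vals (mem c bb) in
        Rmult (Rinv (INR (size vs)))
          (foldr (fun v s => Rplus (prob_out prog D b fuel'
                              (Config (pc c).+1 (setr (mem c) a v))) s) R0 vs)
    | ins => prob_out prog D b fuel' (det_step D ins c)
    end
  end.

Fixpoint bounded_run k (ar : 'I_k -> nat) (prog : seq instr) (D : pdb ar)
  (fuel q : nat) (c : config) : Prop :=
  match fuel with
  | 0 => False
  | fuel'.+1 =>
    match nth IReject prog (pc c) with
    | IAccept | IReject => True
    | IRand a bb => forall v, v \in rand_vals (mem c bb) ->
                      bounded_run prog D fuel' q (Config (pc c).+1 (setr (mem c) a v))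
    | IQuery _ _ _ _ as ins => 0 < q /\ bounded_run prog D fuel' q.-1 (det_step D ins c)
    | ins => bounded_run prog D fuel' q (det_step D ins c)
    end
  end.

Definition init_config k (ar : 'I_k -> nat) (D : pdb ar) : config :=
  Config 0 (fun x => if x == 0 then dom D else 0).

Definition const_time_tester k (ar : 'I_k -> nat) (d : nat)
  (C P : pdb ar -> Prop) (eps : R) (prog : seq instr) (T q : nat) : Prop :=
  forall D : pdb ar, C D ->
    [/\ bounded_run prog D T q (init_config D),
        (P D -> Rle (Rdiv 2 3) (prob_out prog D true T (init_config D))) &
        (eps_far_from d eps P D -> Rle (Rdiv 2 3) (prob_out prog D false T (init_config D)))].

Definition uniformly_testable_const_time k (ar : 'I_k -> nat) (d : nat)
  (C P : pdb ar -> Prop) : Prop :=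
  forall eps : R, Rlt 0 eps -> Rle eps 1 ->
    exists (prog : seq instr) (T q : nat), const_time_tester d C P eps prog T q.

(* Main.v *)
(* x *)
Require Import Defs.
From Stdlib Require Import Reals Lra FunctionalExtensionality Classical.
From mathcomp Require Import all_boot zify.

Set Implicit Arguments.
Unset Strict Implicit.
Unset Printing Implicit Defensive.

(** * Components and their isomorphism codes *)

(** The tester samples a constant number of elements, explores their neighbourhoods to a constant
    radius, and accepts when the observed statistics of rooted views fit those of some member of the
    property; databases of bounded size are read completely. Its correctness rests on
    [close_of_views]: if [H] and a member [G] of the property are large and have nearly equal view
    statistics, then [H] is close to some member of the property, of nearly the same size as [H].
    Three ingredients give this.

    Finite state and pumping. A database of tree-width at most [t] is a forest with [t.+1] colours
    ([tree_of_db], with converse [pdb_of_tw]). The truth of a CMSO sentence and the degree bound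
    depend only on a finite state of the forest that is compatible with plugging into contexts
    ([tree_state]). Marking a small fraction of the nodes and deleting their bags leaves components
    of bounded size ([markP], [hv_None]), and the histogram of their isomorphism types is additive
    under plugging ([hv_plug]). As in Parikh's theorem, a forest is a small one with pumps inserted,
    and positive multiplicities of pumps may be replaced by other positive ones ([parikh]). So a
    member of size [m] can be replaced, for every [n], by a member whose histogram is the old one
    times [n / m], up to a constant error ([scaling]).

    Histograms control distance. Components of equal type are matched, and everything else is
    deleted ([match_parts], [isoon_dist]).

    Views control histograms. The component type is a labelling of [G] that is not visible locally,
    and it has to be reproduced on [H]. Since [H] has bounded tree-width too, few deletions split it
    into bounded pieces. Each piece is sent into [G] along equal views, and types are read off
    there. The energy of the conditional expectation of the labels given the view is bounded and
    grows with the radius, so at some bounded radius it nearly stops growing; there the label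
    frequencies survive the transport ([transfer]). Components of [G] pull back to [H] ([kept_cty]),
    except near the boundaries of the pieces, which are rare ([card_lost]).

    Finally, Chebyshev's inequality compares sample and true frequencies ([sampling]), and since the
    decision depends on boundedly many bits, a table stored in the program takes it
    ([table_tester]). *)

Lemma connect_closed_ind (T : finType) (e : rel T) (P : T -> Prop) x :
  P x -> (forall y z, P y -> e y z -> P z) -> forall y, connect e x y -> P y.
Proof.
move=> Px IH y /connectP[p ep ->].
elim: p x Px ep => //= z p IHp x Px /andP[exz ep]; apply: IHp ep; exact: IH exz.
Qed.

Lemma mapP_inj (T1 T2 : eqType) (f : T1 -> T2) (C : pred T1) (s s' : seq T1) :
  {in C &, injective f} -> all C s -> all C s' -> map f s = map f s' -> s = s'.
Proof.
move=> fI; elim: s s' => [|x s IH] [|y s'] //= /andP[Cx Cs] /andP[Cy Cs'] [fxy /IH ->] //.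
by rewrite (fI x y).
Qed.

Lemma imset_seqP (T1 T2 : finType) (f : T1 -> T2) (C : {set T1}) (s : seq T2) :
  all (mem (f @: C)) s -> exists2 s0, all (mem C) s0 & s = map f s0.
Proof.
elim: s => [|x s IH] /=; first by exists [::].
by case/andP=> /imsetP[u uC ->] /IH[s0 s0C ->]; exists (u :: s0) => //=; apply/andP.
Qed.

Section Structures.
Variables (k amx K : nat).

Definition mapt (A B : Type) (f : A -> B) (t : 'I_k * seq A) : 'I_k * seq B :=
  (t.1, map f t.2).

Definition adj (V : finType) (L : seq ('I_k * seq V)) (A : {set V}) : rel V :=
  fun u v => has (fun t => [&& all (mem A) t.2, u \in t.2 & v \in t.2]) L.

(* Sealed: comparing two components by conversion would unfold [connect]. *)
Lemma cpnt_sealed : {f : forall V : finType, seq ('I_k * seq V) -> {set V} -> V -> {set V} |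
  forall (V : finType) (L : seq ('I_k * seq V)) (A : {set V}) (u : V), f V L A u = [set v | connect (adj L A) u v]}.
Proof. by eexists => V L A u. Qed.

Definition cpnt := proj1_sig cpnt_sealed.

Section Components.
Variables (V : finType) (L : seq ('I_k * seq V)) (A : {set V}).
Local Notation adj := (adj L A).
Local Notation cpnt := (cpnt L A).

Lemma in_cpnt u v : (v \in cpnt u) = connect adj u v.
Proof. by have := proj2_sig cpnt_sealed V L A u => /setP/(_ v); rewrite inE. Qed.

Lemma adjP u v : reflect (exists t, [/\ t \in L, {subset t.2 <= A}, u \in t.2 & v \in t.2]) (adj u v).
Proof.
apply: (iffP hasP) => [[t tL /and3P[/allP tA ut vt]]|[t [tL tA ut vt]]]; exists t => //.
by apply/and3P; split=> //; apply/allP.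
Qed.

Lemma adj_sym u v : adj u v = adj v u.
Proof. by rewrite /adj; apply: eq_has => t; rewrite [(u \in _) && _]andbC. Qed.

Lemma adj_in u v : adj u v -> (u \in A) && (v \in A).
Proof. by case/adjP=> t [_ tA /tA-> /tA->]. Qed.

Lemma comp_refl u : u \in cpnt u.
Proof. by rewrite in_cpnt connect0. Qed.

Lemma adj_connect_sym : connect_sym adj.
Proof. by apply: sym_connect_sym => u v; apply: adj_sym. Qed.

Lemma comp_eq u v : v \in cpnt u -> cpnt v = cpnt u.
Proof.
rewrite in_cpnt => uv; apply/setP=> w; rewrite !in_cpnt.
by rewrite (same_connect adj_connect_sym uv).
Qed.

Lemma comp_sub u : u \in A -> cpnt u \subset A.
Proof.
move=> uA; apply/subsetP=> v; rewrite in_cpnt; apply: (connect_closed_ind (P := fun w => w \in A)) => // y z _.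
by case/adj_in/andP.
Qed.

Lemma comp_tuple t u : t \in L -> {subset t.2 <= A} -> u \in t.2 -> {subset t.2 <= cpnt u}.
Proof.
move=> tL tA ut v vt; rewrite in_cpnt; apply: connect1; apply/adjP; by exists t.
Qed.

Definition code_of (h : {ffun V -> 'I_K}) (C : {set V}) : {set 'I_K} * {set 'I_k * {bseq amx of 'I_K}} :=
  (h @: C, [set p | (p.1, bseqval p.2) \in [seq mapt h t | t <- L & all (mem C) t.2]]).

(** All copies of the component on ['I_K] are collected, over every injective labelling. This makes
    the code an isomorphism invariant without the choice of a canonical labelling. *)
Definition code (C : {set V}) : {set {set 'I_K} * {set 'I_k * {bseq amx of 'I_K}}} :=
  [set X | [exists h : {ffun V -> 'I_K},
     [forall u in C, [forall v in C, (h u == h v) ==> (u == v)]] && (X == code_of h C)]].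

Lemma codeP (C : {set V}) X : reflect (exists2 h : {ffun V -> 'I_K}, {in C &, injective h} & X = code_of h C)
   (X \in code C).
Proof.
rewrite inE; apply: (iffP existsP) => [[h /andP[hI /eqP->]]|[h hI ->]]; exists h => //.
  move=> u v uC vC huv; apply/eqP.
  move/forall_inP/(_ u uC)/forall_inP/(_ v vC)/implyP: hI; apply; exact/eqP.
rewrite eqxx andbT; apply/forall_inP=> u uC; apply/forall_inP=> v vC; apply/implyP=> /eqP huv.
by apply/eqP; apply: hI.
Qed.

Lemma code_nonempty (C : {set V}) : 0 < K -> #|C| <= K -> exists X, X \in code C.
Proof.
move=> K0 CK.
pose h := [ffun u => insubd (Ordinal K0) (index u (enum C))].
exists (code_of h C); apply/codeP; exists h => // u v uC vC; rewrite !ffunE.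
have lt w : w \in C -> index w (enum C) < K.
  by move=> wC; apply: leq_trans CK; rewrite cardE index_mem mem_enum.
move/(congr1 val); rewrite !val_insubd !lt // => e.
by rewrite -(nth_index u (_ : u \in enum C)) ?mem_enum // e nth_index // mem_enum.
Qed.
End Components.

(** Isomorphism of induced substructures, given by a total function of which only the values on [C]
    matter. *)
Definition isoon (V V' : finType) (L : seq ('I_k * seq V)) (L' : seq ('I_k * seq V'))
    (C : {set V}) (C' : {set V'}) (f : V -> V') : Prop :=
  [/\ {in C &, injective f}, f @: C = C' &
     forall R s, all (mem C) s -> ((R, s) \in L) = ((R, map f s) \in L')].

Hypothesis K0 : 0 < K.

Lemma mem_mapt_in (V V' : finType) (L : seq ('I_k * seq V)) (C : {set V}) (f : V -> V') R s :
  {in C &, injective f} -> all (mem C) s ->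
  ((R, map f s) \in [seq mapt f t | t <- L & all (mem C) t.2]) = ((R, s) \in L).
Proof.
move=> fI sC; apply/mapP/idP => [[[R' s']]|sL]; last first.
  by exists (R, s); rewrite // mem_filter sC.
by rewrite mem_filter /= => /andP[s'C s'L] [-> /(mapP_inj fI)->].
Qed.

(** Composing with [f] or with its inverse turns labellings of one set into labellings of the other
    with the same copy on ['I_K]. *)
Lemma code_iso (V V' : finType) (L : seq ('I_k * seq V)) (L' : seq ('I_k * seq V')) (C : {set V}) (C' : {set V'}) f :
  isoon L L' C C' f -> code L C = code L' C'.
Proof.
case=> fI <- HL.
have Lsub (h : {ffun V -> 'I_K}) (h' : {ffun V' -> 'I_K}) :
    {in C, forall u, h' (f u) = h u} -> code_of L h C = code_of L' h' (f @: C).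
  move=> hh; rewrite /code_of; congr pair.
    apply/setP=> x; apply/imsetP/imsetP => [[u uC ->]|[v /imsetP[u uC ->] ->]].
      by exists (f u); rewrite ?imset_f ?hh.
    by exists u; rewrite ?hh.
  apply/setP=> p; rewrite !inE.
  have mh s : all (mem C) s -> map h s = map h' (map f s).
    by move=> /allP sC; rewrite -map_comp; apply/eq_in_map => u /sC uC; rewrite /= hh.
  apply/mapP/mapP => [[[R s]]|[[R s]]]; rewrite mem_filter /= => /andP[sC sL] ->.
    exists (R, map f s); last by rewrite /mapt /= mh.
    rewrite mem_filter -HL // sL andbT /=; apply/allP=> _ /mapP[u us ->].
    by apply: imset_f; apply: (allP sC).
  have [s0 s0C es] := imset_seqP sC; subst s.
  exists (R, s0); last by rewrite /mapt /= mh.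
  by rewrite mem_filter HL // s0C.
apply/setP=> X; apply/codeP/codeP => [[h hI ->]|[h' hI ->]].
  pose h' := [ffun v => if [pick u in C | f u == v] is Some u then h u else Ordinal K0].
  have hh : {in C, forall u, h' (f u) = h u}.
    move=> u uC; rewrite ffunE; case: pickP => [v /andP[vC /eqP/fI->] //|/(_ u)].
    by rewrite uC eqxx.
  exists h'; last exact: Lsub.
  move=> _ _ /imsetP[u uC ->] /imsetP[v vC ->]; rewrite !hh //.
  by move/hI->.
pose h := [ffun u => h' (f u)].
exists h; last by symmetry; apply: Lsub => u uC; rewrite ffunE.
by move=> u v uC vC; rewrite !ffunE => /(hI _ _ (imset_f f uC) (imset_f f vC)) /fI->.
Qed.

(** Equal nonempty codes share a copy; one labelling onto it followed by the inverse of the other is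
    the isomorphism. The bound on [#|C|] makes the code nonempty. *)
Lemma code_inj (V V' : finType) (L : seq ('I_k * seq V)) (L' : seq ('I_k * seq V')) (C : {set V}) (C' : {set V'}) (v0 : V') :
  (forall t, t \in L -> size t.2 <= amx) -> (forall t, t \in L' -> size t.2 <= amx) ->
  #|C| <= K -> code L C = code L' C' -> exists f, isoon L L' C C' f.
Proof.
move=> La La' CK ee.
have [X XC] := code_nonempty L K0 CK.
have := XC; rewrite ee => /codeP[h' h'I eX']; move/codeP: XC => [h hI eX].
have [e1 e2] : h @: C = h' @: C' /\ (code_of L h C).2 = (code_of L' h' C').2.
  by split; [have := congr1 fst eX'|have := congr1 snd eX']; rewrite eX.
pose f u := if [pick v in C' | h' v == h u] is Some v then v else v0.
have fP u : u \in C -> (f u \in C') /\ h' (f u) = h u.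
  move=> uC; rewrite /f; case: pickP => [v /andP[vC /eqP->] //|nov].
  have : h u \in h' @: C' by rewrite -e1 imset_f.
  by case/imsetP=> v vC ev; have := nov v; rewrite vC ev eqxx.
have fI : {in C &, injective f}.
  by move=> u v uC vC /(congr1 h'); rewrite !(fP _ _).2 // => /hI->.
exists f; split=> //.
  apply/setP=> v; apply/imsetP/idP => [[u uC ->]|vC]; first by case: (fP u uC).
  have : h' v \in h @: C by rewrite e1 imset_f.
  case/imsetP=> u uC ev; exists u => //; apply: h'I => //; first by case: (fP u uC).
  by rewrite (fP u uC).2.
move=> R s sC.
have fC : all (mem C') (map f s).
  by apply/allP=> _ /mapP[u us ->]; case: (fP u (allP sC u us)).
have hf : map h s = map h' (map f s).
  by rewrite -map_comp; apply/eq_in_map => u us; rewrite /= (fP u (allP sC u us)).2.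
rewrite -(mem_mapt_in (C := C) _ _ hI) // -(mem_mapt_in (C := C') _ _ h'I) // -hf.
have [sa|sa] := leqP (size s) amx.
  have sb : size (map h s) <= amx by rewrite size_map.
  by move/setP/(_ (R, Bseq sb)): e2; rewrite !inE.
rewrite hf.
rewrite (mem_mapt_in (C := C') _ _ h'I) // -hf (mem_mapt_in (C := C) _ _ hI) //.
(* Tuples longer than [amx] leave no trace in the code, but neither list contains one. *)
by apply/idP/idP => [/La|/La'] /=; rewrite ?size_map leqNgt sa.
Qed.

(* Sealing the codes in an ordinal keeps unification away from nested set types. *)
Lemma code_rank : {n : nat & {f : {set {set 'I_K} * {set 'I_k * {bseq amx of 'I_K}}} -> 'I_n | injective f}}.
Proof. by exists #|{: {set {set 'I_K} * {set 'I_k * {bseq amx of 'I_K}}}}|, enum_rank; apply: enum_rank_inj. Qed.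

Definition ncode := projT1 code_rank.
Definition rank_code := proj1_sig (projT2 code_rank).
Lemma rank_code_inj : injective rank_code.
Proof. exact: (proj2_sig (projT2 code_rank)). Qed.

(* Sealed as well: comparing two instances by conversion would unfold [connect]. *)
Lemma cty_sealed :
  {f : forall V : finType, seq ('I_k * seq V) -> {set V} -> V -> option 'I_ncode |
  forall (V : finType) (L : seq ('I_k * seq V)) (A : {set V}) (u : V), f V L A u =
    if (u \in A) && (#|cpnt L A u| <= K) then Some (rank_code (code L (cpnt L A u))) else None}.
Proof. by eexists => V L A u. Qed.

Definition cty := proj1_sig cty_sealed.

Lemma ctyE (V : finType) (L : seq ('I_k * seq V)) (A : {set V}) u : cty L A u =
  if (u \in A) && (#|cpnt L A u| <= K) then Some (rank_code (code L (cpnt L A u))) else None.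
Proof. exact: (proj2_sig cty_sealed). Qed.

Section Embedding.
Variables (V V' : finType) (L : seq ('I_k * seq V)) (L' : seq ('I_k * seq V')).
Variables (A C : {set V}) (A' : {set V'}) (f : V -> V').
Hypothesis Ccl : forall u v, u \in C -> adj L A u v -> v \in C.
Hypothesis fI : {in C &, injective f}.
Hypothesis fA : {in C, forall u, (f u \in A') = (u \in A)}.
Hypothesis fL : forall t, t \in L -> {subset t.2 <= A} -> {subset t.2 <= C} -> mapt f t \in L'.
Hypothesis Lne' : forall t, t \in L' -> t.2 != [::].
Hypothesis fL' : forall t', t' \in L' -> {subset t'.2 <= A'} -> forall u, u \in C ->
  f u \in t'.2 -> exists t, [/\ t \in L, t' = mapt f t & {subset t.2 <= C}].

Lemma comp_closed u : u \in C -> cpnt L A u \subset C.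
Proof.
move=> uC; apply/subsetP=> v; rewrite in_cpnt.
by apply: (connect_closed_ind (P := fun w => w \in C)) => // y z yC /Ccl->.
Qed.

Lemma comp_emb u : u \in C -> cpnt L' A' (f u) = f @: cpnt L A u.
Proof.
move=> uC; apply/setP=> v; apply/idP/imsetP => [|[w wC ->]]; rewrite in_cpnt.
  apply: (connect_closed_ind (P := fun w => exists2 x, x \in cpnt L A u & w = f x)).
    by exists u => //; apply: comp_refl.
  move=> _ z [x xu ->] /adjP[t' [tL tA xt zt]].
  have xC := subsetP (comp_closed uC) x xu.
  have [t [tL1 et tC]] := fL' tL tA xC xt; subst t'.
  move: zt => /mapP[z' z't ->]; exists z' => //.
  have tA1 : {subset t.2 <= A}.
    by move=> w wt; rewrite -fA ?tC //; apply: tA; apply: map_f.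
  have xt' : x \in t.2.
    by case/mapP: xt => x' x't /fI ex; rewrite (ex xC (tC _ x't)).
  suff : z' \in cpnt L A x by rewrite (comp_eq xu).
  exact: comp_tuple tL1 tA1 xt' _ z't.
move: wC; rewrite in_cpnt => cw.
suff [] : w \in C /\ connect (adj L' A') (f u) (f w) by [].
move: w cw; apply: (connect_closed_ind (P := fun w => w \in C /\ connect (adj L' A') (f u) (f w))).
  by rewrite connect0.
move=> y z [yC cy] yz; have zC := Ccl yC yz; split=> //.
apply: connect_trans cy (connect1 _).
case/adjP: yz => t [tL tA yt zt].
have tC : {subset t.2 <= C}.
  move=> w wt; apply: (Ccl yC); apply/adjP; by exists t.
apply/adjP; exists (mapt f t); split; rewrite ?map_f //; first exact: fL.
by move=> _ /mapP[w wt ->]; rewrite fA ?tA ?tC.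
Qed.

(** The hypotheses make [C] and its image unions of components with the same tuples, so components,
    their sizes and their codes correspond. All later comparisons of types (restriction, cutting,
    enumeration, relocation) are instances of this. *)
Lemma cty_emb u : u \in C -> cty L' A' (f u) = cty L A u.
Proof.
move=> uC; rewrite !ctyE fA //; case uA: (u \in A) => //=.
have cC := subsetP (comp_closed uC); have cA := subsetP (comp_sub L uA).
rewrite comp_emb // card_in_imset; last by move=> x y /cC xC /cC yC; apply: fI.
case: ifP => // _; congr (Some (rank_code _)); symmetry; apply: (code_iso (f := f)); split=> //.
  by move=> x y /cC xC /cC yC; apply: fI.
move=> R s /allP sc.
have sC : {subset s <= C} by move=> x /sc /cC.
have sA : {subset s <= A} by move=> x /sc /cA.
apply/idP/idP => [sL|sL']; first exact: (fL sL).
have sA' : {subset map f s <= A'} by move=> _ /mapP[w ws ->]; rewrite fA ?sA ?sC.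
case: s sc sC sA sL' sA' => [|x s] sc sC sA sL' sA'; last first.
  have xC := sC x (mem_head _ _).
  have [[R' s'] [tL [eR es] tC]] := fL' sL' sA' xC (mem_head _ _).
  have : [:: x & s] = s' by apply: (mapP_inj (C := mem C) fI) => //; apply/allP.
  by rewrite eR => ->.
by have := Lne' sL'.
Qed.
End Embedding.
End Structures.

(** * Matching components of equal type *)

Section Matching.
Variables (k amx K : nat).
Hypothesis K0 : 0 < K.
Local Notation cty := (@cty k amx K _).

Definition wf (V : finType) (L : seq ('I_k * seq V)) : Prop :=
  forall t, t \in L -> (t.2 != [::]) && (size t.2 <= amx).

Lemma cty_notin (V : finType) (L : seq ('I_k * seq V)) (A : {set V}) u : u \notin A -> cty L A u = None.
Proof. by rewrite ctyE => /negPf->. Qed.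

Lemma cty_Some (V : finType) (L : seq ('I_k * seq V)) (A : {set V}) u x : cty L A u = Some x ->
  [/\ u \in A, #|cpnt L A u| <= K & x = rank_code (code amx K L (cpnt L A u))].
Proof. by rewrite ctyE; case: ifP => // /andP[uA CK] [<-]. Qed.

Definition vec (V : finType) (L : seq ('I_k * seq V)) (A : {set V}) y :=
  #|[set u | cty L A u == y]|.

Definition separated (V : finType) (L : seq ('I_k * seq V)) (A C : {set V}) : Prop :=
  forall t x, t \in L -> {subset t.2 <= A} -> x \in t.2 -> x \in C -> {subset t.2 <= C}.

Lemma cty_sub (V : finType) (L : seq ('I_k * seq V)) (A C : {set V}) :
  wf L -> separated L A C -> C \subset A -> {in C, forall u, cty L C u = cty L A u}.
Proof.
move=> wL sC /subsetP CA u uC.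
apply: (cty_emb amx K0 (C := C) (f := id) (A' := C) (L' := L)) uC => //.
- by move=> x y xC /adjP[t [tL tA xt yt]]; apply: sC tL tA xt xC _ yt.
- by move=> x xC; rewrite CA // xC.
- by move=> t tL _ _; rewrite /mapt map_id -surjective_pairing.
- by move=> t /wL/andP[].
- move=> t tL tC x xC xt; exists t; split=> //.
  by rewrite /mapt map_id -surjective_pairing.
Qed.

Lemma comp_separated (V : finType) (L : seq ('I_k * seq V)) (A : {set V}) u :
  separated L A (cpnt L A u).
Proof.
by move=> t x tL tA xt xC y yt; rewrite -(comp_eq xC); apply: comp_tuple tL tA xt _ yt.
Qed.

Lemma separatedD (V : finType) (L : seq ('I_k * seq V)) (A C : {set V}) :
  separated L A C -> separated L A (A :\: C).
Proof.
move=> sC t x tL tA xt; rewrite inE => /andP[xC _] y yt; rewrite inE tA // andbT.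
by apply: contra xC => yC; apply: sC tL tA yt yC _ xt.
Qed.

Lemma cty_comp (V : finType) (L : seq ('I_k * seq V)) (A : {set V}) u v :
  u \in A -> v \in cpnt L A u -> cty L A v = cty L A u.
Proof.
by move=> uA vu; rewrite !ctyE uA (subsetP (comp_sub L uA) _ vu) (comp_eq vu).
Qed.

Lemma vec_split (V : finType) (L : seq ('I_k * seq V)) (A C : {set V}) y :
  wf L -> separated L A C -> C \subset A -> y != None ->
  vec L A y = vec L C y + vec L (A :\: C) y.
Proof.
move=> wL sC CA yN; rewrite /vec -cardsUI -[LHS]addn0; congr addn.
  apply: eq_card => u; rewrite in_setU !in_set.
  case uC: (u \in C).
    rewrite -(cty_sub wL sC CA uC); rewrite (cty_notin L (A := A :\: C)) ?in_setD ?uC //.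
    by rewrite [None == y]eq_sym (negPf yN) orbF.
  rewrite (cty_notin L (negbT uC)) [None == y]eq_sym (negPf yN) /=.
  case uA: (u \in A); last by rewrite !(cty_notin _ (negbT _)) ?in_setD ?uA ?andbF.
  by rewrite (cty_sub wL (separatedD sC)) ?subsetDl // in_setD uC uA.
symmetry; apply/eqP; rewrite cards_eq0; apply/eqP/setP=> u; rewrite in_setI !in_set.
have [uC|uC] := boolP (u \in C).
  by rewrite (cty_notin L (A := A :\: C)) ?in_setD ?uC // [None == y]eq_sym (negPf yN) andbF.
by rewrite (cty_notin L uC) [None == y]eq_sym (negPf yN).
Qed.

(** No tuple on either side meets both parts, by separation; so each tuple is governed by [f] alone
    or by [g] alone. *)
Lemma isoonU (V V' : finType) (L : seq ('I_k * seq V)) (L' : seq ('I_k * seq V'))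
    (A C B : {set V}) (A' C' B' : {set V'}) f g :
  separated L A C -> separated L' A' C' -> C \subset A -> C' \subset A' ->
  B \subset A :\: C -> B' \subset A' :\: C' ->
  isoon L L' C C' f -> isoon L L' B B' g ->
  isoon L L' (C :|: B) (C' :|: B') (fun u => if u \in C then f u else g u).
Proof.
move=> sC sC' CA CA' BA BA' [fI eC HC] [gI eB HB].
have BC u : u \in B -> (u \in C) = false.
  by move=> /(subsetP BA); rewrite inE => /andP[/negPf].
have BC' u : u \in B' -> (u \in C') = false.
  by move=> /(subsetP BA'); rewrite inE => /andP[/negPf].
have fC u : u \in C -> f u \in C' by move=> uC; rewrite -eC imset_f.
have gB u : u \in B -> g u \in B' by move=> uC; rewrite -eB imset_f.
have BsA := subset_trans BA (subsetDl _ _); have BsA' := subset_trans BA' (subsetDl _ _).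
have UA : {subset C :|: B <= A} by apply/subsetP; rewrite subUset CA.
have UA' : {subset C' :|: B' <= A'} by apply/subsetP; rewrite subUset CA'.
set h := fun u => _.
have hU u : u \in C :|: B -> h u \in C' :|: B'.
  by rewrite /h !inE; case: ifP => [/fC->//|_ /= /gB->]; rewrite orbT.
have hC u : u \in C :|: B -> (h u \in C') = (u \in C).
  by rewrite /h !inE; case: ifP => [/fC->//|_ /= /gB/BC'].
split.
- move=> u v uU vU huv; have := hC u uU; rewrite huv hC // => uv.
  move: huv uU vU; rewrite /h !inE uv; case: ifP => uC /= huv.
    by move=> _ _; apply: fI; rewrite ?uv.
  by move=> uB vB; apply: gI.
- apply/setP=> v; apply/imsetP/idP => [[u uU ->]|]; first exact: hU.
  rewrite inE -eC -eB => /orP[] /imsetP[u uX ->]; exists u; rewrite ?inE ?uX ?orbT //.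
    by rewrite /h uX.
  by rewrite /h BC.
move=> R s sU.
have {}sU u : u \in s -> u \in C :|: B := allP sU u.
have [/allP sCs|] := boolP (all (mem C) s).
  rewrite HC; last exact/allP.
  by congr ((R, _) \in L'); apply/eq_in_map=> u us; have uC : u \in C := sCs u us; rewrite /h uC.
have [/hasP[x xs xC]|/hasPn nC] := boolP (has (mem C) s).
  move/allP => nsC; apply/idP/idP => sL; exfalso; apply: nsC.
    by apply: (sC (R, s) x) => // y ys; apply/UA/sU.
  move=> y ys; rewrite /= -hC; last by apply: sU.
  apply: (sC' (R, map h s) (h x)) => //=.
  - by move=> _ /mapP[z zs ->]; apply/UA'/hU/sU.
  - exact: map_f.
  - by rewrite hC // sU.
  - exact: map_f.
move=> _; have {}nC u : u \in s -> u \notin C := nC u.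
have sB : all (mem B) s.
  by apply/allP=> u us; have := sU u us; have := nC u us; rewrite !inE => /negPf->.
rewrite HB //.
by congr ((R, _) \in L'); apply/eq_in_map=> u us; rewrite /h (negPf (nC u us)).
Qed.

(** The l1 distance of the two histograms, [None] excluded: of the two truncated differences one is
    zero and the other is the absolute difference. *)
Definition discrepancy (V V' : finType) (L : seq ('I_k * seq V)) (L' : seq ('I_k * seq V'))
    (A : {set V}) (A' : {set V'}) :=
  \sum_y ((vec L A (Some y) - vec L' A' (Some y)) + (vec L' A' (Some y) - vec L A (Some y))).

Lemma vec_comp (V : finType) (L : seq ('I_k * seq V)) (A : {set V}) u x y :
  wf L -> u \in A -> cty L A u = Some x -> vec L (cpnt L A u) (Some y) = (y == x) * #|cpnt L A u|.
Proof.
move=> wL uA ux; rewrite /vec.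
have e v : v \in cpnt L A u -> cty L (cpnt L A u) v = Some x.
  move=> vu; rewrite (cty_sub wL (@comp_separated _ _ _ _) (comp_sub L uA) vu).
  by rewrite (cty_comp uA vu).
case: eqP => [->|/eqP yx]; rewrite ?mul1n ?mul0n.
  apply: eq_card => v; rewrite inE; case vC: (v \in cpnt L A u).
    by rewrite e // eqxx.
  by rewrite !ctyE vC.
apply/eqP; rewrite cards_eq0; apply/eqP/setP=> v; rewrite !inE; case vC: (v \in cpnt L A u).
  by rewrite e //; apply/eqP=> [[exy]]; rewrite exy eqxx in yx.
by rewrite !ctyE vC.
Qed.

(** Greedy matching: two elements of equal type have isomorphic components, of equal size. Removing
    both lowers the two histograms equally, so the discrepancy is unchanged and induction
    applies. *)
Lemma match_total (V V' : finType) (L : seq ('I_k * seq V)) (L' : seq ('I_k * seq V'))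
    (A : {set V}) (A' : {set V'}) (v0 : V') :
  wf L -> wf L' -> {in A, forall u, cty L A u != None} -> {in A', forall u, cty L' A' u != None} ->
  exists (A1 : {set V}) (A1' : {set V'}) f, [/\ A1 \subset A, A1' \subset A', isoon L L' A1 A1' f &
    #|A :\: A1| + #|A' :\: A1'| <= discrepancy L L' A A'].
Proof.
move=> wL wL'; have [m] := ubnP #|A|; elim: m A A' => // m IH A A' /ltnSE Am nA nA'.
have [/existsP[u /existsP[u' /and3P[uA uA' /eqP uu']]]|nex] :=
  boolP [exists u, exists u', [&& u \in A, u' \in A' & cty L A u == cty L' A' u']].
  set C := cpnt L A u; set C' := cpnt L' A' u'.
  have sC : separated L A C by apply: comp_separated.
  have sC' : separated L' A' C' by apply: comp_separated.
  have CA : C \subset A by apply: comp_sub.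
  have CA' : C' \subset A' by apply: comp_sub.
  case eu : (cty L A u) (nA u uA) => [x|//] _.
  have eu' : cty L' A' u' = Some x by rewrite -uu'.
  have [fcode CK] : code amx K L C = code amx K L' C' /\ #|C| <= K.
    have [_ CK ex] := cty_Some eu; have [_ _ ex'] := cty_Some eu'.
    by split; [apply: (@rank_code_inj k amx K); apply: etrans (esym ex) ex'|].
  have wa t : t \in L -> size t.2 <= amx by case/wL/andP.
  have wa' t : t \in L' -> size t.2 <= amx by case/wL'/andP.
  have [f fiso] := code_inj K0 v0 wa wa' CK fcode.
  have cC : #|C| = #|C'|.
    by case: fiso => fI <- _; rewrite card_in_imset.
  have := IH (A :\: C) (A' :\: C').
  case.
  - have : 0 < #|C| by apply/card_gt0P; exists u; apply: comp_refl.
    rewrite cardsD (setIidPr CA); have := subset_leq_card CA; lia.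
  - move=> v vAC; rewrite (cty_sub wL (separatedD sC)) ?subsetDl //.
    by apply: nA; move: vAC; rewrite inE => /andP[].
  - move=> v vAC; rewrite (cty_sub wL' (separatedD sC')) ?subsetDl //.
    by apply: nA'; move: vAC; rewrite inE => /andP[].
  move=> A1 [A1' [g [A1s A1s' giso dd]]].
  exists (C :|: A1), (C' :|: A1'), (fun u => if u \in C then f u else g u); split.
  - by rewrite subUset CA (subset_trans A1s) ?subsetDl.
  - by rewrite subUset CA' (subset_trans A1s') ?subsetDl.
  - exact: (isoonU sC sC' CA CA' A1s A1s' fiso giso).
  rewrite !setDDl in dd; apply: leq_trans dd _.
  rewrite /discrepancy leq_eqVlt; apply/orP; left; apply/eqP/eq_bigr => y _.
  rewrite [in RHS](vec_split (C := C) (A := A)) // [in RHS](vec_split (C := C') (A := A')) //.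
  by rewrite !(vec_comp _ wL uA eu) !(vec_comp _ wL' uA' eu') -/C -/C' -cC !subnDl.
(* No type is common to both sides, so for each type one of the two counts is zero and the
   discrepancy is the number of all remaining elements. *)
exists set0, set0, (fun _ => v0); split; rewrite ?sub0set //.
  split; [by move=> ? ?; rewrite inE | by rewrite imset0 | ].
  move=> R [|x s] /=; last by rewrite inE.
  by move=> _; apply/idP/idP => [/wL|/wL'].
rewrite !setD0.
have sumA (W : finType) (M : seq ('I_k * seq W)) (B : {set W}) :
    {in B, forall u, cty M B u != None} -> #|B| = \sum_y vec M B (Some y).
  move=> nB; rewrite /vec -sum1_card.
  rewrite (eq_bigr (fun y => \sum_(u in B | cty M B u == Some y) 1)); last first.
    move=> y _; rewrite -sum1dep_card; apply: eq_bigl => w; rewrite !ctyE.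
    by case: (w \in B).
  rewrite (exchange_big_dep (mem B)) /=; last by move=> i j _ /andP[].
  apply: eq_bigr => w wB; case e: (cty M B w) (nB w wB) => [y|//] _.
  by rewrite (big_pred1 y) // => z; rewrite wB /= (inj_eq Some_inj) eq_sym.
rewrite (sumA _ L A) // (sumA _ L' A') // -big_split /=; apply: leq_sum => y _.
have [->|nv] := posnP (vec L A (Some y)); first by rewrite sub0n subn0.
have [->|nv'] := posnP (vec L' A' (Some y)); first by rewrite sub0n subn0 !addn0.
exfalso; case/card_gt0P: nv => u; rewrite inE => /eqP eu; case/card_gt0P: nv' => u'.
rewrite inE => /eqP eu'; move/existsP: nex; apply; exists u; apply/existsP; exists u'.
rewrite eu eu' eqxx andbT; move: eu eu'; rewrite !ctyE.
by case: (u \in A) => //=; case: (u' \in A').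
Qed.

(** The elements of type [None] are discarded first. They form whole components or lie outside the
    sets, so the types of the others do not change. *)
Lemma match_parts (V V' : finType) (L : seq ('I_k * seq V)) (L' : seq ('I_k * seq V'))
    (A : {set V}) (A' : {set V'}) (v0 : V') :
  wf L -> wf L' ->
  exists (A1 : {set V}) (A1' : {set V'}) f, isoon L L' A1 A1' f /\
    #|~: A1| + #|~: A1'| <= vec L A None + vec L' A' None + discrepancy L L' A A'.
Proof.
move=> wL wL'.
pose big (W : finType) (M : seq ('I_k * seq W)) (B : {set W}) := [set u | cty M B u != None].
have bigB (W : finType) (M : seq ('I_k * seq W)) (B : {set W}) : big W M B \subset B.
  by apply/subsetP=> u; rewrite inE !ctyE; case: (u \in B).
have bigS (W : finType) (M : seq ('I_k * seq W)) (B : {set W}) : separated M B (big W M B).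
  move=> t x tM tB xt; rewrite inE => xb y yt; rewrite inE.
  by rewrite (cty_comp (tB _ xt)) // (comp_tuple tM tB xt yt).
have bigE (W : finType) (M : seq ('I_k * seq W)) (B : {set W}) y :
    wf M -> vec M (big W M B) (Some y) = vec M B (Some y).
  move=> wM; apply: eq_card => u; rewrite !inE.
  have [ub|ub] := boolP (u \in big W M B); first by rewrite (cty_sub wM (@bigS _ _ _)).
  rewrite ctyE (negPf ub) /=; move: ub; rewrite inE negbK => /eqP->.
  by [].
have bigN (W : finType) (M : seq ('I_k * seq W)) (B : {set W}) : #|~: big W M B| = vec M B None.
  by apply: eq_card => u; rewrite !inE negbK.
have bigT (W : finType) (M : seq ('I_k * seq W)) (B : {set W}) :
    wf M -> {in big W M B, forall u, cty M (big W M B) u != None}.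
  by move=> wM u ub; rewrite (cty_sub wM (@bigS _ _ _)) //; move: ub; rewrite inE.
have [A1 [A1' [f [As As' fiso dd]]]] := match_total v0 wL wL' (bigT _ _ A wL) (bigT _ _ A' wL').
exists A1, A1', f; split=> //.
have cD (W : finType) (X Y : {set W}) : X \subset Y -> #|~: X| = #|~: Y| + #|Y :\: X|.
  move=> XY; have := cardsC X; have := cardsC Y; rewrite cardsD (setIidPr XY).
  have := subset_leq_card XY; lia.
rewrite (cD _ _ _ As) (cD _ _ _ As') !bigN.
have -> : discrepancy L L' A A' = discrepancy L L' (big V L A) (big V' L' A').
  by apply: eq_bigr => y _; rewrite !bigE.
lia.
Qed.
End Matching.

(** * Deletion down to an induced substructure *)

Section Distance.
Variables (k : nat) (ar : 'I_k -> nat).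

Definition dblist n (D : dbase ar n) : seq ('I_k * seq 'I_n) :=
  [seq (R, tval u) | R <- enum 'I_k, u <- enum (D R)].

Lemma mem_dblist n (D : dbase ar n) R (u : (ar R).-tuple 'I_n) :
  ((R, tval u) \in dblist D) = (u \in D R).
Proof.
apply/allpairsPdep/idP => [[R' [u' [_ u'D [eR]]]]|uD]; last first.
  by exists R, u; rewrite !mem_enum.
by subst R' => /val_inj->; rewrite mem_enum in u'D.
Qed.

Lemma dblistP n (D : dbase ar n) t : reflect (exists R (u : (ar R).-tuple 'I_n), u \in D R /\ t = (R, tval u))
  (t \in dblist D).
Proof.
apply: (iffP idP) => [/allpairsPdep[R [u [_ uD ->]]]|[R [u [uD ->]]]]; last by rewrite mem_dblist.
by exists R, u; rewrite mem_enum in uD.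
Qed.

Lemma reach_delete m (D : pdb ar) (A : {set 'I_(dom D)}) : #|~: A| = m ->
  exists (E : pdb ar) (g : 'I_(dom E) -> 'I_(dom D)), [/\ reach m D E, injective g, g @: setT = A &
    forall R u, (u \in rels E R) = (map_tuple g u \in rels D R)].
Proof.
elim: m D A => [|m IH] D A.
  move/eqP; rewrite cards_eq0 => /eqP cA; exists D, id; split=> //.
    by rewrite -[A]setCK cA setC0; apply/setP=> x; rewrite inE; apply/imsetP; exists x.
  move=> R u; have -> // : map_tuple id u = u by apply: val_inj; rewrite /= map_id.
case: D A => n D /= A cA.
have /card_gt0P[a] : 0 < #|~: A| by rewrite cA.
rewrite inE => aA; case: n D A cA a aA => [|n] D A cA a aA; first by case: a {aA}.
pose E1 : dbase ar n := fun R => [set u | map_tuple (lift a) u \in D R].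
pose A1 : {set 'I_n} := [set x | lift a x \in A].
have lA : lift a @: (~: A1) = (~: A) :\ a.
  apply/setP=> y; rewrite !inE; apply/imsetP/andP => [[x]|[ya yA]].
    by rewrite !inE => xA ->; rewrite xA eq_sym neq_lift.
  rewrite eq_sym in ya; have [x ex _] := unlift_some ya.
  by exists x => //; rewrite !inE -ex.
have cA1 : #|~: A1| = m.
  rewrite -(card_imset _ (lift_inj (h := a))) lA.
  by have := cardsD1 a (~: A); rewrite inE aA cA add1n => -[].
have [E [g [rE gI eg HE]]] := IH (PDB E1) A1 cA1.
exists E, (fun x => lift a (g x)); split.
- by exists (PDB E1); split=> //; apply: (@ModDelElem _ _ _ D E1 a).
- by move=> x y /lift_inj/gI.
- apply/setP=> y; apply/imsetP/idP => [[x _ ->]|yA].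
    have : g x \in g @: setT by rewrite imset_f.
    by rewrite eg inE.
  have ya : a != y by apply: contraNneq aA => ->.
  case: (unlift_some ya) => x ex _.
  have : x \in A1 by rewrite inE -ex.
  by rewrite -eg => /imsetP[z _ ez]; exists z; rewrite // ex ez.
- move=> R u; rewrite HE inE.
  have -> // : map_tuple (lift a) (map_tuple g u) = map_tuple (fun x => lift a (g x)) u.
  by apply: val_inj; rewrite /= -map_comp.
Qed.

(** Only element deletions are needed: deleting both complements leaves the two induced
    substructures, which [f] identifies. *)
Lemma isoon_dist (D D' : pdb ar) (A : {set 'I_(dom D)}) (A' : {set 'I_(dom D')}) f :
  isoon (dblist (rels D)) (dblist (rels D')) A A' f -> dist_le D D' (#|~: A| + #|~: A'|).
Proof.
move=> [fI ef HL].
have [E [g [rE gI eg HE]]] := reach_delete (erefl #|~: A|).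
have [E' [g' [rE' gI' eg' HE']]] := reach_delete (erefl #|~: A'|).
exists #|~: A|, #|~: A'|, E, E'; split=> //; split=> //; split=> //.
have gA x : g x \in A by rewrite -eg imset_f.
have hP x : exists y, g' y == f (g x).
  have : f (g x) \in A' by rewrite -ef imset_f.
  by rewrite -eg' => /imsetP[y _ ey]; exists y; rewrite ey.
pose h x := xchoose (hP x).
have hE x : g' (h x) = f (g x) by apply/eqP/(xchooseP (hP x)).
have hI : injective h.
  by move=> x y /(congr1 g'); rewrite !hE => /fI e; apply: gI; apply: e.
exists h; split.
  apply: inj_card_bij => //.
  have -> : #|'I_(dom E)| = #|A| by rewrite -eg card_imset // cardsT.
  have -> : #|'I_(dom E')| = #|A'| by rewrite -eg' card_imset // cardsT.
  by rewrite -ef card_in_imset.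
move=> R u; rewrite HE HE' -!mem_dblist /= HL; last by apply/allP=> _ /mapP[x _ ->]; apply: gA.
have -> // : map f (map g u) = map g' (map h u).
by rewrite -!map_comp; apply: eq_map => x /=; rewrite hE.
Qed.
End Distance.

(** * Trees *)

Section Trees.
Variables (k c : nat).

(* First-child/next-sibling encoding of a rooted forest whose nodes are the elements of a database:
   [Node i own x a b] is an element of colour [i] and name [x], with descendants [a] and later siblings [b].
   Its bag consists of itself and, for every other colour, of its closest ancestor of that colour;
   [own] lists the tuples over that bag for which it is the lowest element.
   [Mk] is transparent and marks a place where the forest may be cut. *)
Inductive tree :=
| Leaf
| Node (i : 'I_c) (own : seq ('I_k * seq 'I_c)) (x : nat) (a b : tree)
| Mk (a : tree).

Fixpoint El (T : tree) : finType :=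
  match T with
  | Leaf => void
  | Node _ _ _ a b => option (El a + El b)%type
  | Mk a => El a
  end.

(** Leaving the descendants of a node of colour [i] binds the open colour [i] to that node; [sgb] is
    the counterpart for siblings, which do not see the node. *)
Definition sga (A B : Type) (i : 'I_c) (z : 'I_c + A) : 'I_c + option (A + B) :=
  match z with
  | inl j => if j == i then inr None else inl j
  | inr u => inr (Some (inl u))
  end.

Definition sgb (A B : Type) (z : 'I_c + B) : 'I_c + option (A + B) :=
  match z with
  | inl j => inl j
  | inr u => inr (Some (inr u))
  end.

Arguments sga {A B} i z.
Arguments sgb {A B} z.

(** An entry [inl j] stands for the closest ancestor of colour [j] that is not yet part of the
    forest. Such open ends make the tuples compositional; [cl] keeps those without open ends. *)
Fixpoint ot (T : tree) : seq ('I_k * seq ('I_c + El T)) :=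
  match T with
  | Leaf => [::]
  | Node i own _ a b =>
      map (mapt (@sga (El a) (El b) i)) (map (mapt inl) own ++ ot a)
      ++ map (mapt (@sgb (El a) (El b))) (ot b)
  | Mk a => ot a
  end.

(** Every mark deletes the bag seen from it. The bag enters as the list of all colours, which get
    bound on the way up; hence [c] entries per mark. *)
Fixpoint Zs (T : tree) : seq ('I_c + El T) :=
  match T with
  | Leaf => [::]
  | Node i _ _ a b => map (@sga (El a) (El b) i) (Zs a) ++ map (@sgb (El a) (El b)) (Zs b)
  | Mk a => map inl (enum 'I_c) ++ Zs a
  end.

Definition getr (A B : Type) (z : A + B) : option B := if z is inr u then Some u else None.

Definition cl (T : tree) : seq ('I_k * seq (El T)) :=
  [seq (t.1, pmap (@getr _ _) t.2) | t <- ot T & all (fun z => isSome (getr z)) t.2].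

Definition AT (T : tree) : {set El T} := [set u | inr u \notin Zs T].

Lemma getr_map (A B : Type) (s : seq B) : pmap (@getr A B) (map inr s) = s.
Proof. by elim: s => //= x s ->. Qed.

Lemma getr_all (A B : Type) (s : seq (A + B)) :
  all (fun z => isSome (getr z)) s -> map inr (pmap (@getr A B) s) = s.
Proof. by elim: s => //= -[|] //= x s IH /IH->. Qed.

Lemma mem_cl T R s : ((R, s) \in cl T) = ((R, map inr s) \in ot T).
Proof.
apply/mapP/idP => [[[R' s']]|sT]; last first.
  by exists (R, map inr s); rewrite /= ?getr_map // mem_filter sT andbT; elim: s {sT}.
by rewrite mem_filter /= => /andP[s's s'T] [-> ->]; rewrite getr_all.
Qed.

Inductive ctx :=
| CH
| CL (i : 'I_c) (own : seq ('I_k * seq 'I_c)) (x : nat) (X : ctx) (b : tree)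
| CR (i : 'I_c) (own : seq ('I_k * seq 'I_c)) (x : nat) (a : tree) (X : ctx)
| CM (X : ctx).

Fixpoint plug (X : ctx) (S : tree) : tree :=
  match X with
  | CH => S
  | CL i own x X b => Node i own x (plug X S) b
  | CR i own x a X => Node i own x a (plug X S)
  | CM X => Mk (plug X S)
  end.

Definition omapl (A A' B : Type) (f : A -> A') (z : option (A + B)) : option (A' + B) :=
  match z with
  | None => None
  | Some (inl u) => Some (inl (f u))
  | Some (inr v) => Some (inr v)
  end.

Definition omapr (A B B' : Type) (f : B -> B') (z : option (A + B)) : option (A + B') :=
  match z with
  | None => None
  | Some (inl u) => Some (inl u)
  | Some (inr v) => Some (inr (f v))
  end.

(* Elements outside the hole, elements of the plugged tree, and the bag seen from the hole. *)
Fixpoint eout (X : ctx) (S : tree) : El (plug X (Mk Leaf)) -> El (plug X (Mk S)) :=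
  match X with
  | CH => fun z : void => match z with end
  | CL _ _ _ X b => omapl (@eout X S)
  | CR _ _ _ a X => omapr (@eout X S)
  | CM X => @eout X S
  end.

Fixpoint ein (X : ctx) (S : tree) : El S -> El (plug X (Mk S)) :=
  match X with
  | CH => id
  | CL _ _ _ X b => fun u => Some (inl (@ein X S u))
  | CR _ _ _ a X => fun u => Some (inr (@ein X S u))
  | CM X => @ein X S
  end.

Fixpoint hbag (X : ctx) : 'I_c -> 'I_c + El (plug X (Mk Leaf)) :=
  match X with
  | CH => inl
  | CL i _ _ X b => fun j => sga i (hbag X j)
  | CR i _ _ a X => fun j => sgb (hbag X j)
  | CM X => hbag X
  end.

Definition smap (A B B' : Type) (f : B -> B') (z : A + B) : A + B' :=
  match z with inl j => inl j | inr u => inr (f u) end.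

Definition fout X S (z : 'I_c + El (plug X (Mk Leaf))) : 'I_c + El (plug X (Mk S)) := smap (@eout X S) z.
Definition fin X S (z : 'I_c + El S) : 'I_c + El (plug X (Mk S)) :=
  match z with inl j => fout S (hbag X j) | inr u => inr (ein X u) end.

Lemma omapl_inj (A A' B : Type) (f : A -> A') : injective f -> injective (@omapl A A' B f).
Proof. by move=> fI [[u|u]|] [[v|v]|] //= [] => [e|->] //; rewrite (fI _ _ e). Qed.

Lemma omapr_inj (A B B' : Type) (f : B -> B') : injective f -> injective (@omapr A B B' f).
Proof. by move=> fI [[u|u]|] [[v|v]|] //= [] => [->|e] //; rewrite (fI _ _ e). Qed.

Lemma eout_inj X S : injective (@eout X S).
Proof.
elim: X => [|i own x X IH b|i own x a X IH|X IH].
- by move=> [].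
- exact: omapl_inj.
- exact: omapr_inj.
- exact: IH.
Qed.

Lemma ein_inj X S : injective (@ein X S).
Proof.
elim: X => [|i own x X IH b|i own x a X IH|X IH] //= u v.
- by case=> e; apply: IH.
- by case=> e; apply: IH.
Qed.

Lemma eout_ein X S u v : @eout X S u <> ein X v.
Proof.
elim: X u v => [[]|i own x X IH b|i own x a X IH|X IH] //=.
- by move=> [[u|u]|] v //= [] e; apply: (IH u v e).
- by move=> [[u|u]|] v //= [] e; apply: (IH u v e).
Qed.

Lemma ecover X S w : (exists u, w = @eout X S u) \/ (exists v, w = @ein X S v).
Proof.
elim: X w => [|i own x X IH b|i own x a X IH|X IH] //= w; first by right; exists w.
- case: w => [[w|w]|]; last by left; exists None.
    by case: (IH w) => -[u ->]; [left; exists (Some (inl u))|right; exists u].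
  by left; exists (Some (inr w)).
- case: w => [[w|w]|]; last by left; exists None.
    by left; exists (Some (inl w)).
  by case: (IH w) => -[u ->]; [left; exists (Some (inr u))|right; exists u].
Qed.

Lemma fout_CL i own x X b S z : @fout (CL i own x X b) S (sga i z) = sga i (@fout X S z).
Proof. by case: z => [j|u] //=; rewrite /fout /=; case: ifP. Qed.

Lemma fout_CLb i own x X b S z : @fout (CL i own x X b) S (sgb z) = sgb z.
Proof. by case: z. Qed.

Lemma fout_CR i own x a X S z : @fout (CR i own x a X) S (sgb z) = sgb (@fout X S z).
Proof. by case: z. Qed.

Lemma fout_CRa i own x a X S z : @fout (CR i own x a X) S (sga i z) = sga i z.
Proof. by case: z => [j|u] //=; case: ifP. Qed.

Lemma fin_CL i own x X b S z : @fin (CL i own x X b) S z = sga i (fin X z).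
Proof. by case: z => //= j; rewrite fout_CL. Qed.

Lemma fin_CR i own x a X S z : @fin (CR i own x a X) S z = sgb (fin X z).
Proof. by case: z => //= j; rewrite fout_CR. Qed.

Lemma fin_CH S z : @fin CH S z = z.
Proof. by case: z. Qed.

Lemma mapt_comp (A B C : Type) (f : B -> C) (g : A -> B) (h : A -> C) (t : 'I_k * seq A) :
  (forall x, f (g x) = h x) -> mapt f (mapt g t) = mapt h t.
Proof. by move=> e; rewrite /mapt -map_comp; congr pair; apply: eq_map => x; rewrite -e. Qed.

Lemma mapt_comp2 (A B B' C : Type) (f : B -> C) (g : A -> B) (f' : B' -> C) (g' : A -> B') (t : 'I_k * seq A) :
  (forall x, f (g x) = f' (g' x)) -> mapt f (mapt g t) = mapt f' (mapt g' t).
Proof. by move=> e; rewrite /mapt -!map_comp; congr pair; apply: eq_map => x; rewrite /= e. Qed.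

Lemma ot_plug X S :
  perm_eq (ot (plug X (Mk S))) (map (mapt (@fout X S)) (ot (plug X (Mk Leaf))) ++ map (mapt (@fin X S)) (ot S)).
Proof.
elim: X => [|i own x X IH b|i own x a X IH|X IH] //=.
- rewrite (eq_map (g := id)) ?map_id // => -[R s]; rewrite /mapt /=; congr pair.
  by rewrite (eq_map (g := id)) ?map_id // => z; rewrite fin_CH.
- rewrite !map_cat -!map_comp -!catA.
  rewrite [in X in perm_eq _ (X ++ _)](eq_map (g := mapt (@sga (El (plug X (Mk S))) (El b) i) \o mapt inl)); last first.
    by move=> t; rewrite /mapt /= -!map_comp; congr pair; apply: eq_map => j /=; case: ifP.
  rewrite perm_cat2l.
  rewrite (eq_map (g := mapt (@sga (El (plug X (Mk S))) (El b) i) \o mapt (@fout X S))); last first.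
    by move=> t; apply: mapt_comp2 => z; rewrite fout_CL.
  rewrite [in X in perm_eq _ (_ ++ X ++ _)](eq_map (g := mapt (@sgb (El (plug X (Mk S))) (El b)))); last first.
    by move=> t; apply: mapt_comp => z; rewrite fout_CLb.
  rewrite [in X in perm_eq _ (_ ++ _ ++ X)](eq_map (g := mapt (@sga (El (plug X (Mk S))) (El b) i) \o mapt (@fin X S))); last first.
    by move=> t; symmetry; apply: mapt_comp => z; rewrite fin_CL.
  rewrite catA perm_sym perm_catAC perm_sym perm_cat2r.
  by rewrite [map (_ \o mapt (@fout X S)) _]map_comp [map (_ \o mapt (@fin X S)) _]map_comp -map_cat perm_map.
- rewrite !map_cat -!map_comp -!catA.
  rewrite [in X in perm_eq _ (X ++ _)](eq_map (g := mapt (@sga (El a) (El (plug X (Mk S))) i) \o mapt inl)); last first.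
    by move=> t; rewrite /mapt /= -!map_comp; congr pair; apply: eq_map => j /=; case: ifP.
  rewrite [in X in perm_eq _ (_ ++ X ++ _)](eq_map (g := mapt (@sga (El a) (El (plug X (Mk S))) i))); last first.
    by move=> t; apply: mapt_comp => z; rewrite fout_CRa.
  rewrite !perm_cat2l.
  rewrite [in X in perm_eq _ (X ++ _)](eq_map (g := mapt (@sgb (El a) (El (plug X (Mk S)))) \o mapt (@fout X S))); last first.
    by move=> t; apply: mapt_comp2 => z; rewrite fout_CR.
  rewrite [in X in perm_eq _ (_ ++ X)](eq_map (g := mapt (@sgb (El a) (El (plug X (Mk S)))) \o mapt (@fin X S))); last first.
    by move=> t; symmetry; apply: mapt_comp => z; rewrite fin_CR.
  by rewrite [map (_ \o mapt (@fout X S)) _]map_comp [map (_ \o mapt (@fin X S)) _]map_comp -map_cat perm_map.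
Qed.


Lemma Zs_plug X S :
  perm_eq (Zs (plug X (Mk S))) (map (@fout X S) (Zs (plug X (Mk Leaf))) ++ map (@fin X S) (Zs S)).
Proof.
elim: X => [|i own x X IH b|i own x a X IH|X IH] /=.
- rewrite cats0 -map_comp (eq_map (f := @fin CH S) (g := id)) ?map_id; last first.
    by move=> y; rewrite fin_CH.
  exact: perm_refl.
- rewrite map_cat -!map_comp.
  rewrite (eq_map (f := @fout (CL i own x X b) S \o @sga (El (plug X (Mk Leaf))) (El b) i)
    (g := sga i \o @fout X S)); last by move=> y; apply: fout_CL.
  rewrite (eq_map (f := @fout (CL i own x X b) S \o @sgb (El (plug X (Mk Leaf))) (El b)) (g := @sgb (El (plug X (Mk S))) (El b))); last first.
    by case.
  rewrite (eq_map (f := @fin (CL i own x X b) S) (g := sga i \o @fin X S)); last by move=> y; apply: fin_CL.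
  rewrite perm_sym perm_catAC perm_sym perm_cat2r.
  by rewrite [map (_ \o @fout X S) _]map_comp [map (_ \o @fin X S) _]map_comp -map_cat perm_map.
- rewrite map_cat -!map_comp.
  rewrite (eq_map (f := @fout (CR i own x a X) S \o @sga (El a) (El (plug X (Mk Leaf))) i)
    (g := @sga (El a) (El (plug X (Mk S))) i)); last by move=> [j|y] //=; case: ifP.
  rewrite (eq_map (f := @fout (CR i own x a X) S \o @sgb (El a) (El (plug X (Mk Leaf)))) (g := sgb \o @fout X S)); last first.
    by move=> y; apply: fout_CR.
  rewrite (eq_map (f := @fin (CR i own x a X) S) (g := sgb \o @fin X S)); last by move=> y; apply: fin_CR.
  rewrite -catA perm_cat2l.
  by rewrite [map (_ \o @fout X S) _]map_comp [map (_ \o @fin X S) _]map_comp -map_cat perm_map.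
- rewrite map_cat -map_comp -catA (eq_map (f := @fout (CM X) S \o inl) (g := inl)) // perm_cat2l.
  exact: IH.
Qed.

Lemma hbag_Zs X j : hbag X j \in Zs (plug X (Mk Leaf)).
Proof.
elim: X => [|i own x X IH b|i own x a X IH|X IH] /=.
- by rewrite mem_cat map_f ?mem_enum.
- by rewrite mem_cat map_f.
- by rewrite mem_cat map_f ?orbT.
- by rewrite mem_cat IH orbT.
Qed.

Lemma fin_inr X S u : fin X (inr u) = inr (@ein X S u). Proof. by []. Qed.

Lemma AT_out X S u : (eout S u \in AT (plug X (Mk S))) = (u \in AT (plug X (Mk Leaf))).
Proof.
rewrite !inE (perm_mem (Zs_plug X S)) mem_cat; congr negb.
have -> : (inr (eout S u) \in map (@fout X S) (Zs (plug X (Mk Leaf)))) = (inr u \in Zs (plug X (Mk Leaf))).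
  apply/mapP/idP => [[[j|v] vZ //=]|uZ]; last by exists (inr u).
  by case=> e; rewrite (eout_inj e).
case uZ: (inr u \in _) => //=; apply/negbTE/negP=> /mapP[[j|v] vZ /=]; last first.
  by case=> e; apply: (eout_ein e).
move=> ej; have := hbag_Zs X j; case: (hbag X j) ej => //= v [e]; by rewrite -(eout_inj e) uZ.
Qed.

Lemma AT_in X S u : (@ein X S u \in AT (plug X (Mk S))) = (u \in AT S).
Proof.
rewrite !inE (perm_mem (Zs_plug X S)) mem_cat; congr negb.
have -> : (inr (ein X u) \in map (@fout X S) (Zs (plug X (Mk Leaf)))) = false.
  by apply/negbTE/negP=> /mapP[[j|v] vZ //= [] /esym/eout_ein].
apply/mapP/idP => [[[j|v] vZ /=]|uZ]; last by exists (inr u).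
  by case: (hbag X j) => //= v [] /esym/eout_ein.
by case=> e; rewrite (ein_inj e).
Qed.

Lemma fin_inl_Zs X S j : fin X (inl j) \in Zs (plug X (Mk S)).
Proof.
rewrite (perm_mem (Zs_plug X S)) mem_cat; apply/orP; left.
exact: (map_f (@fout X S) (hbag_Zs X j)).
Qed.

Lemma all_inr (A B : eqType) (s : seq (A + B)) : (forall a, inl a \notin s) -> exists s', s = map inr s'.
Proof.
elim: s => [|[a|b] s IH] H; first by exists [::].
  by have := H a; rewrite mem_head.
case: IH => [a|s' ->]; last by exists (b :: s').
by apply: contra (H a); rewrite inE => ->.
Qed.

Lemma map_inr_inj (A B : eqType) : injective (map (@inr A B)).
Proof. by apply: inj_map => x y []. Qed.

(** * Cutting a forest at a mark *)

Section Cut.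
Variables (amx K : nat).
Hypothesis K0 : 0 < K.

Definition hv (T : tree) (y : option 'I_(ncode k amx K)) := vec (cl T) (AT T) y.

(** A tuple of [S] with an open colour gets there an entry of the bag at the mark, which is deleted
    or still open. So a closed surviving tuple lies on one side of the cut. *)
Lemma cut_tuple X S (t : 'I_k * seq (El (plug X (Mk S)))) : t \in cl (plug X (Mk S)) ->
  {subset t.2 <= AT (plug X (Mk S))} ->
  (exists2 t0, t0 \in cl (plug X (Mk Leaf)) & t = mapt (eout S) t0) \/
  (exists2 t0, t0 \in cl S & t = mapt (@ein X S) t0).
Proof.
case: t => R s; rewrite mem_cl (perm_mem (ot_plug X S)) mem_cat => /orP[] /mapP[[R' s0] sX [eR e]] sA; rewrite /= in eR; subst R'.
  left; have [a|s1 es1] := all_inr (s := s0).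
    by apply/negP=> /(map_f (@fout X S)); rewrite -[map _ s0]e => /mapP[w _ /=].
  exists (R, s1); first by rewrite mem_cl -es1.
  congr pair; apply: (@map_inr_inj 'I_c _); rewrite [LHS]e es1 -!map_comp; exact: eq_map.
right; have [a|s1 es1] := all_inr (s := s0).
  apply/negP=> /(map_f (@fin X S)); rewrite -[map _ s0]e => /mapP[u us eu].
  by have := sA u us; rewrite inE -eu fin_inl_Zs.
exists (R, s1); first by rewrite mem_cl -es1.
congr pair; apply: (@map_inr_inj 'I_c _); rewrite [LHS]e es1 -!map_comp; exact: eq_map.
Qed.

Lemma cty_out X S u : wf amx (cl (plug X (Mk S))) ->
  cty amx K (cl (plug X (Mk S))) (AT (plug X (Mk S))) (eout S u) =
  cty amx K (cl (plug X (Mk Leaf))) (AT (plug X (Mk Leaf))) u.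
Proof.
move=> wT; apply: (cty_emb amx K0 (C := setT)) => //.
- by move=> x y _ _; apply: eout_inj.
- by move=> x _; apply: AT_out.
- move=> [R s] sX _ _; rewrite mem_cl (perm_mem (ot_plug X S)) mem_cat.
  rewrite mem_cl in sX; apply/orP; left; apply/mapP; exists (R, map inr s) => //.
  by rewrite /mapt /= -!map_comp; congr pair; apply: eq_map.
- by move=> t /wT/andP[].
- move=> t tT tA v _ vt; case: (cut_tuple tT tA) => [[t0 t0X et]|[t0 t0S et]].
    by exists t0; split=> // w _; rewrite inE.
  by exfalso; move: vt; rewrite et => /mapP[w _ /eout_ein].
Qed.

Lemma cty_in X S u : wf amx (cl (plug X (Mk S))) ->
  cty amx K (cl (plug X (Mk S))) (AT (plug X (Mk S))) (ein X u) = cty amx K (cl S) (AT S) u.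
Proof.
move=> wT; apply: (cty_emb amx K0 (C := setT)) => //.
- by move=> x y _ _; apply: ein_inj.
- by move=> x _; apply: AT_in.
- move=> [R s] sX _ _; rewrite mem_cl (perm_mem (ot_plug X S)) mem_cat.
  rewrite mem_cl in sX; apply/orP; right; apply/mapP; exists (R, map inr s) => //.
  by rewrite /mapt /= -!map_comp; congr pair; apply: eq_map.
- by move=> t /wT/andP[].
- move=> t tT tA v _ vt; case: (cut_tuple tT tA) => [[t0 t0X et]|[t0 t0S et]].
    by exfalso; move: vt; rewrite et => /mapP[w _ /esym/eout_ein].
  by exists t0; split=> // w _; rewrite inE.
Qed.

(* Deleting the bag seen from a mark disconnects the subforest below the mark from the rest. *)
Lemma hv_plug X S y : wf amx (cl (plug X (Mk S))) ->
  hv (plug X (Mk S)) y = hv (plug X (Mk Leaf)) y + hv S y.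
Proof.
move=> wT; rewrite /hv /vec.
set P := [set u | _]; set P1 := [set u | _]; set P2 := [set u | _].
have -> : P = [set eout S u | u in P1] :|: [set ein X u | u in P2].
  apply/setP=> w; rewrite in_setU !in_set.
  have [[u ->]|[u ->]] := ecover w.
    rewrite (cty_out _ wT) (mem_imset _ _ (@eout_inj X S)) in_set -[LHS]orbF; congr orb.
    by symmetry; apply/imsetP => -[v _ /eout_ein].
  rewrite (cty_in _ wT) (mem_imset _ _ (@ein_inj X S)) in_set.
  have -> // : (ein X u \in [set eout S u0 | u0 in P1]) = false.
  by apply/imsetP => -[v _ /esym/eout_ein].
rewrite cardsU (_ : _ :&: _ = set0) ?cards0 ?subn0; last first.
  apply/setP=> w; rewrite in_set0 in_setI.
  by apply/andP=> -[/imsetP[u _ ->] /imsetP[v _ /eout_ein]].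
by rewrite !card_imset; [|apply: ein_inj|apply: eout_inj].
Qed.
End Cut.
End Trees.

(** * Recognizability of CMSO *)

Section Logic.
Variables (k : nat) (ar : 'I_k -> nat).
Implicit Types (g : formula ar).

Definition updv (A : Type) (S : nat + nat -> A) (z : nat + nat) (v : A) : nat + nat -> A :=
  fun y => if y == z then v else S y.

(* All variables range over sets, the value of a first-order variable being a singleton. *)
Fixpoint msat (V : finType) (L : seq ('I_k * seq V)) (S : nat + nat -> {set V}) g : bool :=
  match g with
  | FRel R xs => has (fun t => (t.1 == R) && all2 (fun u x => u \in S (inl x)) t.2 xs) L
  | FEq x y => [exists v, (v \in S (inl x)) && (v \in S (inl y))]
  | FIn x X => [exists v, (v \in S (inl x)) && (v \in S (inr X))]
  | FNot g => ~~ msat L S g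
  | FAnd g h => msat L S g && msat L S h
  | FOr g h => msat L S g || msat L S h
  | FEx x g => [exists v, msat L (updv S (inl x) [set v]) g]
  | FExS X g => [exists A : {set V}, msat L (updv S (inr X) A) g]
  | FMod m x g => m %| #|[set v | msat L (updv S (inl x) [set v]) g]|
  end.

Lemma msat_free (V : finType) (L : seq ('I_k * seq V)) g (S S' : nat + nat -> {set V}) :
  (forall x, x \in free_fo g -> S (inl x) = S' (inl x)) ->
  (forall x, x \in free_so g -> S (inr x) = S' (inr x)) -> msat L S g = msat L S' g.
Proof.
elim: g S S' => [R xs|x y|x X|g IH|g IH h IH'|g IH h IH'|x g IH|X g IH|m x g IH] S S' /= H1 H2.
- apply: eq_has => t; congr andb; elim: t.2 (tval xs) H1 => [|u s IH] [|x ys] //= H1.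
  by rewrite (IH ys) ?H1 ?mem_head // => y ys'; apply: H1; rewrite inE ys' orbT.
- by apply: eq_existsb => v; rewrite !H1 ?inE ?eqxx ?orbT.
- by apply: eq_existsb => v; rewrite H1 ?H2 ?inE.
- by rewrite (IH _ S').
- by rewrite (IH _ S') ?(IH' _ S') // => x xg; [apply: H1|apply: H2|apply: H1|apply: H2];
     rewrite mem_cat xg ?orbT.
- by rewrite (IH _ S') ?(IH' _ S') // => x xg; [apply: H1|apply: H2|apply: H1|apply: H2];
     rewrite mem_cat xg ?orbT.
- apply: eq_existsb => v; apply: IH => y yg; last exact: H2.
  rewrite /updv; case: ifP => // /negbT yx; apply: H1; rewrite mem_filter yg andbT.
  by apply: contra yx => /eqP->.
- apply: eq_existsb => A; apply: IH => y yg; first exact: H1.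
  rewrite /updv; case: ifP => // /negbT yx; apply: H2; rewrite mem_filter yg andbT.
  by apply: contra yx => /eqP->.
- congr (_ %| _); apply: eq_card => v; rewrite !inE; apply: IH => y yg; last exact: H2.
  rewrite /updv; case: ifP => // /negbT yx; apply: H1; rewrite mem_filter yg andbT.
  by apply: contra yx => /eqP->.
Qed.

Lemma sat_msat n (D : dbase ar n) (V : finType) (L : seq ('I_k * seq V)) (f : V -> 'I_n) g fo (so : nat -> {set 'I_n})
    (S : nat + nat -> {set V}) :
  bijective f -> (forall R s, ((R, s) \in L) = ((R, map f s) \in dblist D)) ->
  (forall x, fo x < n) -> (forall x, S (inl x) = [set v | f v == fo x :> nat]) ->
  (forall X, S (inr X) = [set v | f v \in so X]) -> sat D fo so g = msat L S g.
Proof.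
move=> fB HL; have [f' fK f'K] := fB; have fI := can_inj fK.
elim: g fo so S => [R xs|x y|x X|g IH|g IH h IH'|g IH h IH'|x g IH|X g IH|m x g IH] fo so S /= H0 H1 H2.
- have E (s : seq V) (ys : seq nat) : all2 (fun u x => u \in S (inl x)) s ys = (map (fun v => nat_of_ord (f v)) s == map fo ys).
    by elim: s ys => [|u s IH] [|y ys] //=; rewrite IH H1 inE eqseq_cons.
  apply/existsP/hasP => [[u /andP[uD /eqP eu]]|[[R' s] sL /= /andP[/eqP eR]]].
    exists (R, map f' u); rewrite /= ?eqxx ?E /=.
      by rewrite HL -map_comp (eq_map (g := id)) ?map_id ?mem_dblist // => v; apply: f'K.
    by rewrite -eu -map_comp; apply/eqP/eq_map => v; rewrite /= f'K.
  subst R'; rewrite E => /eqP es; move: sL; rewrite HL => /dblistP[R' [u [uD [eR eu]]]]; subst R'.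
  exists u; rewrite uD -es; apply/eqP; rewrite -[tval u]eu -map_comp; exact: eq_map.
- apply/idP/existsP => [/eqP xy|[v]]; last by rewrite !H1 !inE => /andP[/eqP<- /eqP<-].
  by exists (f' (Ordinal (H0 x))); rewrite !H1 !inE f'K /= xy eqxx.
- apply/existsP/existsP => [[i /andP[iX ei]]|[v]].
    by exists (f' i); rewrite H1 H2 !inE f'K ei.
  by rewrite H1 H2 !inE => /andP[ev vX]; exists (f v); rewrite vX.
- by rewrite (IH _ _ S).
- by rewrite (IH _ _ S) ?(IH' _ _ S).
- by rewrite (IH _ _ S) ?(IH' _ _ S).
- have E v : sat D (upd fo x (f v)) so g = msat L (updv S (inl x) [set v]) g.
    apply: IH => // y; rewrite /updv /upd.
      by case: ifP.
    rewrite (inj_eq inl_inj); case: ifP => // _.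
    by apply/setP=> w; rewrite !inE (inj_eq val_inj) (inj_eq fI).
  apply/existsP/existsP => [[i Hi]|[v Hv]]; last by exists (f v); rewrite E.
  by exists (f' i); rewrite -E f'K.
- have E A : sat D fo (upd so X A) g = msat L (updv S (inr X) [set v | f v \in A]) g.
    apply: IH => // y; rewrite /updv /upd (inj_eq inr_inj); case: ifP => //.
  apply/existsP/existsP => [[A HA]|[B HB]]; first by exists [set v | f v \in A]; rewrite -E.
  exists (f @: B); rewrite E; move: HB; congr (is_true (msat _ (updv _ _ _) _)).
  by apply/setP=> v; rewrite inE mem_imset.
- have E v : sat D (upd fo x (f v)) so g = msat L (updv S (inl x) [set v]) g.
    apply: IH => // y; rewrite /updv /upd.
      by case: ifP.
    rewrite (inj_eq inl_inj); case: ifP => // _.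
    by apply/setP=> w; rewrite !inE (inj_eq val_inj) (inj_eq fI).
  congr (_ %| _); rewrite -[RHS](card_imset _ fI); apply: eq_card => i; rewrite inE.
  by rewrite -{1 2}(f'K i) E mem_imset // inE.
Qed.
End Logic.

Lemma card_partition (A B : finType) (h : pred B) (G : A -> B) :
  #|[set u | h (G u)]| = \sum_(q | h q) #|[set u | G u == q]|.
Proof.
rewrite -sum1dep_card (partition_big G h) //=.
apply: eq_bigr => q hq; rewrite -sum1dep_card; apply: eq_bigl => u.
by case: eqP => [->|]; rewrite ?andbF ?andbT.
Qed.

(** Residues modulo [m], where modulus 0 means the distinction between zero and positive, in
    accordance with [0 %| n] being [n == 0]. This treats existence as a special case of modular
    counting. *)
Definition red (m n : nat) : nat := if m == 0 then minn n 1 else n %% m.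

Lemma red_lt m n : red m n < m.+2.
Proof. by rewrite /red; case: m => [|m] /=; [lia|have := ltn_pmod n (ltn0Sn m); lia]. Qed.

Lemma redD m a b : red m (red m a + red m b) = red m (a + b).
Proof. by rewrite /red; case: m => [|m] /=; [lia|rewrite modnDm]. Qed.

Lemma redDl m a b : red m (red m a + b) = red m (a + b).
Proof. by rewrite /red; case: m => [|m] /=; [lia|rewrite modnDml]. Qed.

Lemma redDr m a b : red m (a + red m b) = red m (a + b).
Proof. by rewrite addnC redDl addnC. Qed.

Lemma red_sum m (I : finType) (P : pred I) (F : I -> nat) :
  red m (\sum_(i | P i) red m (F i)) = red m (\sum_(i | P i) F i).
Proof.
apply: (big_ind2 (fun a b => red m a = red m b)) => // [a a' b b' ea eb|i _].
  by rewrite -redD ea eb redD.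
by have := redDl m (F i) 0; rewrite !addn0.
Qed.

Lemma dvdn_red m n : (m %| red m n) = (m %| n).
Proof. by rewrite /red; case: m => [|m] /=; [rewrite !dvd0n; lia|rewrite /dvdn modn_mod]. Qed.

Section Recognition.
Variables (k c : nat) (ar : 'I_k -> nat).
Local Notation tree := (tree k c).
Local Notation asg T := (nat + nat -> {set El T}).

Definition Sl (a b : tree) (S : nat + nat -> {set option (El a + El b)}) : asg a :=
  fun z => [set u | Some (inl u) \in S z].
Definition Sr (a b : tree) (S : nat + nat -> {set option (El a + El b)}) : asg b :=
  fun z => [set u | Some (inr u) \in S z].
Definition mks (a b : tree) (S : nat + nat -> {set option (El a + El b)}) : nat + nat -> bool :=
  fun z => None \in S z.

(** Evaluation by a deterministic bottom-up tree automaton: the letter of a node consists of its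
    colour, its tuples and its membership in the values of the variables. Names are invisible and
    marks transparent. *)
Definition recognizable (P : forall T : tree, asg T -> bool) : Prop :=
  exists (Q : finType) (F : forall T : tree, asg T -> Q)
    (op : 'I_c -> seq ('I_k * seq 'I_c) -> (nat + nat -> bool) -> Q -> Q -> Q) (q0 : Q) (acc : Q -> bool),
  [/\ forall S, F (@Leaf k c) S = q0,
      forall i own x a b S, F (Node i own x a b) S = op i own (@mks a b S) (F a (Sl S)) (F b (Sr S)),
      forall a S, F (Mk a) S = F a S
    & forall T S, P T S = acc (F T S)].

Lemma exists_El (a b : tree) (P : pred (option (El a + El b))) :
  [exists v, P v] = [|| P None, [exists u, P (Some (inl u))] | [exists u, P (Some (inr u))]].
Proof.
apply/existsP/or3P => [[[[u|u]|] Pu]|[Pu|/existsP[u Pu]|/existsP[u Pu]]].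
- by apply: Or32; apply/existsP; exists u.
- by apply: Or33; apply/existsP; exists u.
- exact: Or31.
- by exists None.
- by exists (Some (inl u)).
- by exists (Some (inr u)).
Qed.

Lemma card_El (a b : tree) (P : pred (option (El a + El b))) :
  #|[set v | P v]| = P None + #|[set u | P (Some (inl u))]| + #|[set u | P (Some (inr u))]|.
Proof.
rewrite -!sum1dep_card big_mkcond (bigD1 None) //= (reindex_omap Some id) /=; last by case.
rewrite (eq_bigl predT); last by move=> u; rewrite /= eqxx.
rewrite big_sumType /= addnA.
by rewrite -!big_mkcond; case: (P None).
Qed.

Lemma recog_meet (z1 z2 : nat + nat) :
  recognizable (fun (T : tree) (S : asg T) => [exists v, (v \in S z1) && (v \in S z2)]).
Proof.
exists bool, (fun (T : tree) (S : asg T) => [exists v, (v \in S z1) && (v \in S z2)]),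
  (fun i own m qa qb => [|| m z1 && m z2, qa | qb]), false, id; split=> //.
  by move=> S; apply/existsP=> -[[]].
move=> i own x a b S /=; rewrite exists_El; congr [|| _, _ | _];
  by apply: eq_existsb => u; rewrite !inE.
Qed.

Definition topt (A : Type) (z : 'I_c + A) : option 'I_c := if z is inl j then Some j else None.
Definition okp (A : finType) (S : nat + nat -> {set A}) (z : 'I_c + A) (x : nat) : bool :=
  if z is inr u then u \in S (inl x) else true.

(** Partial matches of the atom: a position is [Some j] while its entry is the open colour [j], and
    [None] once the entry is an element, which then lies in the value of its variable. *)
Definition pats (R : 'I_k) (xs : seq nat) (T : tree) (S : asg T) : seq (seq (option 'I_c)) :=
  [seq map (@topt _) t.2 | t <- ot T & (t.1 == R) && all2 (okp S) t.2 xs].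

Definition okc (i : 'I_c) (m : nat + nat -> bool) (p : option 'I_c) (x : nat) : bool :=
  (p == Some i) ==> m (inl x).
Definition stepp (i : 'I_c) (p : option 'I_c) : option 'I_c := if p == Some i then None else p.

Lemma pats_node R xs i own x (a b : tree) S :
  pats R xs (T := Node i own x a b) S =
  [seq map (stepp i \o Some) t.2 | t <- own & (t.1 == R) && all2 (okc i (@mks a b S)) (map Some t.2) xs]
  ++ [seq map (stepp i) p | p <- pats R xs (@Sl a b S) & all2 (okc i (@mks a b S)) p xs]
  ++ pats R xs (@Sr a b S).
Proof.
rewrite /pats /= map_cat !filter_cat !map_cat -catA; congr (_ ++ (_ ++ _)).
- rewrite !filter_map -!map_comp; set p1 := preim _ _.
  rewrite (@eq_filter _ p1 (fun t => (t.1 == R) && all2 (okc i (@mks a b S)) (map Some t.2) xs)); last first.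
    move=> t; rewrite /p1 /= {p1}; congr andb; elim: t.2 xs => [|j s IH] [|y ys] //=.
    by rewrite -IH /okc (inj_eq Some_inj); case: ifP.
  apply: eq_map => t /=; rewrite -!map_comp; apply: eq_map => j /=.
  by rewrite /stepp (inj_eq Some_inj); case: ifP.
- rewrite !filter_map -!map_comp -filter_predI; set p1 := preim _ _; set p2 := predI _ _.
  rewrite (@eq_filter _ p1 p2); last first.
    move=> t; rewrite /p1 /p2 /= {p1 p2} andbCA; congr andb; elim: t.2 xs => [|z s IH] [|y ys] //=.
    rewrite IH andbACA; congr andb; case: z => [j|u] /=; rewrite /okc /okp ?inE //= ?andbT.
      by rewrite (inj_eq Some_inj); case: ifP.
  apply: eq_map => t /=; rewrite -!map_comp; apply: eq_map => -[j|u] //=.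
  by rewrite /stepp (inj_eq Some_inj); case: ifP.
rewrite filter_map -map_comp; set p1 := preim _ _.
rewrite (@eq_filter _ p1 (fun t => (t.1 == R) && all2 (okp (@Sr a b S)) t.2 xs)); last first.
  move=> t; rewrite /p1 /= {p1}; congr andb; elim: t.2 xs => [|z s IH] [|y ys] //=.
  by rewrite IH; congr andb; case: z => [j|u] //=; rewrite inE.
by apply: eq_map => t /=; rewrite -map_comp; apply: eq_map => -[].
Qed.

Lemma pats_size R xs (T : tree) S p : p \in pats R xs (T := T) S -> size p = size xs.
Proof.
case/mapP=> t; rewrite mem_filter => /andP[/andP[_ H] _] ->; rewrite size_map.
by elim: t.2 xs H => [|z s IH] [|y ys] //= /andP[_ /IH->].
Qed.

(** The state is the set of partial matches, of which there are finitely many because a pattern has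
    fixed length. Acceptance asks for the pattern with all entries bound. *)
Lemma recog_rel (R : 'I_k) (n : nat) (xs : n.-tuple nat) :
  recognizable (fun (T : tree) (S : asg T) => has (fun t => (t.1 == R) && all2 (fun u x => u \in S (inl x)) t.2 xs) (cl T)).
Proof.

exists {set n.-tuple (option 'I_c)}, (fun (T : tree) (S : asg T) => [set p : n.-tuple (option 'I_c) | tval p \in pats R xs S]).
exists (fun i own m (qa qb : {set n.-tuple (option 'I_c)}) => [set p : n.-tuple (option 'I_c) |
  [|| tval p \in [seq map (stepp i \o Some) t.2 | t <- own & (t.1 == R) && all2 (okc i m) (map Some t.2) xs],
      [exists p' in qa, all2 (okc i m) (tval p') xs && (tval p == map (stepp i) (tval p'))] | p \in qb]]).
exists set0, (fun q : {set n.-tuple (option 'I_c)} => nseq_tuple n None \in q); split=> //.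
- move=> i own x a b S; apply/setP=> p; rewrite !inE pats_node !mem_cat; congr [|| _, _ | _].
  apply/mapP/existsP => [[p']|[p']].
    rewrite mem_filter => /andP[ok pp'] ep.
    have sp : size p' == n by rewrite (pats_size pp') size_tuple.
    by exists (Tuple sp); rewrite inE pp' ok ep eqxx.
  by rewrite inE => /and3P[pp' ok /eqP ep]; exists (tval p'); rewrite // mem_filter ok.
- move=> T S; rewrite inE; apply/hasP/mapP => [[[R' s] sT /= /andP[/eqP eR ok]]|[[R' s]]].
    subst R'; exists (R, map inr s).
      rewrite mem_filter -mem_cl sT andbT eqxx /=; elim: s (tval xs) ok {sT} => [|u s IH] [|y ys] //=.
      by case/andP=> -> /IH.
    rewrite -map_comp /=; have : size s = n.
      rewrite -(size_tuple xs); elim: s (tval xs) ok {sT} => [|u s IH] [|y ys] //= /andP[_ /IH->] //.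
    by move <-; elim: s {sT ok} => //= u s ->.
  rewrite mem_filter /= => /andP[/andP[/eqP eR ok] sT] es; subst R'.
  have [j|s' es'] := all_inr (s := s).
    apply/negP=> /(map_f (@topt _)); rewrite -[map _ s]es => /nseqP[].
    by [].
  exists (R, s'); first by rewrite mem_cl -es'.
  rewrite eqxx /=; subst s.
  by elim: s' (tval xs) ok {sT es} => [|u s IH] [|y ys] //= /andP[-> /IH].
Qed.

Lemma Sl_updv (a b : tree) (S : nat + nat -> {set option (El a + El b)}) z A :
  @Sl a b (updv S z A) = updv (@Sl a b S) z [set u | Some (inl u) \in A].
Proof. by apply: functional_extensionality => y; rewrite /Sl /updv; case: ifP. Qed.

Lemma Sr_updv (a b : tree) (S : nat + nat -> {set option (El a + El b)}) z A :
  @Sr a b (updv S z A) = updv (@Sr a b S) z [set u | Some (inr u) \in A].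
Proof. by apply: functional_extensionality => y; rewrite /Sr /updv; case: ifP. Qed.

Lemma mks_updv (a b : tree) (S : nat + nat -> {set option (El a + El b)}) z A :
  @mks a b (updv S z A) = updv (@mks a b S) z (None \in A).
Proof. by apply: functional_extensionality => y; rewrite /mks /updv; case: ifP. Qed.

(** The subset construction: the state collects the states reached under all values of the
    quantified set. The value splits freely into its parts at the node, among the descendants and
    among the siblings. *)
Lemma recog_exS (P : forall T : tree, asg T -> bool) z : recognizable P ->
  recognizable (fun (T : tree) (S : asg T) => [exists A : {set El T}, P T (updv S z A)]).
Proof.
case=> Q [F [op [q0 [acc [F0 FN FM HP]]]]].
exists {set Q}, (fun (T : tree) (S : asg T) => [set q | [exists A : {set El T}, F T (updv S z A) == q]]).
exists (fun i own m (qa qb : {set Q}) => [set q | [exists e : bool, [exists q1 in qa, [exists q2 in qb,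
   q == op i own (updv m z e) q1 q2]]]]).
exists [set q0], (fun qs : {set Q} => [exists q in qs, acc q]); split.
- move=> S; apply/setP=> q; rewrite !inE; apply/existsP/eqP => [[A /eqP<-]|->]; first by rewrite F0.
  by exists set0; rewrite F0.
- move=> i own x a b S; apply/setP=> q; rewrite !inE.
  apply/existsP/existsP => [[A /eqP<-]|[e /existsP[q1 /andP[q1a /existsP[q2 /andP[q2b /eqP->]]]]]].
    exists (None \in A); apply/existsP; exists (F a (@Sl a b (updv S z A))).
    rewrite inE Sl_updv; apply/andP; split; first by apply/existsP; eexists; apply: eqxx.
    apply/existsP; exists (F b (@Sr a b (updv S z A))); rewrite inE Sr_updv.
    apply/andP; split; first by apply/existsP; eexists; apply: eqxx.
    by rewrite FN mks_updv Sl_updv Sr_updv.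
  move: q1a q2b; rewrite !inE => /existsP[A /eqP<-] /existsP[B /eqP<-].
  pose A' : {set option (El a + El b)} :=
    [set u | match u with None => e | Some (inl u) => u \in A | Some (inr u) => u \in B end].
  have e1 : (None \in A') = e by rewrite inE.
  have e2 : [set u | Some (inl u) \in A'] = A by apply/setP=> u; rewrite !inE.
  have e3 : [set u | Some (inr u) \in A'] = B by apply/setP=> u; rewrite !inE.
  by exists A'; rewrite FN mks_updv Sl_updv Sr_updv e1 e2 e3.
- by move=> a S /=; apply/setP=> q; rewrite !inE; apply: eq_existsb => A; rewrite FM.
- move=> T S; apply/existsP/existsP => [[A PA]|[q]].
    exists (F T (updv S z A)); rewrite inE -HP PA andbT; apply/existsP; by exists A.
  by rewrite inE => /andP[/existsP[A /eqP<-]]; rewrite -HP; exists A.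
Qed.

(** The state counts, modulo [m], the choices of the element that lead to each state. It also stores
    the state under the empty value: the chosen element is the node, a descendant or in the sibling
    part, and the other parts are then evaluated without it. *)
Lemma recog_mod (P : forall T : tree, asg T -> bool) z m : recognizable P ->
  recognizable (fun (T : tree) (S : asg T) => m %| #|[set v : El T | P T (updv S z [set v])]|).
Proof.
case=> Q [F [op [q0 [acc [F0 FN FM HP]]]]].
pose num (T : tree) (S : asg T) (q : Q) := #|[set v : El T | F T (updv S z [set v]) == q]|.
pose R n : 'I_m.+2 := Ordinal (red_lt m n).
exists (Q * {ffun Q -> 'I_m.+2})%type,
  (fun (T : tree) (S : asg T) => (F T (updv S z set0), [ffun q => R (num T S q)])).
exists (fun i own mk (qa qb : Q * {ffun Q -> 'I_m.+2}) => (op i own (updv mk z false) qa.1 qb.1,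
  [ffun q => R ((op i own (updv mk z true) qa.1 qb.1 == q)
     + \sum_(q1 | op i own (updv mk z false) q1 qb.1 == q) qa.2 q1
     + \sum_(q2 | op i own (updv mk z false) qa.1 q2 == q) qb.2 q2)])).
exists (q0, [ffun => R 0]), (fun qc : Q * {ffun Q -> 'I_m.+2} => m %| \sum_(q | acc q) qc.2 q).
have s0l (a b : tree) : [set u | Some (inl u) \in (set0 : {set option (El a + El b)})] = set0.
  by apply/setP=> u; rewrite !inE.
have s0r (a b : tree) : [set u | Some (inr u) \in (set0 : {set option (El a + El b)})] = set0.
  by apply/setP=> u; rewrite !inE.
split.
- move=> S; rewrite F0; congr pair; apply/ffunP=> q; rewrite !ffunE; congr R.
  by rewrite /num; apply/eqP; rewrite cards_eq0; apply/eqP/setP=> -[].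
- move=> i own x a b S /=; congr pair.
    by rewrite FN mks_updv Sl_updv Sr_updv s0l s0r inE.
  apply/ffunP=> q; rewrite !ffunE; apply: val_inj => /=; rewrite /num card_El.
  have E u u1 u2 v1 v2 : red m u1 = red m v1 -> red m u2 = red m v2 -> red m (u + u1 + u2) = red m (u + v1 + v2).
    move=> e1 e2; have h : red m (u + u1) = red m (u + v1) by rewrite -redDr e1 redDr.
    by rewrite -[LHS]redD h e2 redD.
  rewrite FN mks_updv Sl_updv Sr_updv in_set1 eqxx.
  have el : [set u | Some (inl u) \in [set None : option (El a + El b)]] = set0 by apply/setP=> u; rewrite !inE.
  have er : [set u | Some (inr u) \in [set None : option (El a + El b)]] = set0 by apply/setP=> u; rewrite !inE.
  rewrite el er; apply: E.
    rewrite (eq_bigr (fun q1 => red m (num a (@Sl a b S) q1))); last by move=> q1 _; rewrite ffunE.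
    rewrite red_sum -(card_partition (fun q1 => op _ _ _ q1 _ == q) (fun u => F a (updv (@Sl a b S) z [set u]))).
    congr red; apply: eq_card => u; rewrite [LHS]in_set [RHS]in_set FN mks_updv Sl_updv Sr_updv.
    have e1 : (None \in [set Some (inl u) : option (El a + El b)]) = false by rewrite !inE.
    have e2 : [set v | Some (inl v) \in [set Some (inl u) : option (El a + El b)]] = [set u].
      by apply/setP=> v; rewrite !inE (inj_eq Some_inj) (inj_eq inl_inj).
    have e3 : [set v | Some (inr v) \in [set Some (inl u) : option (El a + El b)]] = set0.
      by apply/setP=> v; rewrite !inE.
    by rewrite e1 e2 e3.
  rewrite (eq_bigr (fun q1 => red m (num b (@Sr a b S) q1))); last by move=> q1 _; rewrite ffunE.
  rewrite red_sum -(card_partition (fun q1 => op _ _ _ _ q1 == q) (fun u => F b (updv (@Sr a b S) z [set u]))).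
  congr red; apply: eq_card => u; rewrite [LHS]in_set [RHS]in_set FN mks_updv Sl_updv Sr_updv.
  have e1 : (None \in [set Some (inr u) : option (El a + El b)]) = false by rewrite !inE.
  have e2 : [set v | Some (inl v) \in [set Some (inr u) : option (El a + El b)]] = set0.
    by apply/setP=> v; rewrite !inE.
  have e3 : [set v | Some (inr v) \in [set Some (inr u) : option (El a + El b)]] = [set u].
    by apply/setP=> v; rewrite !inE (inj_eq Some_inj) (inj_eq inr_inj).
  by rewrite e1 e2 e3.
- by move=> a S /=; rewrite FM; congr pair; apply/ffunP=> q; rewrite !ffunE; congr R;
    apply: eq_card => u; rewrite !inE FM.
- move=> T S; rewrite -dvdn_red -[in RHS]dvdn_red; congr (_ %| _).
  rewrite (eq_bigr (fun q => red m (num T S q))); last by move=> q _; rewrite ffunE.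
  rewrite red_sum; congr red; rewrite -(card_partition acc (fun v => F T (updv S z [set v]))).
  by apply: eq_card => v; rewrite !inE HP.
Qed.

Lemma recog_bool2 (f : bool -> bool -> bool) (P P' : forall T : tree, asg T -> bool) :
  recognizable P -> recognizable P' -> recognizable (fun (T : tree) (S : asg T) => f (P T S) (P' T S)).
Proof.
case=> Q [F [op [q0 [acc [F0 FN FM HP]]]]] [Q' [F' [op' [q0' [acc' [F0' FN' FM' HP']]]]]].
exists (Q * Q')%type, (fun (T : tree) (S : asg T) => (F T S, F' T S)),
  (fun i own m qa qb => (op i own m qa.1 qb.1, op' i own m qa.2 qb.2)), (q0, q0'),
  (fun q => f (acc q.1) (acc' q.2)).
by split=> [S|i own x a b S|a S|T S] /=; rewrite ?F0 ?F0' ?FN ?FN' ?FM ?FM' ?HP ?HP'.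
Qed.

Lemma recog_msat (g : formula ar) : recognizable (fun (T : tree) (S : asg T) => msat (cl T) S g).
Proof.
elim: g => [R xs|x y|x X|g IH|g IH h IH'|g IH h IH'|x g IH|X g IH|m x g IH] /=.
- exact: recog_rel.
- exact: recog_meet.
- exact: recog_meet.
- exact: (recog_bool2 (fun b _ => ~~ b) IH IH).
- exact: (recog_bool2 andb IH IH').
- exact: (recog_bool2 orb IH IH').
(* Existence is the negation of counting with modulus 0, which holds exactly when no element
   satisfies the formula. *)
- have H := recog_mod (inl x) 0 IH; have [Q [F [op [q0 [acc [F0 FN FM HP]]]]]] := recog_bool2 (fun b _ => ~~ b) H H.
  exists Q, F, op, q0, acc; split=> // T S; rewrite -HP dvd0n cards_eq0.
  apply/existsP/set0Pn => [[v Hv]|[v]]; first by exists v; rewrite inE.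
  by rewrite inE; exists v.
- exact: (recog_exS (inr X) IH).
- exact: (recog_mod (inl x) m IH).
Qed.

Section Degree.
Variable d : nat.

Definition otdeg (T : tree) (z : 'I_c + El T) : nat := count (fun t => z \in t.2) (ot T).
Definition degok (T : tree) : bool := [forall u : El T, otdeg (inr u) <= d].

Lemma mem_map_sga i (a b : tree) (s : seq ('I_c + El a)) :
  [/\ forall j, (inl j \in map (@sga c (El a) (El b) i) s) = (j != i) && (inl j \in s),
      (inr None \in map (@sga c (El a) (El b) i) s) = (inl i \in s),
      forall u, (inr (Some (inl u)) \in map (@sga c (El a) (El b) i) s) = (inr u \in s) &
      forall u, (inr (Some (inr u)) \in map (@sga c (El a) (El b) i) s) = false].
Proof.
split=> [j||u|u].
- apply/mapP/andP => [[[j'|u] zs //=]|[ji js]].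
    by case: ifP => // /negbT j'i [->].
  by exists (inl j) => //=; rewrite (negPf ji).
- apply/mapP/idP => [[[j'|u] zs //=]|js].
    by case: ifP => // /eqP <-.
  by exists (inl i) => //=; rewrite eqxx.
- apply/mapP/idP => [[[j'|v] zs //=]|us]; [by case: ifP|by case=> ->|by exists (inr u)].
- by apply/mapP=> -[[j'|v] zs //=]; case: ifP.
Qed.

Lemma mem_map_sgb (a b : tree) (s : seq ('I_c + El b)) :
  [/\ forall j, (inl j \in map (@sgb c (El a) (El b)) s) = (inl j \in s),
      (inr None \in map (@sgb c (El a) (El b)) s) = false,
      forall u, (inr (Some (inl u)) \in map (@sgb c (El a) (El b)) s) = false &
      forall u, (inr (Some (inr u)) \in map (@sgb c (El a) (El b)) s) = (inr u \in s)].
Proof.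
split=> [j||u|u].
- by apply/mapP/idP => [[[j'|u] zs //= [->]] //|js]; exists (inl j).
- by apply/mapP=> -[[j'|u]].
- by apply/mapP=> -[[j'|v]].
- by apply/mapP/idP => [[[j'|v] zs //= [->]] //|us]; exists (inr u).
Qed.

Lemma otdeg_node i own x (a b : tree) :
  [/\ forall j, otdeg (T := Node i own x a b) (inl j) =
         (if j == i then 0 else count (fun t => j \in t.2) own + otdeg (T := a) (inl j)) + otdeg (T := b) (inl j),
      otdeg (T := Node i own x a b) (inr None) = count (fun t => i \in t.2) own + otdeg (T := a) (inl i),
      forall u, otdeg (T := Node i own x a b) (inr (Some (inl u))) = otdeg (T := a) (inr u) &
      forall u, otdeg (T := Node i own x a b) (inr (Some (inr u))) = otdeg (T := b) (inr u)].
Proof.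
have own_l (j : 'I_c) (s : seq 'I_c) : ((inl j : 'I_c + El a) \in map inl s) = (j \in s).
  by apply: mem_map => u v [].
have own_r (u : El a) (s : seq 'I_c) : ((inr u : 'I_c + El a) \in map inl s) = false.
  by apply/mapP=> -[].
rewrite /otdeg /=; split=> [j||u|u]; rewrite !count_cat !count_map count_cat count_map.
- rewrite (eq_count (a2 := fun t => (j != i) && (j \in t.2))); last first.
    by move=> t /=; have [-> _ _ _] := @mem_map_sga i a b (map inl t.2); rewrite own_l.
  rewrite (eq_count (a2 := fun t => (j != i) && (inl j \in t.2))); last first.
    by move=> t /=; have [-> _ _ _] := @mem_map_sga i a b t.2.
  rewrite (eq_count (a1 := preim (mapt (@sgb c (El a) (El b))) _) (a2 := fun t => inl j \in t.2)); last first.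
    by move=> t /=; have [-> _ _ _] := @mem_map_sgb a b t.2.
  by congr (_ + _); case: eqP => //= _; rewrite !count_pred0.
- rewrite (eq_count (a2 := fun t => i \in t.2)); last first.
    by move=> t /=; have [_ -> _ _] := @mem_map_sga i a b (map inl t.2); rewrite own_l.
  rewrite (eq_count (a2 := fun t => inl i \in t.2)); last first.
    by move=> t /=; have [_ -> _ _] := @mem_map_sga i a b t.2.
  rewrite (eq_count (a1 := preim (mapt (@sgb c (El a) (El b))) _) (a2 := pred0)) ?count_pred0 ?addn0 //.
  by move=> t /=; have [_ -> _ _] := @mem_map_sgb a b t.2.
- rewrite (eq_count (a2 := pred0)); last first.
    by move=> t /=; have [_ _ -> _] := @mem_map_sga i a b (map inl t.2); rewrite own_r.
  rewrite (eq_count (a2 := fun t => inr u \in t.2)); last first.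
    by move=> t /=; have [_ _ -> _] := @mem_map_sga i a b t.2.
  rewrite (eq_count (a1 := preim (mapt (@sgb c (El a) (El b))) _) (a2 := pred0)) ?count_pred0 ?addn0 //.
  by move=> t /=; have [_ _ -> _] := @mem_map_sgb a b t.2.
- rewrite (eq_count (a2 := pred0)); last first.
    by move=> t /=; have [_ _ _ ->] := @mem_map_sga i a b (map inl t.2).
  rewrite (eq_count (a2 := pred0)); last first.
    by move=> t /=; have [_ _ _ ->] := @mem_map_sga i a b t.2.
  rewrite (eq_count (a1 := preim (mapt (@sgb c (El a) (El b))) _) (a2 := fun t => inr u \in t.2)) ?count_pred0 //.
  by move=> t /=; have [_ _ _ ->] := @mem_map_sgb a b t.2.
Qed.

Lemma minn_lt n : minn n d.+1 < d.+2. Proof. by rewrite ltnS geq_minr. Qed.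

Definition capd n : 'I_d.+2 := Ordinal (minn_lt n).

(** The degree of a node is known when its colour is closed: its tuples are its own ones and those
    of its descendants that use its colour. Counts per open colour are capped at [d.+1], which
    preserves comparison with [d]. *)
Lemma degok_auto : exists (Q : finType) (F : tree -> Q) (op : 'I_c -> seq ('I_k * seq 'I_c) -> Q -> Q -> Q)
    (acc : Q -> bool), [/\ forall i own x a b, F (Node i own x a b) = op i own (F a) (F b),
      forall a, F (Mk a) = F a & forall T, degok T = acc (F T)].
Proof.
exists (bool * {ffun 'I_c -> 'I_d.+2})%type, (fun T => (degok T, [ffun j => capd (otdeg (T := T) (inl j))])).
exists (fun (i : 'I_c) (own : seq ('I_k * seq 'I_c)) (qa qb : bool * {ffun 'I_c -> 'I_d.+2}) => ([&& count (fun t => i \in t.2) own + (qa.2 i : nat) <= d, qa.1 & qb.1],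
  [ffun j => capd ((if j == i then 0 else count (fun t => j \in t.2) own + (qa.2 j : nat)) + (qb.2 j : nat))])), fst.
split=> // i own x a b; have [H1 H2 H3 H4] := otdeg_node i own x a b.
congr pair; last first.
  apply/ffunP=> j; rewrite !ffunE; apply: val_inj; rewrite /= H1.
  have aux1 z : minn (0 + z) d.+1 = minn (0 + minn z d.+1) d.+1 by lia.
  have aux2 u y z : minn (u + y + z) d.+1 = minn (u + minn y d.+1 + minn z d.+1) d.+1 by lia.
  by case: ifP => _; [apply: aux1|apply: aux2].
have aux3 u y : (u + minn y d.+1 <= d) = (u + y <= d) by lia.
rewrite ffunE /=.
have -> : (count (fun t => i \in t.2) own + minn (otdeg (T := a) (inl i)) d.+1 <= d) =
    (otdeg (T := Node i own x a b) (inr None) <= d).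
  by rewrite H2 aux3.
apply/forallP/and3P => [H|[h0 /forallP ha /forallP hb] [[u|u]|] //].
- by split; [exact: H|apply/forallP=> u; rewrite -H3|apply/forallP=> u; rewrite -H4].
- by rewrite H3.
- by rewrite H4.
Qed.
End Degree.

(** Sentence and degree bound are tracked together, so that forests obtained by replacing subforests
    of equal state stay in the class; the number of colours takes care of the tree-width. *)
Theorem tree_state (g : formula ar) (d : nat) : exists (Q : finType) (F : tree -> Q),
  (forall X S S', F S = F S' -> F (plug X S) = F (plug X S')) /\ (forall S, F (Mk S) = F S) /\
  (forall T T', F T = F T' -> msat (cl T) (fun _ => set0) g = msat (cl T') (fun _ => set0) g
     /\ degok d T = degok d T').
Proof.
have [Q [F [op [q0 [acc [_ FN FM HP]]]]]] := recog_msat g.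
have [Q' [F' [op' [acc' [FN' FM' HP']]]]] := degok_auto d.
pose G (T : tree) := (F T (fun _ => set0), F' T).
have GN i own x a b : G (Node i own x a b) = (op i own (fun _ => false) (G a).1 (G b).1, op' i own (G a).2 (G b).2).
  have e1 : @mks a b (fun _ => set0) = fun _ => false.
    by apply: functional_extensionality => z; rewrite /mks inE.
  have e2 : @Sl a b (fun _ => set0) = fun _ => set0.
    by apply: functional_extensionality => z; apply/setP=> u; rewrite !inE.
  have e3 : @Sr a b (fun _ => set0) = fun _ => set0.
    by apply: functional_extensionality => z; apply/setP=> u; rewrite !inE.
  by rewrite /G FN FN' e1 e2 e3.
have GM a : G (Mk a) = G a by rewrite /G FM FM'.
exists (Q * Q')%type, G; split; last first.
  by split=> // T T' [eF eF']; rewrite !HP !HP' eF eF'.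
by elim=> [|i own x X IH b|i own x a X IH|X IH] S S' e //=; rewrite ?GN ?GM (IH _ _ e).
Qed.
End Recognition.

(** * Cutting and pumping trees *)

Lemma scale_le n n' m e B : e < B.+1 -> n * ((m * n' %/ n).+1 * e) <= n' * (m * e) + n * B.
Proof.
move=> eB; have := leq_trunc_div (m * n') n; move: (_ %/ _) => q h.
have h1 := leq_mul h (leqnn e); have h2 : n * e <= n * B by rewrite leq_mul2l -ltnS eB orbT.
nia.
Qed.

Lemma scale_ge n n' m e : 0 < n -> n' * (m * e) <= n * ((m * n' %/ n).+1 * e).
Proof.
move=> n0; have := ltn_ceil (m * n') n0; move: (_ %/ _) => q h.
have h1 := leq_mul (ltnW h) (leqnn e); nia.
Qed.

Section Sizes.
Variables (k c : nat).
Local Notation tree := (tree k c).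

Fixpoint nd (T : tree) : nat :=
  match T with Leaf => 0 | Node _ _ _ a b => (nd a + nd b).+1 | Mk a => nd a end.

Fixpoint tsz (T : tree) : nat :=
  match T with Leaf => 0 | Node _ _ _ a b => (tsz a + tsz b).+1 | Mk a => (tsz a).+1 end.

Fixpoint marks (T : tree) : nat :=
  match T with Leaf => 0 | Node _ _ _ a b => marks a + marks b | Mk a => (marks a).+1 end.

(* Number of nodes of the topmost cluster. *)
Fixpoint osz (T : tree) : nat :=
  match T with Leaf => 0 | Node _ _ _ a b => (osz a + osz b).+1 | Mk a => 0 end.

Fixpoint okK (K : nat) (T : tree) : bool :=
  match T with Leaf => true | Node _ _ _ a b => okK K a && okK K b | Mk a => (osz a <= K) && okK K a end.

Fixpoint wft (ar : 'I_k -> nat) (T : tree) : bool :=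
  match T with
  | Leaf => true
  | Node _ own _ a b => [&& all (fun t => size t.2 == ar t.1) own, wft ar a & wft ar b]
  | Mk a => wft ar a
  end.

Lemma card_El_nd (T : tree) : #|El T| = nd T.
Proof.
elim: T => [|i own x a IHa b IHb|a IH] /=; first by rewrite card_void.
  by rewrite card_option card_sum IHa IHb.
exact: IH.
Qed.

Lemma nd_plug X S : nd (plug X (Mk S)) = nd (plug X (@Mk k c (@Leaf k c))) + nd S.
Proof. by elim: X => [|i own x X IH b|i own x a X IH|X IH] //=; rewrite ?IH; lia. Qed.

Lemma marks_plug X S : marks (plug X (Mk S)) = marks (plug X (@Mk k c (@Leaf k c))) + marks S.
Proof. by elim: X => [|i own x X IH b|i own x a X IH|X IH] //=; rewrite ?IH; lia. Qed.

Lemma marks_plug_gt0 X (S : tree) : marks S < marks (plug X (Mk S)).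
Proof. by elim: X => [|i own x X IH b|i own x a X IH|X IH] //=; lia. Qed.

Lemma tsz_plug X S : tsz (plug X (Mk S)) = tsz (plug X (@Mk k c (@Leaf k c))) + tsz S.
Proof. by elim: X => [|i own x X IH b|i own x a X IH|X IH] //=; rewrite ?IH; lia. Qed.

Lemma tsz_plug_lt X (S : tree) : tsz S < tsz (plug X (Mk S)).
Proof. by elim: X => [|i own x X IH b|i own x a X IH|X IH] //=; lia. Qed.

Lemma osz_plug X (S S' : tree) : osz (plug X (Mk S)) = osz (plug X (Mk S')).
Proof. by elim: X => [|i own x X IH b|i own x a X IH|X IH] //=; rewrite IH. Qed.

Lemma ok_plug K X (S S' : tree) : okK K (plug X (Mk S)) -> okK K S' -> osz S' <= K ->
  [/\ okK K S, osz S <= K & okK K (plug X (Mk S'))].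
Proof.
elim: X => [|i own x X IH b|i own x a X IH|X IH] /=.
- by move=> /andP[-> ->] -> ->.
- by move=> /andP[oX ->] oS' sS'; have [-> -> ->] := IH oX oS' sS'.
- by move=> /andP[-> oX] oS' sS'; have [-> -> ->] := IH oX oS' sS'.
- by move=> /andP[sX oX] oS' sS'; have [-> -> ->] := IH oX oS' sS'; rewrite (osz_plug _ _ S) sX.
Qed.

Lemma wft_plug ar X (S : tree) : wft ar (plug X (Mk S)) = wft ar (plug X (Mk (@Leaf k c))) && wft ar S.
Proof.
elim: X => [|i own x X IH b|i own x a X IH|X IH] //=; rewrite IH //.
- by rewrite -!andbA; congr andb; rewrite andbCA [RHS]andbC andbA [X in X = _]andbC andbA andbC.
- by rewrite !andbA.
Qed.

Lemma wft_ot ar (T : tree) t : wft ar T -> t \in ot T -> size t.2 = ar t.1.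
Proof.
elim: T t => [|i own x a IHa b IHb|a IH] //= t /and3P[/allP wo wa wb].
rewrite mem_cat => /orP[] /mapP[t0 t0T ->]; rewrite size_map; last exact: IHb.
by move: t0T; rewrite mem_cat => /orP[/mapP[t1 /wo /eqP w1 ->]|/(IHa _ wa)] //; rewrite size_map.
Qed.

Lemma wft_wf (ar : 'I_k -> nat) amx (T : tree) : (forall R, 0 < ar R <= amx) -> wft ar T -> wf amx (cl T).
Proof.
move=> har wT [R s]; rewrite mem_cl => /(wft_ot wT) /=; rewrite size_map => es.
by have /andP[h1 h2] := har R; rewrite -es in h1 h2; rewrite h2 andbT; case: s es h1 h2.
Qed.

(** The condition on [S] guarantees that the part above the mark is smaller than [T], which the
    induction over cuts needs. *)
Lemma ctx_split (T : tree) : (exists X S, T = plug X (Mk S) /\ S <> @Leaf k c) \/ nd T = osz T.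
Proof.
elim: T => [|i own x a IHa b IHb|a IH] /=; first by right.
- case: IHa => [[X [S [-> nS]]]|ea]; first by left; exists (CL i own x X b), S.
  case: IHb => [[X [S [-> nS]]]|eb]; first by left; exists (CR i own x a X), S.
  by right; rewrite ea eb.
- case: a IH => [|i own x a b|a] IH; first by right.
    by left; exists (CH k c), (Node i own x a b).
  by left; exists (CH k c), (Mk a).
Qed.

Lemma size_Zs (T : tree) : size (Zs T) = c * marks T.
Proof.
elim: T => [|i own x a IHa b IHb|a IH] /=; first by rewrite muln0.
  by rewrite size_cat !size_map IHa IHb mulnDr.
by rewrite size_cat size_map IH size_enum_ord mulnS.
Qed.

Section None_count.
Variables (ar : 'I_k -> nat) (amx K : nat).
Hypothesis har : forall R, 0 < ar R <= amx.
Hypothesis K0 : 0 < K.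

Lemma hv_le (T : tree) (y : option 'I_(ncode k amx K)) : hv T y <= nd T.
Proof. by rewrite -card_El_nd /hv /vec; apply: max_card. Qed.

(** Cut at marks until single clusters remain. A cluster has at most [K] nodes, so no component in
    it is too large and [None] means deleted; a mark deletes at most [c] elements. *)
Lemma hv_None (T : tree) : wft ar T -> okK K T -> osz T <= K ->
  hv T (None : option 'I_(ncode k amx K)) <= c * marks T.
Proof.
have [m] := ubnP (tsz T); elim: m T => // m IH T /ltnSE Tm wT oT sT.
have [[X [S [eT nS]]]|e] := ctx_split T; last first.
  rewrite -size_Zs.
  have : #|[set u : El T | cty amx K (cl T) (AT T) u == None]| <= #|[set u : El T | inr u \in Zs T]|.
    apply: subset_leq_card; apply/subsetP=> u; rewrite !in_set ctyE inE.
    rewrite (leq_trans (max_card _)) ?card_El_nd ?e // andbT.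
    by case: (inr u \in Zs T).
  move=> h; apply: leq_trans h _.
  rewrite cardE -(size_map (@inr 'I_c (El T))); apply: uniq_leq_size.
    by rewrite map_inj_uniq ?enum_uniq // => u v [].
  by move=> z /mapP[u]; rewrite mem_enum in_set => uZ ->.
subst T; move: wT; rewrite wft_plug => /andP[wX wS].
rewrite marks_plug mulnDr (hv_plug K0); last by apply: (wft_wf har); rewrite wft_plug wX.
have [oS sS oX] := ok_plug (S' := @Leaf k c) oT isT (leq0n _).
have tS : 0 < tsz S by clear - nS; case: S nS.
apply: leq_add; apply: IH => //.
- by rewrite tsz_plug in Tm; lia.
- by rewrite (osz_plug _ _ S).
- by have := tsz_plug_lt X S; lia.
Qed.
End None_count.

Fixpoint mark (K1 : nat) (T : tree) : tree :=
  match T with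
  | Leaf => @Leaf k c
  | Node i own x a b => let T1 := Node i own x (mark K1 a) (mark K1 b) in if K1 <= osz T1 then Mk T1 else T1
  | Mk a => mark K1 a
  end.

(** A mark is set as soon as the top cluster reaches [K1] nodes. Both children have smaller
    clusters, so a cluster stays below [K1.*2], and every mark pays for itself with [K1] nodes. *)
Lemma markP K1 (T : tree) : 0 < K1 ->
  [/\ osz (mark K1 T) < K1, okK (K1.*2) (mark K1 T) & marks (mark K1 T) * K1 + osz (mark K1 T) <= nd T].
Proof.
move=> K10; elim: T => [|i own x a [sa oa ma] b [sb ob mb]|a] //=.
case: ifP => H /=; rewrite oa ob ?andbT; first by split=> //; nia.
by split=> //; [lia|nia].
Qed.

Lemma wft_mark ar K1 T : wft ar (mark K1 T) = wft ar T.
Proof.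
elim: T => [|i own x a IHa b IHb|a IH] //=.
by case: ifP => _ /=; rewrite IHa IHb.
Qed.

(** * Pumping between marks of equal state *)

Section Pumping.
Variables (Q : finType) (F : tree -> Q).
Hypothesis FX : forall X S S', F S = F S' -> F (plug X S) = F (plug X S').
Hypothesis FM : forall S, F (Mk S) = F S.
Variable K : nat.

(** The states at which a pump can be inserted. *)
Fixpoint avail (T : tree) : {set Q} :=
  match T with Leaf => set0 | Node _ _ _ a b => avail a :|: avail b | Mk a => F a |: avail a end.

Lemma availP q T : q \in avail T -> exists X S, T = plug X (Mk S) /\ F S = q.
Proof.
elim: T => [|i own x a IHa b IHb|a IH] /=; rewrite ?inE //.
- case/orP=> [/IHa|/IHb] [X [S [-> <-]]]; first by exists (CL i own x X b), S.
  by exists (CR i own x a X), S.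
- case/orP=> [/eqP->|/IH [X [S [-> <-]]]]; first by exists (CH k c), a.
  by exists (CM X), S.
Qed.

Lemma avail_sub X S : avail (Mk S) \subset avail (plug X (Mk S)).
Proof.
elim: X => [|i own x X IH b|i own x a X IH|X IH] //=.
- exact: subset_trans IH (subsetUl _ _).
- exact: subset_trans IH (subsetUr _ _).
- exact: subset_trans IH (subsetUr _ _).
Qed.

Lemma avail_plug X S S' : F S = F S' -> avail (plug X (Mk S)) \subset avail (plug X (Mk S')) :|: avail S.
Proof.
move=> e; elim: X => [|i own x X IH b|i own x a X IH|X IH] /=.
- by rewrite e subUset subsetUr andbT (subset_trans _ (subsetUl _ _)) ?subsetUl.
- apply/subsetP=> q; move/subsetP/(_ q): IH; rewrite !inE.
  by case: (q \in avail b); case: (q \in avail S); rewrite ?orbT ?orbF.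
- apply/subsetP=> q; move/subsetP/(_ q): IH; rewrite !inE.
  by case: (q \in avail a); case: (q \in avail S); rewrite ?orbT ?orbF.
- rewrite (FX X (S := Mk S) (S' := Mk S')) ?FM //.
  apply/subsetP=> q; move/subsetP/(_ q): IH; rewrite !inE.
  by case: (q == F _); case: (q \in avail S); rewrite ?orbT ?orbF.
Qed.

(** A cluster of at most [K] nodes has at most [K.+1] places below it; [h] bounds the number of
    states available at the marks. *)
Fixpoint bnd (h : nat) : nat := if h is h'.+1 then K + K.+1 * bnd h' else 0.

Lemma bnd_mono h h' : h <= h' -> bnd h <= bnd h'.
Proof.
elim: h h' => [|h IH] [|h'] //; rewrite ltnS => /IH; rewrite /=; nia.
Qed.

Definition pump T X Y S := [/\ T = plug X (Mk (plug Y (Mk S))), F (plug Y (Mk S)) = F S &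
  nd (plug Y (Mk S)) <= bnd #|Q|.+1].

(** At a mark whose state recurs at a mark below, the part in between is a pump, and a lowest one is
    small. Without recurrence each nested mark contributes a new available state, so nesting is
    bounded by the number of states. *)
Lemma pump_or_small T : okK K T ->
  (exists X Y S, pump T X Y S) \/ nd T <= osz T + (osz T).+1 * bnd #|avail T|.
Proof.
elim: T => [|i own x a IHa b IHb|S IH] /=; first by right.
- move=> /andP[/IHa {}IHa /IHb {}IHb].
  case: IHa => [[X [Y [S [-> e h]]]]|ha]; first by left; exists (CL i own x X b), Y, S.
  case: IHb => [[X [Y [S [-> e h]]]]|hb]; first by left; exists (CR i own x a X), Y, S.
  right; have ba := bnd_mono (subset_leq_card (subsetUl (avail a) (avail b))).
  have bb := bnd_mono (subset_leq_card (subsetUr (avail a) (avail b))).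
  nia.
- move=> /andP[sS /IH {}IH].
  case: IH => [[X [Y [S' [-> e h]]]]|hS]; first by left; exists (CM X), Y, S'.
  have le : nd S <= bnd #|avail S|.+1 by rewrite /=; nia.
  have [FS|FS] := boolP (F S \in avail S).
    have [Y [S' [eS e]]] := availP FS; left; exists (CH k c), Y, S'; rewrite /pump -eS; split=> //.
    by apply: leq_trans le (bnd_mono _); rewrite ltnS max_card.
  by right; rewrite cardsU1 FS add0n mul1n.
Qed.

Variables (ar : 'I_k -> nat) (amx Kc : nat).
Hypothesis har : forall R, 0 < ar R <= amx.
Hypothesis Kc0 : 0 < Kc.
Local Notation Y := (option 'I_(ncode k amx Kc)).

Definition Bp := bnd #|Q|.+1.
(* A pump is recorded by the states occurring at its marks and by its component counts. *)
Definition ptype : finType := ({set Q} * {ffun Y -> 'I_Bp.+1})%type.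

Definition lin (b : Y -> nat) (m : ptype -> nat) (y : Y) := b y + \sum_th m th * (th.2 y : nat).

(** The context [Y0] is iterated [p] times at a mark of state [F S], which changes no state. As [p]
    is positive, the states available inside [Y0] become available in the result. *)
Lemma insert_pump (Y0 : ctx k c) (S T1 : tree) p : 0 < p -> wft ar (plug Y0 (Mk S)) -> F (plug Y0 (Mk S)) = F S ->
  F S \in avail T1 -> wft ar T1 ->
  exists T', [/\ wft ar T', F T' = F T1, avail T1 \subset avail T', avail (plug Y0 (Mk S)) \subset avail T' :|: avail S
    & forall y : Y, hv T' y = hv T1 y + p * hv (plug Y0 (Mk (@Leaf k c))) y].
Proof.
move=> p0 wY eY FS wT1.
have [X [S' [eT1 FS']]] := availP FS; subst T1.
have := wT1; rewrite wft_plug => /andP[wX wS']; have := wY; rewrite wft_plug => /andP[wY0 wS].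
pose U n := iter n (fun Z => plug Y0 (Mk Z)) S'.
have FU n : F (U n) = F S.
  elim: n => //= n IH; rewrite -[RHS]eY; apply: FX; by rewrite !FM.
have wU n : wft ar (U n) by elim: n => //= n IH; rewrite wft_plug wY0.
have hU n (y : Y) : hv (U n) y = hv S' y + n * hv (plug Y0 (Mk (@Leaf k c))) y.
  elim: n => [|n IH]; first by rewrite addn0.
  rewrite /= (hv_plug Kc0) ?IH; first by rewrite mulSn; lia.
  by apply: (wft_wf har); rewrite wft_plug wY0 wU.
have aU n : avail S' \subset avail (U n).
  elim: n => //= n IH; apply: subset_trans IH _; apply: subset_trans (avail_sub _ _).
  exact: subsetUr.
exists (plug X (Mk (U p))); split.
- by rewrite wft_plug wX wU.
- by apply: FX; rewrite !FM FU.
- apply: subset_trans (avail_plug X (S := S') (S' := U p) _) _; first by rewrite FU.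
  rewrite subUset subxx /=; apply: subset_trans (aU p) _; apply: subset_trans (avail_sub _ _).
  exact: subsetUr.
- case: p p0 => // p _; apply: subset_trans (avail_plug Y0 (S := S) (S' := U p) _) _; first by rewrite FU.
  apply: setSU; apply: subset_trans (avail_sub _ _); exact: subsetUr.
- move=> y; rewrite (hv_plug Kc0 (S := U p)); last by apply: (wft_wf har); rewrite wft_plug wX wU.
  rewrite (hv_plug Kc0 (S := S')); last exact: (wft_wf har).
  by rewrite hU addnA.
Qed.

(** Remove a small pump, apply induction to the rest, and reinsert with the wanted multiplicity. The
    two inclusions of available states keep a place for every later reinsertion. *)
Theorem parikh T : wft ar T -> okK K T -> osz T <= K -> exists (b : Y -> nat) (m : ptype -> nat),
  [/\ forall y, b y <= Bp, forall y, hv T y = lin b m y &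
   forall m', (forall th, (0 < m' th) = (0 < m th)) -> exists T', [/\ wft ar T', F T' = F T,
     forall y, hv T' y = lin b m' y, avail T \subset avail T' &
     forall th, 0 < m th -> th.1 \subset avail T']].
Proof.
have [s] := ubnP (marks T); elim: s T => // s IH T /ltnSE Ts wT oT sT.
have [[X [Y0 [S [eT eY hB]]]]|small] := pump_or_small oT; last first.
  exists (fun y => hv T y), (fun _ => 0); split.
  - move=> y; apply: leq_trans (hv_le T y) _; rewrite /Bp /=; apply: leq_trans small _.
    by apply: leq_add => //; apply: leq_mul => //; apply/bnd_mono/max_card.
  - by move=> y; rewrite /lin big1 ?addn0 // => th _; rewrite mul0n.
  move=> m' Hm'; exists T; split=> // y; rewrite /lin big1 ?addn0 // => th _.
  by have := Hm' th; case: (m' th) => // n; rewrite ltnn.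
subst T; set T1 := plug X (Mk S).
have [oU _ oT1] : [/\ okK K (plug Y0 (Mk S)), osz (plug Y0 (Mk S)) <= K & okK K T1].
  have [oU sU _] := ok_plug (S' := @Leaf k c) oT isT (leq0n _).
  have [oS sS _] := ok_plug (S' := @Leaf k c) oU isT (leq0n _).
  by have [_ _ ->] := ok_plug oT oS sS.
move: (wT); rewrite wft_plug => /andP[wX wU].
have wS : wft ar S by move: wU; rewrite wft_plug => /andP[].
have wT1 : wft ar T1 by rewrite wft_plug wX wS.
have hvb y : hv (plug Y0 (Mk (@Leaf k c))) (y : Y) < Bp.+1.
  rewrite ltnS; apply: leq_trans (hv_le _ _) _; apply: leq_trans hB.
  by rewrite [leqRHS]nd_plug leq_addr.
(* The type of the removed pump. Its counts are those of the context with an empty hole, the amount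
   that each inserted copy adds. *)
pose th0 : ptype := (avail (plug Y0 (Mk S)), [ffun y => Ordinal (hvb y)]).
have [||b [m1 [bB h1 H1]]] := IH T1 _ wT1 oT1.
- by move: Ts; rewrite marks_plug /T1 [in marks (plug X (Mk S))]marks_plug; have := marks_plug_gt0 Y0 S; lia.
- by rewrite (osz_plug _ _ (plug Y0 (Mk S))).
have hT y : hv (plug X (Mk (plug Y0 (Mk S)))) (y : Y) = hv T1 y + (th0.2 y : nat).
  rewrite ffunE /= /T1 (hv_plug Kc0 (S := plug Y0 (Mk S))); last exact: (wft_wf har).
  rewrite (hv_plug Kc0 (X := Y0) (S := S)); last exact: (wft_wf har).
  rewrite (hv_plug Kc0 (X := X) (S := S)); last exact: (wft_wf har).
  lia.
have availT : avail (plug X (Mk (plug Y0 (Mk S)))) \subset avail T1 :|: th0.1.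
  exact: avail_plug.
have FT1 : F T1 = F (plug X (Mk (plug Y0 (Mk S)))) by apply: FX; rewrite !FM.
have aST1 : avail S \subset avail T1.
  apply: subset_trans (avail_sub _ _); exact: subsetUr.
exists b, (fun th => m1 th + (th == th0)); split=> //.
- move=> y; rewrite hT h1 /lin -addnA; congr (_ + _).
  rewrite [in RHS](eq_bigr (fun th => m1 th * (th.2 y : nat) + (if th == th0 then th0.2 y : nat else 0))); last first.
    by move=> th _; rewrite mulnDl; case: eqP => [->|]; rewrite ?mul1n ?mul0n.
  by rewrite big_split /= -big_mkcond big_pred1_eq.
move=> m' Hm'.
(* If [th0] already has positive multiplicity, induction applies to [m'] directly, and the states of
   the removed pump are available by the last clause of the induction hypothesis. Otherwise the
   multiplicity of [th0] is set to 0 in the induction and [m' th0] copies are inserted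
   afterwards. *)
have [pos|zero] := posnP (m1 th0); last first.
  have [|T' [wT' FT' hT' aT' thT']] := H1 m'.
    by move=> th; rewrite Hm'; case: (th =P th0) => [->|_]; rewrite ?addn0 ?addn1 // zero.
  exists T'; split=> //; first by rewrite FT'.
    by apply: subset_trans availT _; rewrite subUset aT' thT'.
  move=> th; case: (th =P th0) => [->|_] h; apply: thT' => //; by rewrite addn0 in h.
have [|T1' [wT1' FT1' hT1' aT1' thT1']] := H1 (fun th => if th == th0 then 0 else m' th).
  by move=> th; case: (th =P th0) => [->|/eqP/negPf e]; rewrite ?pos // Hm' e addn0.
have p0 : 0 < m' th0 by rewrite Hm' eqxx addn1.
have FS1 : F S \in avail T1'.
  apply: (subsetP aT1'); apply: (subsetP (avail_sub X S)); exact: setU11.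
have [T' [wT' FT' aT' aY hT']] := insert_pump p0 wU eY FS1 wT1'.
have aT1T' := subset_trans aT1' aT'.
have th0T' : th0.1 \subset avail T'.
  apply: subset_trans aY _; by rewrite subUset subxx (subset_trans aST1).
exists T'; split=> //.
- by rewrite FT' FT1'.
- move=> y; rewrite hT' hT1' /lin -addnA; congr (_ + _).
  rewrite (bigD1 th0) //= eqxx mul0n add0n [in RHS](bigD1 th0) //= ffunE /= addnC; congr (_ + _).
  by apply: eq_bigr => th /negPf->.
- by apply: subset_trans availT _; rewrite subUset aT1T'.
- move=> th; case: (th =P th0) => [->|e] h //; rewrite addn0 in h.
  by apply: subset_trans aT'; apply: thT1'.
Qed.

Definition Wp := Bp + #|ptype| * Bp.

(** All multiplicities are scaled by [n' / nd T]. Rounding costs at most one pump per type, and base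
    and pumps have counts bounded by [Bp], whence the constant [Wp]. *)
Corollary scaling T n' : wft ar T -> okK K T -> osz T <= K -> exists T', [/\ wft ar T', F T' = F T &
  forall y : Y, (nd T * hv T' y <= n' * hv T y + (nd T + n') * Wp) /\
                (n' * hv T y <= nd T * hv T' y + (nd T + n') * Wp)].
Proof.
move=> wT oT sT; have [b [m [bB hT H]]] := parikh wT oT sT.
pose n := nd T; have [n0|n0] := posnP n.
  have hv0 y : hv T (y : Y) = 0 by apply/eqP; rewrite -leqn0 -n0 hv_le.
  by exists T; split=> // y; rewrite !hv0 -/n n0 !muln0.
(* Floor plus one keeps every positive multiplicity positive, as [parikh] requires. *)
pose m' th := if m th == 0 then 0 else (m th * n' %/ n).+1.
have [|T' [wT' FT' hT' _ _]] := H m'.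
  by move=> th; rewrite /m'; case: (m th).
exists T'; split=> // y; have [W eW] : exists W, W = Wp by exists Wp.
rewrite -/n -eW hT hT' /lin !mulnDr !big_distrr /=.
have bb := bB y.
have S1 : \sum_th n * (m' th * (th.2 y : nat)) <= \sum_th n' * (m th * (th.2 y : nat)) + \sum_(th : ptype) n * Bp.
  rewrite -big_split; apply: leq_sum => th _ /=; rewrite /m'; have := ltn_ord (th.2 y).
  case: eqP => [->|_] h; first by rewrite !mul0n !muln0.
  exact: scale_le.
have S2 : \sum_th n' * (m th * (th.2 y : nat)) <= \sum_th n * (m' th * (th.2 y : nat)).
  apply: leq_sum => th _ /=; rewrite /m'.
  case: eqP => [->|_]; first by rewrite !mul0n !muln0.
  exact: scale_ge.
pose P := #|ptype| * Bp.
have E : \sum_(th : ptype) n * Bp = n * P by rewrite sum_nat_const mulnCA.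
have EW : W = Bp + P by rewrite eW.
rewrite E in S1; rewrite EW; clear eW EW E; clearbody P.
move: (\sum_th n * _) (\sum_th n' * _) S1 S2 => s1 s2 S1 S2.
have nb : n * b y <= n * Bp by rewrite leq_mul2l bb orbT.
have nb' : n' * b y <= n' * Bp by rewrite leq_mul2l bb orbT.
have eW : (n + n') * (Bp + P) = n * Bp + n * P + (n' * Bp + n' * P) by rewrite mulnDl !mulnDr.
rewrite eW; move: (n * b y) (n' * b y) (n * Bp) (n' * Bp) (n * P) (n' * P) nb nb' S1.
by move=> u v x1 x2 x3 x4 nb nb' S1; split; lia.
Qed.
End Pumping.
End Sizes.

(** * Trees and databases of bounded tree-width *)

Lemma connect_map (A B : finType) (e : rel A) (e' : rel B) (f : A -> B) :
  (forall x y, e x y -> e' (f x) (f y)) -> forall x y, connect e x y -> connect e' (f x) (f y).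
Proof.
move=> H x; apply: (connect_closed_ind (P := fun y => connect e' (f x) (f y))) => // y z xy yz.
exact: connect_trans xy (connect1 (H _ _ yz)).
Qed.

Section TreeDecomposition.
Variables (k c : nat).
Local Notation tree := (tree k c).

Fixpoint TN (T : tree) : finType :=
  match T with
  | Leaf => unit
  | Node _ _ _ a b => option (TN a + TN b)%type
  | Mk a => TN a
  end.

Fixpoint tr (T : tree) : TN T :=
  match T with
  | Leaf => tt
  | Node _ _ _ a b => None
  | Mk a => tr a
  end.

Definition tnode (A B : finType) (ra : A) (rb : B) (ea : rel A) (eb : rel B) : rel (option (A + B)) :=
  fun x y => match x, y with
  | None, Some (inl v) => v == ra
  | Some (inl v), None => v == ra
  | None, Some (inr v) => v == rb
  | Some (inr v), None => v == rb
  | Some (inl u), Some (inl v) => ea u v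
  | Some (inr u), Some (inr v) => eb u v
  | _, _ => false
  end.

Fixpoint te (T : tree) : rel (TN T) :=
  match T with
  | Leaf => fun _ _ => false
  | Node _ _ _ a b => tnode (tr a) (tr b) (@te a) (@te b)
  | Mk a => @te a
  end.

Definition bnode (i : 'I_c) (a b : tree) (ta : TN a -> {set 'I_c + El a}) (tb : TN b -> {set 'I_c + El b})
    (x : option (TN a + TN b)) : {set 'I_c + option (El a + El b)} :=
  match x with
  | None => [set inl j | j : 'I_c]
  | Some (inl u) => @sga c (El a) (El b) i @: ta u
  | Some (inr v) => @sgb c (El a) (El b) @: tb v
  end.

(** Every new bag consists of all colours, open at first and bound by [sga] on the way up; so bags
    have at most [c] elements. *)
Fixpoint tb (T : tree) : TN T -> {set 'I_c + El T} :=
  match T with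
  | Leaf => fun _ => [set inl j | j : 'I_c]
  | Node i _ _ a b => @bnode i a b (@tb a) (@tb b)
  | Mk a => @tb a
  end.

Lemma te_sym T : symmetric (@te T).
Proof.
elim: T => [|i own x a IHa b IHb|a IH]; [by []| |exact: IH].
by move=> [[u|u]|] [[v|v]|] //=.
Qed.

Lemma te_irr T x : ~~ @te T x x.
Proof.
elim: T x => [|i own x a IHa b IHb|a IH]; [by []| |exact: IH].
by move=> [[u|u]|] /=.
Qed.

Lemma te_conn T x : connect (@te T) (tr T) x.
Proof.
elim: T x => [|i own x a IHa b IHb|a IH] //=; first by case.
have ca u : connect (tnode (tr a) (tr b) (@te a) (@te b)) None (Some (inl u)).
  apply: connect_trans (connect1 _) (connect_map (f := fun v => Some (inl v)) _ (IHa u)) => //=; exact: eqxx.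
have cb u : connect (tnode (tr a) (tr b) (@te a) (@te b)) None (Some (inr u)).
  apply: connect_trans (connect1 _) (connect_map (f := fun v => Some (inr v)) _ (IHb u)) => //=; exact: eqxx.
by case=> [[u|u]|].
Qed.

Lemma card_pairs (A : finType) (e : rel A) : #|[set p : A * A | e p.1 p.2]| = \sum_x #|[set y | e x y]|.
Proof.
rewrite -sum1dep_card -(pair_big_dep predT e (fun _ _ => 1)) /=.
by apply: eq_bigr => x _; rewrite sum1dep_card.
Qed.

Lemma sum_opt (A B : finType) (G : option (A + B) -> nat) :
  \sum_x G x = G None + \sum_u G (Some (inl u)) + \sum_u G (Some (inr u)).
Proof.
rewrite (bigD1 None) //= (reindex_omap Some id) /=; last by case.
rewrite (eq_bigl predT); last by move=> u; rewrite /= eqxx.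
by rewrite big_sumType /= addnA.
Qed.

Lemma card_opt (A B : finType) (P : pred (option (A + B))) :
  #|[set v | P v]| = P None + #|[set u | P (Some (inl u))]| + #|[set u | P (Some (inr u))]|.
Proof.
rewrite -!sum1dep_card big_mkcond sum_opt -!big_mkcond; by case: (P None).
Qed.

Lemma TN_gt0 T : 0 < #|TN T|. Proof. by apply/card_gt0P; exists (tr T). Qed.

Lemma te_edges T : #|[set p : TN T * TN T | te p.1 p.2]| = (#|TN T|.-1).*2.
Proof.
elim: T => [|i own x a IHa b IHb|a IH] //=.
  by rewrite card_unit /=; apply/eqP; rewrite cards_eq0; apply/eqP/setP=> p; rewrite !inE.
have eF (A : finType) : #|[set y : A | false]| = 0.
  by apply/eqP; rewrite cards_eq0; apply/eqP/setP=> p; rewrite !inE.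
rewrite card_pairs sum_opt /= card_option card_sum card_opt /=.
have e1 (A : finType) (r : A) : #|[set y | y == r]| = 1.
  by rewrite -(cards1 r); apply: eq_card => y; rewrite !inE.
rewrite !e1.
rewrite (eq_bigr (fun u => (u == tr a) + #|[set y | te u y]|)); last first.
  by move=> u _; rewrite card_opt /= eF addn0.
rewrite [in X in _ + X](eq_bigr (fun u => (u == tr b) + #|[set y | te u y]|)); last first.
  by move=> u _; rewrite card_opt /= eF addn0.
rewrite !big_split /= -!card_pairs IHa IHb.
have e2 (A : finType) (r : A) : \sum_i (i == r) = 1.
  by rewrite (bigD1 r) //= eqxx big1 // => y /negPf->.
rewrite !e2 -!addnn; move: (TN_gt0 a) (TN_gt0 b); case: #|TN a| => // p _; case: #|TN b| => // q _ /=; lia.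
Qed.

Lemma tb_card T (x : TN T) : #|tb x| <= c.
Proof.
have cI (A : finType) : #|[set (inl j : 'I_c + A) | j : 'I_c]| <= c.
  by apply: leq_trans (leq_imset_card _ _) _; rewrite card_ord.
move: T x; elim=> [|i own x a IHa b IHb|a IH].
- by move=> x; apply: cI.
- case=> [[u|u]|] /=; [| |exact: cI]; apply: leq_trans (leq_imset_card _ _) _.
    exact: IHa.
  exact: IHb.
- exact: IH.
Qed.

Lemma tb_root T : tb (tr T) = [set inl j | j : 'I_c].
Proof. by elim: T => [|i own x a IHa b IHb|a IH] //=. Qed.

Lemma inl_root T j : inl j \in tb (tr T).
Proof. by rewrite tb_root imset_f. Qed.

Lemma tb_tuple T : forall t, t \in ot T -> exists x : TN T, {subset t.2 <= @tb T x}.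
Proof.
elim: T => [|i own x a IHa b IHb|a IH] //= t; rewrite mem_cat => /orP[] /mapP[t0 t0T ->] /=.
  have [u us] : exists u, {subset t0.2 <= tb (u : TN a)}.
    move: t0T; rewrite mem_cat => /orP[/mapP[t1 _ ->]|/IHa //].
    by exists (tr a) => _ /mapP[j _ ->]; apply: inl_root.
  by exists (Some (inl u)) => _ /mapP[z zt ->]; apply: imset_f; apply: us.
have [u us] := IHb _ t0T.
by exists (Some (inr u)) => _ /mapP[z zt ->]; apply: imset_f; apply: us.
Qed.

Lemma tb_el T : forall u : El T, exists x : TN T, inr u \in @tb T x.
Proof.
elim: T => [|i own x a IHa b IHb|a IH] /=; [by case| |exact: IH].
case=> [[u|u]|].
- by have [y uy] := IHa u; exists (Some (inl y)); apply/imsetP; exists (inr u).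
- by have [y uy] := IHb u; exists (Some (inr y)); apply/imsetP; exists (inr u).
- exists (Some (inl (tr a))); apply/imsetP; exists (inl i); rewrite ?inl_root //= ?eqxx //.
Qed.

Definition tez T z : rel (TN T) := [rel x y | [&& te x y, z \in tb x & z \in tb y]].

Lemma mem_sga i (a b : tree) (A : {set 'I_c + El a}) :
  [/\ forall j, (inl j \in @sga c (El a) (El b) i @: A) = (j != i) && (inl j \in A),
      (inr None \in @sga c (El a) (El b) i @: A) = (inl i \in A),
      forall u, (inr (Some (inl u)) \in @sga c (El a) (El b) i @: A) = (inr u \in A) &
      forall u, (inr (Some (inr u)) \in @sga c (El a) (El b) i @: A) = false].
Proof.
have E z : (z \in @sga c (El a) (El b) i @: A) = (z \in map (@sga c (El a) (El b) i) (enum A)).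
  by apply/imsetP/mapP => -[y yA ->]; exists y; rewrite ?mem_enum // in yA *.
have [h1 h2 h3 h4] := @mem_map_sga k c i a b (enum A).
by split=> [j||u|u]; rewrite E ?h1 ?h2 ?h3 ?h4 ?mem_enum.
Qed.

Lemma mem_sgb (a b : tree) (A : {set 'I_c + El b}) :
  [/\ forall j, (inl j \in @sgb c (El a) (El b) @: A) = (inl j \in A),
      (inr None \in @sgb c (El a) (El b) @: A) = false,
      forall u, (inr (Some (inl u)) \in @sgb c (El a) (El b) @: A) = false &
      forall u, (inr (Some (inr u)) \in @sgb c (El a) (El b) @: A) = (inr u \in A)].
Proof.
have E z : (z \in @sgb c (El a) (El b) @: A) = (z \in map (@sgb c (El a) (El b)) (enum A)).
  by apply/imsetP/mapP => -[y yA ->]; exists y; rewrite ?mem_enum // in yA *.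
have [h1 h2 h3 h4] := @mem_map_sgb k c a b (enum A).
by split=> [j||u|u]; rewrite E ?h1 ?h2 ?h3 ?h4 ?mem_enum.
Qed.

(** The two claims go through induction together: bags with an open colour are connected to the root
    bag, so when that colour is bound to a node, the bags of the node are connected through the root
    of its descendants. *)
Lemma tb_conn T : (forall j (x : TN T), inl j \in tb x -> connect (tez (inl j)) (tr T) x) /\
  (forall u, exists r : TN T, forall x, inr u \in tb x -> connect (tez (inr u)) r x).
Proof.
elim: T => [|i own x a [IHa1 IHa2] b [IHb1 IHb2]|a IH] //=.
  by split=> [j []|[]].
have La (z : 'I_c + El a) z' : (forall A : {set 'I_c + El a}, (z' \in @sga c (El a) (El b) i @: A) = (z \in A)) ->
    forall y y', connect (tez z) y y' ->
      connect (@tez (Node i own x a b) z') (Some (inl y)) (Some (inl y')).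
  by move=> H; apply: connect_map => y y2; rewrite /tez /= !H.
have Lb (z : 'I_c + El b) z' : (forall A : {set 'I_c + El b}, (z' \in @sgb c (El a) (El b) @: A) = (z \in A)) ->
    forall y y', connect (tez z) y y' ->
      connect (@tez (Node i own x a b) z') (Some (inr y)) (Some (inr y')).
  by move=> H; apply: connect_map => y y2; rewrite /tez /= !H.
split.
- move=> j [[y|y]|] //=.
    have [h1 _ _ _] := mem_sga i b (tb y); rewrite h1 => /andP[ji jy].
    have H (A : {set 'I_c + El a}) : (inl j \in @sga c (El a) (El b) i @: A) = (inl j \in A).
      by have [-> _ _ _] := mem_sga i b A; rewrite ji.
    apply: connect_trans (connect1 _) (La _ _ H _ _ (IHa1 j y jy)).
    by rewrite /tez /= eqxx H inl_root imset_f.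
  have [h1 _ _ _] := mem_sgb a (tb y); rewrite h1 => jy.
  have H (A : {set 'I_c + El b}) : (inl j \in @sgb c (El a) (El b) @: A) = (inl j \in A).
    by have [-> _ _ _] := mem_sgb a A.
  apply: connect_trans (connect1 _) (Lb _ _ H _ _ (IHb1 j y jy)).
  by rewrite /tez /= eqxx H inl_root imset_f.
- have noroot (u : option (El a + El b)) : (inr u \in [set inl j | j : 'I_c]) = false.
    by apply/imsetP=> -[].
  case=> [[u|u]|].
  + have [r Hr] := IHa2 u; exists (Some (inl r)) => -[[y|y]|] /=; last by rewrite noroot.
      have [_ _ -> _] := mem_sga i b (tb y) => /Hr; apply: La => A.
      by have [_ _ -> _] := mem_sga i b A.
    by have [_ _ -> _] := mem_sgb a (tb y).
  + have [r Hr] := IHb2 u; exists (Some (inr r)) => -[[y|y]|] /=; last by rewrite noroot.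
      by have [_ _ _ ->] := mem_sga i b (tb y).
    have [_ _ _ ->] := mem_sgb a (tb y) => /Hr; apply: Lb => A.
    by have [_ _ _ ->] := mem_sgb a A.
  + exists (Some (inl (tr a))) => -[[y|y]|] /=; last by rewrite noroot.
      have [_ -> _ _] := mem_sga i b (tb y) => /IHa1; apply: La => A.
      by have [_ -> _ _] := mem_sga i b A.
    by have [_ -> _ _] := mem_sgb a (tb y).
Qed.
End TreeDecomposition.

(** * From coloured forests to databases *)

Section TreeToDatabase.
Variables (k t : nat) (ar : 'I_k -> nat).
Local Notation tree := (tree k t.+1).

Definition db_of (T : tree) : dbase ar #|El T| :=
  fun R => [set u | (R, map enum_val (tval u)) \in cl T].

Definition pdb_of (T : tree) : pdb ar := PDB (db_of T).

Lemma db_of_list (T : tree) R s : wft ar T -> ((R, s) \in cl T) = ((R, map enum_rank s) \in dblist (db_of T)).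
Proof.
move=> wT; have eK : map enum_val (map enum_rank s) = s.
  by rewrite -map_comp (eq_map (g := id)) ?map_id // => u; apply: enum_rankK.
apply/idP/dblistP => [sT|[R' [u [uD [eR es]]]]].
  have sz : size (map enum_rank s) == ar R.
    by move: sT; rewrite mem_cl => /(wft_ot wT) /=; rewrite !size_map => ->.
  by exists R, (Tuple sz); split=> //; rewrite inE /= eK.
by subst R'; move: uD; rewrite inE -es eK.
Qed.

Lemma deg_el_count n (D : dbase ar n) a : deg_el D a = count (fun t => a \in t.2) (dblist D).
Proof.
rewrite /deg_el /dblist count_flatten sumnE !big_map -enumT big_enum /=; apply: eq_bigr => R _.
rewrite count_map -size_filter cardE; apply: perm_size; apply: uniq_perm.
- exact: enum_uniq.
- exact/filter_uniq/enum_uniq.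
- move=> u; rewrite [LHS]mem_enum [RHS]mem_filter mem_enum inE [RHS]andbC //.
Qed.

Lemma dblist_uniq n (D : dbase ar n) : uniq (dblist D).
Proof.
apply: allpairs_uniq_dep => [|R _|].
- exact: enum_uniq.
- exact: enum_uniq.
- move=> [R u] [R' u'] _ _ /= [eR]; subst R'; by move/val_inj->.
Qed.

Lemma pdb_of_deg d (T : tree) : wft ar T -> degok d T -> deg_le d (pdb_of T).
Proof.
move=> wT /forallP dT a; apply: leq_trans (dT (enum_val a)); rewrite deg_el_count /otdeg -!size_filter.
rewrite -(size_map (mapt (fun x => inr (enum_val x) : 'I_t.+1 + El T))); apply: uniq_leq_size.
  rewrite map_inj_uniq ?filter_uniq ?dblist_uniq //.
  move=> [R s] [R' s'] [-> e]; congr pair; move: e; apply: inj_map => x y [] /enum_val_inj //.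
move=> p /mapP[[R s]]; rewrite mem_filter /= => /andP[as_ sD] ->.
rewrite mem_filter /=; apply/andP; split; first by apply/mapP; exists a.
have -> : mapt (fun x => inr (enum_val x) : 'I_t.+1 + El T) (R, s) = (R, map inr (map enum_val s)).
  by rewrite /mapt /= -map_comp.
rewrite -mem_cl (db_of_list _ _ wT) -map_comp.
by rewrite (eq_map (g := id)) ?map_id // => u; apply: enum_valK.
Qed.

Lemma pdb_of_tw (T : tree) : wft ar T -> treewidth_le (gaifman (rels (pdb_of T))) t.
Proof.
move=> wT.
exists #|TN T|, (fun x y => te (enum_val x) (enum_val y)),
  (fun x => [set v | inr (enum_val v) \in tb (enum_val x : TN T)]); split; last first.
  move=> x; apply: leq_trans (tb_card (enum_val x)).
  rewrite -(card_imset _ (f := fun v => inr (enum_val v) : 'I_t.+1 + El T)); last first.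
    by move=> u v [] /enum_val_inj.
  by apply: subset_leq_card; apply/subsetP=> z /imsetP[v]; rewrite inE => vx ->.
have rk (e : rel (TN T)) (e' : rel 'I_#|TN T|) : (forall x y, e x y -> e' (enum_rank x) (enum_rank y)) ->
    forall x y, connect e x y -> connect e' (enum_rank x) (enum_rank y).
  by move=> H; apply: connect_map.
split.
- split.
  + exact: TN_gt0.
  + by move=> x y; rewrite te_sym.
  + by move=> x; apply: te_irr.
  + move=> x y; rewrite -(enum_valK x) -(enum_valK y).
    apply: (rk (@te _ _ T)) => [u v|]; first by rewrite !enum_rankK.
    apply: connect_trans (te_conn _); rewrite (sym_connect_sym (@te_sym _ _ T)); exact: te_conn.
  + rewrite -te_edges -(card_imset _ (f := fun p : TN T * TN T => (enum_rank p.1, enum_rank p.2))); last first.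
      by move=> [u v] [u' v'] [/enum_rank_inj-> /enum_rank_inj->].
    apply: eq_card => -[x y]; rewrite !inE /=; apply/idP/imsetP => [xy|[[u v]]].
      by exists (enum_val x, enum_val y); rewrite ?inE //= !enum_valK.
    by rewrite inE /= => uv [-> ->]; rewrite !enum_rankK.
- move=> v; have [x vx] := tb_el (enum_val v); exists (enum_rank x).
  by rewrite inE enum_rankK.
- move=> u v /andP[_ /existsP[R /existsP[s /and3P[sD us vs]]]].
  move: sD; rewrite inE mem_cl => /tb_tuple[x sx]; exists (enum_rank x).
  by rewrite !inE enum_rankK !sx //= -map_comp; apply/mapP; [exists v|exists u].
- move=> v x y; rewrite !inE => vx vy.
  have [_ H] := tb_conn T; have [r Hr] := H (enum_val v).
  rewrite -(enum_valK x) -(enum_valK y).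
  apply: (rk (tez (inr (enum_val v)))) => [u w|]; first by rewrite /= !inE !enum_rankK.
  apply: connect_trans (Hr _ vy); rewrite sym_connect_sym; first exact: Hr.
  by move=> u w; rewrite /tez /= te_sym [(_ \in tb u) && _]andbC.
Qed.

(** [models] starts from the assignment sending every variable to 0; with at least one node this is
    an actual element, so [sat_msat] applies, and for a sentence the assignment can be exchanged. *)
Lemma pdb_of_models (T : tree) (phi : formula ar) : wft ar T -> 0 < nd T -> sentence phi ->
  models (pdb_of T) phi = msat (cl T) (fun _ => set0) phi.
Proof.
move=> wT nT /andP[/eqP fo0 /eqP so0].
pose S (z : nat + nat) : {set El T} := match z with
  | inl _ => [set v | enum_rank v == 0 :> nat] | inr _ => set0 end.
have -> : msat (cl T) (fun _ => set0) phi = msat (cl T) S phi.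
  by apply: msat_free => x; rewrite ?fo0 ?so0.
apply: (sat_msat (f := enum_rank)) => //.
- by exists enum_val; [apply: enum_rankK|apply: enum_valK].
- by move=> R s; apply: db_of_list.
- by move=> _; rewrite /= card_El_nd.
- by move=> X; apply/setP=> v; rewrite !inE.
Qed.

Lemma pdb_of_iso (T : tree) (A : {set El T}) : wft ar T ->
  isoon (cl T) (dblist (rels (pdb_of T))) A (enum_rank @: A) enum_rank.
Proof.
move=> wT; split=> //; first by move=> u v _ _; apply: enum_rank_inj.
by move=> R s _; apply: db_of_list.
Qed.
End TreeToDatabase.

(** * Elimination orders from tree decompositions *)

Lemma dbl_pred a p q : 1 + (1 + p) <= a.*2 -> q <= p -> q <= a.-1.*2.
Proof. lia. Qed.

Section Elimination.
Variables (V : finType) (m : nat) (e : rel 'I_m) (B : 'I_m -> {set V}).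
Hypothesis esym : forall x y, e x y = e y x.
Hypothesis eirr : forall x, ~~ e x x.

(* [None] plays the role of an element lying in every bag. *)
Definition inB (w : option V) (x : 'I_m) : bool := if w is Some v then v \in B x else true.

Definition eB (A : {set 'I_m}) (w : option V) : rel 'I_m :=
  fun x y => [&& x \in A, y \in A, e x y, inB w x & inB w y].

(* A sequence of bags in which every bag meets the union of the later ones inside one of them. *)
Fixpoint rip (s : seq {set V}) : Prop :=
  match s with
  | [::] => True
  | C :: s' => rip s' /\ (s' = [::] \/ exists2 C', C' \in s' & forall v, v \in C -> has (fun C2 : {set V} => v \in C2) s' -> v \in C')
  end.

(** A walk that enters a leaf [z] must leave it to the same neighbour [y], so visits to [z] can be
    cut out. *)
Lemma connect_skip (T : finType) (r r' : rel T) (z y : T) :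
  (forall x, r x z -> x = y) -> (forall x, r z x -> x = y) -> z != y ->
  (forall x x', x != z -> x' != z -> r x x' -> r' x x') ->
  forall i j, i != z -> j != z -> connect r i j -> connect r' i j.
Proof.
move=> H1 H2 zy H3 i j iz jz.
pose f x := if x == z then y else x.
suff H w : connect r i w -> connect r' i (f w) by move/H; rewrite /f (negPf jz).
apply: (connect_closed_ind (P := fun x => connect r' i (f x))); first by rewrite /f (negPf iz).
move=> x x' ix; rewrite /f; case: (x =P z) => [ex|/eqP xz]; case: (x' =P z) => [ex'|/eqP x'z] rxx'.
- by move: ix; rewrite /f ex eqxx.
- by move: ix; rewrite /f ex eqxx; rewrite ex in rxx'; rewrite (H2 _ rxx').
- by move: ix; rewrite /f (negPf xz); rewrite ex' in rxx'; rewrite (H1 _ rxx').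
- apply: connect_trans (connect1 (H3 _ _ xz x'z rxx')).
  by move: ix; rewrite /f (negPf xz).
Qed.

(** Remove a leaf [z] of the decomposition tree. Whatever its bag shares with other bags lies, by
    connectivity, in the bag of its only neighbour, which is the running intersection property. The
    case [None] keeps the remaining tree connected. *)
Lemma elimination (A : {set 'I_m}) :
  (forall w i j, i \in A -> j \in A -> inB w i -> inB w j -> connect (eB A w) i j) ->
  #|[set p : 'I_m * 'I_m | [&& p.1 \in A, p.2 \in A & e p.1 p.2]]| <= (#|A|.-1).*2 ->
  exists s, rip s /\ s =i [set B x | x in A].
Proof.
have [n] := ubnP #|A|; elim: n A => // n IH A /ltnSE An conn edges.
have [A1|A2] := leqP #|A| 1.
  have [A0|[x xA]] := set_0Vmem A.
    exists [::]; split=> // C; rewrite A0 in_nil; symmetry; apply/imsetP=> -[x]; by rewrite inE.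
  have eA : A = [set x].
    by apply/eqP; rewrite eq_sym eqEcard sub1set xA cards1.
  exists [:: B x]; split; first by split=> //; left.
  by move=> C; rewrite eA imset_set1 !inE.
pose nb x := [set y in A | e x y].
(* If every vertex had two neighbours, there would be at least [2 * #|A|] directed edges, against
   the bound [(#|A|.-1).*2]. *)
have [z zA nz] : exists2 z, z \in A & #|nb z| <= 1.
  have [/existsP[z /andP[zA zn]]|nex] := boolP [exists z, (z \in A) && (#|nb z| <= 1)]; first by exists z.
  exfalso; move: edges; apply/negP; rewrite -ltnNge.
  have -> : #|[set p : 'I_m * 'I_m | [&& p.1 \in A, p.2 \in A & e p.1 p.2]]| = \sum_(x in A) #|nb x|.
    rewrite (card_pairs (fun x y => [&& x \in A, y \in A & e x y])) [RHS]big_mkcond.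
    apply: eq_bigr => x _; case: ifP => xA.
      by apply: eq_card => y; rewrite !inE.
    by apply/eqP; rewrite cards_eq0; apply/eqP/setP=> y; rewrite !inE.
  apply: (@leq_trans (\sum_(x in A) 2)); first by rewrite sum_nat_const; lia.
  apply: leq_sum => x xA; rewrite ltnNge; apply/negP=> h; move/existsP: nex; apply.
  by exists x; rewrite xA.
have nbr w l : l \in A -> l != z -> inB w z -> inB w l -> exists2 y, y \in nb z & inB w y.
  move=> lA lz wz wl; have /connectP[[|y p] /=] := conn w z l zA lA wz wl.
    by move=> _ el; rewrite el eqxx in lz.
  by move=> /andP[/and5P[_ yA zy _ wy] _] _; exists y => //; rewrite inE yA.
have [l /setD1P[lz lA]] : exists l, l \in A :\ z.
  by apply/card_gt0P; move: (cardsD1 z A); rewrite zA; lia.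
have [y ynb _] := nbr None l lA lz isT isT.
have yE x : x \in nb z -> x = y.
  by move=> xnb; move: nz; rewrite leqNgt => /negP; case: (x =P y) => // /eqP xy [];
    apply/card_gt1P; exists x, y.
move: (ynb); rewrite inE => /andP[yA ezy].
have zy : z != y by apply: contraTneq ezy => <-; apply: eirr.
have cA' : #|A :\ z| = #|A|.-1 by rewrite (cardsD1 z A) zA.
have [|||s [rs es]] := IH (A :\ z).
- by rewrite cA'; lia.
- move=> w i j /setD1P[iz iA] /setD1P[jz jA] wi wj.
  apply: (connect_skip (z := z) (y := y) _ _ zy _ iz jz) (conn w i j iA jA wi wj).
  + by move=> x /and5P[xA _ xz _ _]; apply: yE; rewrite inE xA esym.
  + by move=> x /and5P[_ xA xz _ _]; apply: yE; rewrite inE xA.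
  + by move=> x x' xz x'z /and5P[xA x'A xx' wx wx']; rewrite /eB !inE xz x'z xA x'A xx' wx wx'.
- rewrite cA'.
  set E := [set p | _] in edges; set E' := [set p | _].
  have sub : E' \subset E :\ (z, y) :\ (y, z).
    apply/subsetP=> -[x x']; rewrite !inE /= => /and3P[/andP[xz xA] /andP[x'z x'A] ->].
    by rewrite xA x'A !xpair_eqE (negPf xz) (negPf x'z) !andbF.
  have zyE : (z, y) \in E by rewrite inE /= zA yA.
  have yzE : (y, z) \in E :\ (z, y) by rewrite in_setD1 inE /= xpair_eqE eq_sym (negPf zy) zA yA esym.
  move: edges; rewrite (cardsD1 (z, y) E) zyE (cardsD1 (y, z) (E :\ (z, y))) yzE.
  by move=> edges; apply: dbl_pred edges (subset_leq_card sub).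
exists (B z :: s); split.
  split=> //; right; exists (B y).
    by rewrite es; apply: imset_f; rewrite !inE eq_sym zy.
  move=> v vz /hasP[C]; rewrite es => /imsetP[l' /setD1P[l'z l'A] ->] vl.
  by have [y' /yE->] := nbr (Some v) l' l'A l'z vz vl.
move=> C; rewrite inE es; apply/orP/imsetP => [[/eqP->|/imsetP[x /setD1P[_ xA] ->]]|[x xA ->]].
- by exists z.
- by exists x.
- case: (x =P z) => [->|/eqP xz]; first by left.
  by right; apply: imset_f; rewrite !inE xz.
Qed.
End Elimination.

(** * Building a coloured forest from an elimination order *)

Section Insertion.
Variables (k t : nat) (ar : 'I_k -> nat).
Local Notation c := t.+1.
Local Notation tree := (tree k c).

Definition sgn (i : 'I_c) (x : nat) (z : 'I_c + nat) : 'I_c + nat :=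
  match z with inl j => if j == i then inr x else inl j | inr y => inr y end.

(* Tuples and elements written with the names carried by the nodes. *)
Fixpoint otn (T : tree) : seq ('I_k * seq ('I_c + nat)) :=
  match T with
  | Leaf => [::]
  | Node i own x a b => map (mapt (sgn i x)) (map (mapt inl) own ++ otn a) ++ otn b
  | Mk a => otn a
  end.

Fixpoint names (T : tree) : seq nat :=
  match T with Leaf => [::] | Node _ _ x a b => x :: names a ++ names b | Mk a => names a end.

(* [hasbag T f]: some place of [T] where a new leaf can be inserted sees the bag [f]. *)
Fixpoint hasbag (T : tree) (f : 'I_c -> 'I_c + nat) : Prop :=
  match T with
  | Leaf => f =1 inl
  | Node i _ x a b => [\/ f =1 inl, exists2 f', hasbag a f' & f =1 (sgn i x) \o f' | hasbag b f]
  | Mk a => hasbag a f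
  end.

Lemma hasbag_inl T : hasbag T inl.
Proof. by elim: T => [|i own x a IHa b IHb|a IH] //=; apply: Or31. Qed.

Definition updb (f : 'I_c -> 'I_c + nat) (i : 'I_c) (x : nat) : 'I_c -> 'I_c + nat :=
  fun j => if j == i then inr x else f j.

(** The new node becomes the first among the siblings at a place that sees the bag [f]. Earlier
    places survive, and below the new node the bag is [f] with colour [i] overwritten. *)
Lemma insert_leaf (T : tree) f i own x : hasbag T f -> exists T',
  [/\ perm_eq (names T') (x :: names T),
      perm_eq (otn T') (map (mapt (updb f i x)) own ++ otn T),
      forall g, hasbag T g -> hasbag T' g,
      hasbag T' (updb f i x)
    & all (fun t => size t.2 == ar t.1) own -> wft ar T -> wft ar T'].
Proof.
have newl g : g =1 inl -> map (mapt (sgn i x)) (map (mapt inl) own) = map (mapt (updb g i x)) own.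
  move=> gE; rewrite -map_comp; apply: eq_map => -[R s]; rewrite /mapt /= -map_comp; congr pair.
  by apply: eq_map => j; rewrite /updb /= gE.
elim: T f => [|i0 own0 x0 a IHa b IHb|a IH] f /=.
- move=> fE; exists (Node i own x (@Leaf k c) (@Leaf k c)); split=> //=.
  + by rewrite !cats0 (newl _ fE).
  + by move=> g gE; apply: Or31.
  + by apply: Or32; exists inl => // j; rewrite /updb /= fE.
  + by move=> -> _.
- case=> [fE|[f' fa fE]|fb].
  + exists (Node i own x (@Leaf k c) (Node i0 own0 x0 a b)); split=> //=.
    * by rewrite cats0 (newl _ fE).
    * by move=> g gE; apply: Or33.
    * by apply: Or32; exists inl => // j; rewrite /updb /= fE.
    * by move=> -> ->.
  + have [a' [na oa ha ba wa]] := IHa f' fa; exists (Node i0 own0 x0 a' b); split=> //=.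
    * rewrite -[x :: x0 :: _]/([:: x] ++ [:: x0] ++ names a ++ names b) perm_sym perm_catCA.
      by rewrite /= perm_cons perm_sym -[x :: names a ++ _]/((x :: names a) ++ _) perm_cat2r.
    * rewrite catA perm_cat2r !map_cat perm_sym perm_catCA perm_cat2l perm_sym.
      have -> : map (mapt (updb f i x)) own = map (mapt (sgn i0 x0)) (map (mapt (updb f' i x)) own).
        rewrite -map_comp; apply: eq_map => t0 /=; symmetry; apply: mapt_comp => j.
        by rewrite /updb; case: ifP => // _; rewrite fE.
      by rewrite -map_cat; apply: perm_map.
    * move=> g [gE|[g' ga gE]|gb]; [exact: Or31|apply: Or32; exists g' => //; exact: ha|exact: Or33].
    * apply: Or32; exists (updb f' i x) => // j; rewrite /updb /=; case: ifP => // _; exact: fE.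
    * by move=> wo /and3P[-> wa0 ->]; rewrite wa.
  + have [b' [nb ob hb bb wb]] := IHb f fb; exists (Node i0 own0 x0 a b'); split=> //=.
    * rewrite -[x0 :: names a ++ names b']/((x0 :: names a) ++ names b').
      rewrite -[x :: x0 :: _]/([:: x] ++ (x0 :: names a) ++ names b) perm_sym perm_catCA perm_cat2l perm_sym.
      exact: nb.
    * by rewrite perm_sym perm_catCA perm_cat2l perm_sym.
    * by move=> g [gE|ga|gb]; [exact: Or31|exact: Or32|apply: Or33; exact: hb].
    * exact: Or33.
    * by move=> wo /and3P[-> -> wb0]; rewrite wb.
- move=> fa; have [a' [na oa ha ba wa]] := IH f fa; by exists (Mk a').
Qed.

Section Build.
Variables (n : nat) (D : dbase ar n).
Hypothesis har : forall R, 0 < ar R.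

Definition nval (s : 'I_n) : 'I_c + nat := inr (nat_of_ord s).

Definition built (U : {set 'I_n}) (T : tree) : Prop :=
  [/\ perm_eq (names T) (map val (enum U)),
      perm_eq (otn T) (map (mapt nval) [seq t <- dblist D | all (mem U) t.2]) & wft ar T].

Definition covers (f : 'I_c -> 'I_c + nat) (N : {set 'I_n}) : Prop := forall w, w \in N -> exists j, f j = nval w.

(** The tuples new with [v] lie in [v |: N], and [N] is visible in the bag [f], so they can be
    written with colours at the new node. *)
Lemma add_vertex U T f N v : built U T -> hasbag T f -> covers f N -> v \notin U -> #|N| < c ->
  (forall t, t \in dblist D -> {subset t.2 <= v |: U} -> v \in t.2 -> {subset t.2 <= v |: N}) ->
  v \notin N ->
  exists T' f', [/\ built (v |: U) T', hasbag T' f', covers f' (v |: N) & forall g, hasbag T g -> hasbag T' g].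
Proof.
move=> [nT oT wT] hf cf vU Nc tN vN.
pose col w := if [pick j | f j == nval w] is Some j then j else ord0.
have colP w : w \in N -> f (col w) = nval w.
  move=> /cf[j fj]; rewrite /col; case: pickP => [j' /eqP //|/(_ j)]; by rewrite fj eqxx.
have [i iN] : exists i, i \notin col @: N.
  apply/existsP; rewrite -negb_forall; apply/negP=> /forallP all.
  have : #|'I_c| <= #|col @: N| by apply: subset_leq_card; apply/subsetP=> i _; apply: all.
  by rewrite card_ord leqNgt (leq_ltn_trans (leq_imset_card _ _) Nc).
pose new := [seq t <- dblist D | all (mem (v |: U)) t.2 & v \in t.2].
pose cv w := if w == v then i else col w.
have updE w : w \in v |: N -> updb f i v (cv w) = nval w.
  rewrite /updb /cv !inE; case: eqP => [->|_] //=; first by rewrite eqxx.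
  move=> wN; case: eqP => [ei|_]; last exact: colP.
  by rewrite -ei imset_f in iN.
have [T' [nT' oT' kT' bT' wT']] := insert_leaf i (map (mapt cv) new) v hf.
exists T', (updb f i v); split=> //; last first.
  move=> w; rewrite !inE => wN; exists (cv w); apply: updE; by rewrite !inE.
split.
- apply: perm_trans nT' _; apply: perm_trans (_ : perm_eq _ (map val (v :: enum U))) _; first by rewrite /= perm_cons.
  apply: perm_map; apply: uniq_perm; rewrite /= ?enum_uniq ?mem_enum ?vU //.
  by move=> w; rewrite !inE !mem_enum !inE.
- apply: perm_trans oT' _.
  have -> : map (mapt (updb f i v)) (map (mapt cv) new) = map (mapt nval) new.
    rewrite -map_comp; apply/eq_in_map => -[R s] /=; rewrite mem_filter /= => /andP[/andP[/allP sU vs] sD].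
    rewrite /mapt /= -map_comp; congr pair; apply/eq_in_map => w ws /=; apply: updE.
    exact: (tN (R, s)).
  apply: perm_trans (_ : perm_eq _ (map (mapt nval) (new ++ [seq t <- dblist D | all (mem U) t.2]))) _.
    by rewrite map_cat perm_cat2l.
  apply: perm_map; rewrite /new.
  have -> : [seq t <- dblist D | all (mem U) t.2] =
      [seq t <- [seq t <- dblist D | all (mem (v |: U)) t.2] | v \notin t.2].
    rewrite -filter_predI; apply: eq_filter => -[R s] /=.
    apply/allP/andP => [sU|[vs /allP sU] w ws].
      split; first by apply: contra vU => /sU.
      by apply/allP=> w /sU wU; rewrite /= !inE (wU : w \in U) orbT.
    have := sU w ws; rewrite /= !inE; case: eqP => // ew; by rewrite -ew ws in vs.
  have -> : [seq t <- dblist D | all (mem (v |: U)) t.2 & v \in t.2] =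
      [seq t <- [seq t <- dblist D | all (mem (v |: U)) t.2] | v \in t.2].
    by rewrite -filter_predI; apply: eq_filter => t0 /=; rewrite andbC.
  by rewrite perm_filterC.
- apply: wT' => //; apply/allP=> _ /mapP[[R s] rs ->]; rewrite size_map.
  move: rs; rewrite mem_filter => /andP[_ /dblistP[R' [u [_ [-> ->]]]]] /=.
  by rewrite size_tuple.
Qed.

Definition nbr (v w : 'I_n) : bool := has (fun t => (v \in t.2) && (w \in t.2)) (dblist D).

Lemma add_bag U T f (C : {set 'I_n}) : built U T -> hasbag T f -> covers f (C :&: U) -> #|C| <= c ->
  (forall v w, v \in C -> v \notin U -> w \in U -> nbr v w -> w \in C) ->
  exists T' f', [/\ built (C :|: U) T', hasbag T' f', covers f' C & forall g, hasbag T g -> hasbag T' g].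
Proof.
have [q] := ubnP #|C :\: U|; elim: q U T f => // q IH U T f /ltnSE CU bT hf cf Cc H.
have [C0|[v]] := set_0Vmem (C :\: U).
  have CsU : C \subset U by rewrite -setD_eq0 C0.
  exists T, f; split=> //; first by rewrite (setUidPr CsU).
  by move: cf; rewrite (setIidPl CsU).
rewrite inE => /andP[vU vC].
have [|||T1 [f1 [bT1 hf1 cf1 k1]]] := add_vertex bT hf cf vU.
- apply: leq_trans Cc; apply: proper_card; apply/properP; split; first exact: subsetIl.
  by exists v => //; rewrite inE (negPf vU) andbF.
- move=> t0 t0D t0U vt w wt; have := t0U w wt; rewrite !inE; case: eqP => //= wv wU; rewrite wU andbT.
  by apply: (H v w vC vU wU); rewrite /nbr; apply/hasP; exists t0 => //; rewrite vt.
- by rewrite inE (negPf vU) andbF.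
have [||||T2 [f2 [bT2 hf2 cf2 k2]]] := IH (v |: U) T1 f1 _ bT1 hf1.
- have := cardsD1 v (C :\: U); rewrite !inE vU vC setDDl setUC => e0; move: CU; rewrite e0; lia.
- move=> w; rewrite !inE => wCU; apply: cf1; rewrite !inE; case: eqP wCU => //= _ /andP[-> ->] //.
- exact: Cc.
- move=> v' w v'C; rewrite !inE negb_or => /andP[v'v v'U] /orP[/eqP-> //|wU]; exact: H.
exists T2, f2; split=> //; last by move=> g /k1/k2.
by move: bT2; rewrite setUCA setUA (setUidPr _ : v |: C = C) //; rewrite ?sub1set.
Qed.

(** Bags are added from the end of the sequence. By running intersection the old elements of a bag
    lie in one earlier treated bag, and some place of the forest sees that bag. *)
Lemma build (s : seq {set 'I_n}) : rip s -> (forall C, C \in s -> #|C| <= c) ->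
  (forall v w, has (fun C : {set 'I_n} => v \in C) s -> has (fun C : {set 'I_n} => w \in C) s -> nbr v w ->
     has (fun C : {set 'I_n} => (v \in C) && (w \in C)) s) ->
  exists T, built [set v | has (fun C : {set 'I_n} => v \in C) s] T /\
    forall C, C \in s -> exists2 f, hasbag T f & covers f C.
Proof.
elim: s => [|C s IH] /=.
  move=> _ _ _; exists (@Leaf k c); split=> //; split=> //=.
  - by rewrite (_ : [set v | false] = set0) ?enum_set0 //; apply/setP=> v; rewrite !inE.
  - rewrite (eq_in_filter (a2 := pred0)) ?filter_pred0 // => t0 /dblistP[R [u [uD ->]]] /=.
    by have := har R; rewrite -{1}(size_tuple u); case: (tval u) => //= w l _; rewrite inE.
move=> [rs rC] Cc H.
have [||T [bT cT]] := IH rs.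
- by move=> C' C's; apply: Cc; rewrite inE C's orbT.
- move=> v w vs ws vw; have := H v w; rewrite vs ws !orbT => /(_ isT isT vw) /orP[/andP[vC wC]|//].
  case: rC => [s0|[C' C's HC']]; first by rewrite s0 in vs.
  by apply/hasP; exists C' => //; rewrite !HC'.
set U := [set v | has _ s] in bT.
have [f hf cf] : exists2 f, hasbag T f & covers f (C :&: U).
  case: rC => [s0|[C' C's HC']].
    by exists inl; [exact: hasbag_inl|move=> w; rewrite !inE s0 /= andbF].
  have [f hf cf] := cT C' C's; exists f => // w; rewrite !inE => /andP[wC ws]; exact/cf/HC'.
have [||T' [f' [bT' hf' cf' k']]] := add_bag bT hf cf.
- by apply: Cc; rewrite mem_head.
- move=> v w vC; rewrite !inE => vs ws vw; have := H v w; rewrite vC ws orbT => /(_ isT isT vw).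
  case/orP=> [/andP[_ ->] //|/hasP[C' C's /andP[vC' _]]].
  by case/hasP: vs; exists C'.
exists T'; split.
  by rewrite (_ : [set v | _] = C :|: U) //; apply/setP=> v; rewrite !inE.
move=> C'; rewrite inE => /orP[/eqP->|/cT[g hg cg]]; first by exists f'.
by exists g => //; apply: k'.
Qed.
End Build.
End Insertion.

(** * Identifying a forest with its database through names *)

Section Names.
Variables (k t : nat).
Local Notation tree := (tree k t.+1).

Fixpoint nm (T : tree) : El T -> nat :=
  match T with
  | Leaf => fun _ => 0
  | Node _ _ x a b => fun z => match z with None => x | Some (inl u) => nm u | Some (inr u) => nm u end
  | Mk a => @nm a
  end.

Fixpoint els (T : tree) : seq (El T) :=
  match T with
  | Leaf => [::]
  | Node _ _ _ a b => None :: map (fun u => Some (inl u)) (els a) ++ map (fun u => Some (inr u)) (els b)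
  | Mk a => els a
  end.

Lemma names_els T : names T = map (@nm T) (els T).
Proof.
elim: T => [|i own x a IHa b IHb|a IH] //=.
by rewrite map_cat -!map_comp IHa IHb.
Qed.

Lemma mem_els T u : u \in els T.
Proof.
elim: T u => [|i own x a IHa b IHb|a IH]; [by case| |exact: IH].
case=> [[u|u]|] /=; rewrite inE ?eqxx //; apply/orP; right; rewrite mem_cat; apply/orP.
- by left; apply/mapP; exists u.
- by right; apply/mapP; exists u.
Qed.

Lemma size_els T : size (els T) = nd T.
Proof. by elim: T => [|i own x a IHa b IHb|a IH] //=; rewrite size_cat !size_map IHa IHb. Qed.

Lemma nm_inj T : uniq (names T) -> injective (@nm T).
Proof.
rewrite names_els => un u v e; have := mem_els u; have := mem_els v => vE uE.
rewrite -(nth_index u uE) -(nth_index u vE); congr nth.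
apply/eqP; rewrite -(nth_uniq 0 _ _ un) ?size_map ?index_mem //.
by rewrite !(nth_map u) ?index_mem // !nth_index // e.
Qed.

Definition nms (T : tree) (z : 'I_t.+1 + El T) : 'I_t.+1 + nat :=
  match z with inl j => inl j | inr u => inr (nm u) end.

Lemma otn_ot T : otn T = map (mapt (@nms T)) (ot T).
Proof.
elim: T => [|i own x a IHa b IHb|a IH] //=.
rewrite !map_cat -!map_comp IHa IHb -!map_comp; congr (_ ++ _); last first.
  by apply: eq_map => t0 /=; symmetry; apply: mapt_comp => -[].
congr (_ ++ _); apply: eq_map => t0; last first.
  by rewrite /=; apply: mapt_comp2 => -[j|u] //=; case: ifP.
by rewrite /mapt /= -!map_comp; congr pair; apply: eq_map => j /=; case: ifP.
Qed.

Lemma mapt_inj (A C : Type) (f : A -> C) : injective f -> injective (@mapt k A C f).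
Proof. by move=> fI [R s] [R' s'] [-> /(inj_map fI)->]. Qed.

Lemma names_mark K1 (T : tree) : names (mark K1 T) = names T.
Proof. by elim: T => [|i own x a IHa b IHb|a IH] //=; case: ifP => _ /=; rewrite IHa IHb. Qed.

Lemma otn_mark K1 (T : tree) : otn (mark K1 T) = otn T.
Proof. by elim: T => [|i own x a IHa b IHb|a IH] //=; case: ifP => _ /=; rewrite IHa IHb. Qed.

Variables (ar : 'I_k -> nat) (n : nat) (D : dbase ar n).
Hypothesis har : forall R, 0 < ar R.

Lemma built_mark K1 (U : {set 'I_n}) (T : tree) : built D U T -> built D U (mark K1 T).
Proof. by case=> h1 h2 h3; split; rewrite ?names_mark ?otn_mark ?wft_mark. Qed.

Theorem built_iso (T : tree) : built D setT T -> exists f : El T -> 'I_n, [/\ bijective f,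
  forall R s, ((R, s) \in cl T) = ((R, map f s) \in dblist D)
  & forall d, deg_le d (PDB D) -> degok d T].
Proof.
move=> [nT oT wT].
have un : uniq (names T) by rewrite (perm_uniq nT) map_inj_uniq ?enum_uniq //; apply: val_inj.
have nI := nm_inj un.
have nlt (u : El T) : nm u < n.
  have : nm u \in names T by rewrite names_els; apply/mapP; exists u => //; apply: mem_els.
  by rewrite (perm_mem nT) => /mapP[v _ ->]; apply: ltn_ord.
pose f (u : El T) : 'I_n := Ordinal (nlt u).
have fI : injective f by move=> u v /(congr1 val) /= /nI.
have nsI : injective (@nms T) by move=> [j|u] [j'|v] //= [] => [->|e] //; rewrite (nI _ _ e).
have nvI : injective (@nval t n) by move=> u v [] /val_inj.
have oT' : perm_eq (otn T) (map (mapt (@nval t n)) (dblist D)).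
  by rewrite (eq_filter (a2 := predT)) ?filter_predT // in oT => t0; apply/allP=> w _; rewrite /= inE.
exists f; split.
- apply: inj_card_bij => //; rewrite card_El_nd -size_els -(size_map (@nm T)) -names_els (perm_size nT).
  by rewrite size_map -cardE cardsT.
- move=> R s; rewrite mem_cl -(mem_map (mapt_inj nsI)) -otn_ot (perm_mem oT').
  rewrite -(mem_map (mapt_inj nvI)); have -> // : mapt (@nms T) (R, map inr s) = mapt (@nval t n) (R, map f s).
  by rewrite /mapt /= -!map_comp; congr pair; apply: eq_map.
- move=> d dD; apply/forallP=> u; apply: leq_trans (dD (f u)); rewrite deg_el_count /otdeg.
  have <- : count (fun t0 => inr (nm u) \in t0.2) (otn T) = count (fun t0 => inr u \in t0.2) (ot T).
    rewrite otn_ot count_map; apply: eq_count => t0 /=.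
    by rewrite -[inr (nm u)]/(nms (inr u)) mem_map.
  rewrite (permP oT') count_map leq_eqVlt; apply/orP; left; apply/eqP/eq_count => t0 /=.
  by rewrite -[inr (nm u)]/(nval t (f u)) mem_map.
Qed.

(** An elimination order of the decomposition tree is fed to [build]; bags of size [t.+1] match the
    number of colours. *)
Theorem tree_of_db d : class_C d t (PDB D) -> exists T : tree, built D setT T.
Proof.
case=> _ [m [e [B [[[m0 esym eirr econn ecard] Bcov Bedge Bconn] Bt]]]].
have [||s [rs es]] := @elimination _ m e B esym eirr setT.
- move=> [v|] i j _ _ /= wi wj.
    have := Bconn v i j wi wj; apply: connect_sub => x y /= /and3P[xy vx vy]; apply: connect1.
    by rewrite /eB /= !inE xy vx vy.
  have := econn i j; apply: connect_sub => x y xy; apply: connect1; by rewrite /eB /= !inE xy.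
- rewrite cardsT card_ord -ecard; apply: eq_leq; apply: eq_card => p; by rewrite !inE.
have bag x : B x \in s by rewrite es imset_f.
have cov v : has (fun C : {set 'I_n} => v \in C) s.
  by have [x vx] := Bcov v; apply/hasP; exists (B x).
have [||T [bT _]] := @build k t ar n D har s rs.
- by move=> C; rewrite es => /imsetP[x _ ->].
- move=> v w _ _ /hasP[t0 /dblistP[R [u [uD ->]]] /= /andP[vu wu]]; apply/hasP.
  have [->|vw] := eqVneq v w.
    by have [x vx] := Bcov w; exists (B x); rewrite ?vx.
  have [|x vwx] := Bedge v w; last by exists (B x).
  rewrite /gaifman vw; apply/existsP; exists R; apply/existsP; exists u.
  by rewrite uD vu wu.
exists T; rewrite (_ : setT = [set v | has (fun C : {set 'I_n} => v \in C) s]) //.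
by apply/setP=> v; rewrite !inE cov.
Qed.
End Names.

(** * Compiling expressions to the machine *)

Section Machine.
Variables (k : nat) (ar : 'I_k -> nat).

Inductive expr : Type :=
| ECon (c : nat)
| EReg (x : nat)
| ESuc (e : expr)
| EComp (R l j : nat) (e : expr)
| EEq (e1 e2 : expr).

Fixpoint eval (D : pdb ar) (m : nat -> nat) (e : expr) : nat :=
  match e with
  | ECon c => c
  | EReg x => m x
  | ESuc e => (eval D m e).+1
  | EComp R l j e => if oracle D R (eval D m e) j is Some s then nth 0 s l else 0
  | EEq e1 e2 => eval D m e1 == eval D m e2
  end.

Fixpoint below (b : nat) (e : expr) : bool :=
  match e with
  | ECon _ => true
  | EReg x => x < b
  | ESuc e => below b e
  | EComp _ _ _ e => below b e
  | EEq e1 e2 => below b e1 && below b e2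
  end.

Lemma below_le b b' e : b <= b' -> below b e -> below b' e.
Proof.
move=> bb'; elim: e => //= [x|e1 IH1 e2 IH2]; first by move=> h; apply: leq_trans bb'.
by case/andP=> /IH1-> /IH2->.
Qed.

Lemma eval_ext (D : pdb ar) m m' b e : (forall x, x < b -> m x = m' x) -> below b e -> eval D m e = eval D m' e.
Proof.
move=> H; elim: e => //= [e IH|R l j e IH|e1 IH1 e2 IH2]; try by move=> /IH->.
by case/andP=> /IH1-> /IH2->.
Qed.

Lemma map_eval_ext (D : pdb ar) m m' b es : (forall x, x < b -> m x = m' x) -> all (below b) es ->
  [seq eval D m e | e <- es] = [seq eval D m' e | e <- es].
Proof. by move=> H; elim: es => //= e es IH /andP[be /IH->]; rewrite (eval_ext D H be). Qed.

(* The component register is cleared before the query, so that it reads 0 when the answer is too short. *)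
Fixpoint compile (b : nat) (e : expr) : seq instr :=
  match e with
  | ECon c => [:: IConst b c]
  | EReg x => [:: IConst b 0; IAdd b x b]
  | ESuc e => compile b e ++ [:: IConst b.+1 1; IAdd b b b.+1]
  | EComp R l j e => compile b e ++
     [:: IConst b.+1 R; IConst b.+2 j; IConst (b.+3 + l.+1) 0; IQuery b.+3 b.+1 b b.+2; IMul b b.+3 (b.+3 + l.+1)]
  | EEq e1 e2 => compile b e1 ++ compile b.+1 e2 ++
     [:: ISub b.+2 b b.+1; ISub b.+3 b.+1 b; IAdd b.+2 b.+2 b.+3; IConst b.+3 1; ISub b b.+3 b.+2]
  end.

Definition straight (i : instr) : bool :=
  match i with IJz _ _ | IRand _ _ | IAccept | IReject => false | _ => true end.

Definition mstep (D : pdb ar) (m : nat -> nat) (i : instr) : nat -> nat := Defs.mem (det_step D i (Config 0 m)).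
Definition run (D : pdb ar) (code : seq instr) (m : nat -> nat) : nat -> nat := foldl (mstep D) m code.

Local Arguments run : simpl never.

Lemma run_cat (D : pdb ar) c1 c2 m : run D (c1 ++ c2) m = run D c2 (run D c1 m).
Proof. exact: foldl_cat. Qed.

Lemma setr_eq m a v : setr m a v a = v.
Proof. by rewrite /setr /upd eqxx. Qed.

Lemma setr_neq m a v x : x != a -> setr m a v x = m x.
Proof. by rewrite /setr /upd => /negPf->. Qed.

Lemma compile_straight b e : all straight (compile b e).
Proof. by elim: e b => //= [e IH|R l j e IH|e1 IH1 e2 IH2] b; rewrite !all_cat ?IH ?IH1 ?IH2. Qed.

Lemma compile_ok (D : pdb ar) e b m : below b e ->
  run D (compile b e) m b = eval D m e /\ forall x, x < b -> run D (compile b e) m x = m x.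
Proof.
elim: e b m => [c|y|e IH|R l j e IH|e1 IH1 e2 IH2] b m /=.
- move=> _; split=> [|x xb]; rewrite /run /= /mstep /= ?setr_eq // setr_neq //; lia.
- move=> yb; have yn : y != b by lia.
  split=> [|x xb]; rewrite /run /= /mstep /= ?setr_eq ?[setr _ _ _ y]setr_neq ?addn0 //.
  by rewrite !setr_neq //; lia.
- move=> be; have := IH b m be; rewrite run_cat; move: (run D (compile b e) m) => m1 [h1 h2].
  rewrite /run /= /mstep /=; split=> [|x xb].
    by do ![rewrite setr_eq | rewrite [setr _ _ _ _]setr_neq; [|by lia]]; rewrite h1 addn1.
  by do ![rewrite [setr _ _ _ _]setr_neq; [|by lia]]; apply: h2.
- move=> be; have := IH b m be; rewrite run_cat; move: (run D (compile b e) m) => m1 [h1 h2].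
  rewrite /run /= /mstep /=.
  set m2 := setr (setr (setr m1 _ _) _ _) _ _.
  have e1 : m2 b.+1 = R.
    rewrite /m2 setr_neq; last by lia. rewrite setr_neq; last by lia. by rewrite setr_eq.
  have e2 : m2 b.+2 = j by rewrite /m2 setr_neq ?setr_eq //; lia.
  have e3 : m2 b = eval D m e.
    rewrite /m2 setr_neq; last by lia. rewrite setr_neq; last by lia. rewrite setr_neq //; lia.
  have e4 x : x < b -> m2 x = m x.
    move=> xb; rewrite /m2 setr_neq; last by lia. rewrite setr_neq; last by lia. rewrite setr_neq ?h2 //; lia.
  rewrite e1 e2 e3; split=> [|x xb].
    rewrite setr_eq; case: (oracle _ _ _ _) => [s|] /=; last by rewrite setr_eq.
    rewrite eqxx ifF; last by lia.
    have -> : b.+3 < b.+3 + l.+1 by lia.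
    rewrite leq_add2l addKn /=; case: ltnP => ls; rewrite mul1n //.
    by rewrite /m2 setr_eq nth_default.
  rewrite setr_neq; last by lia.
  case: (oracle _ _ _ _) => [s|] /=; last by rewrite setr_neq ?e4 //; lia.
  rewrite ifF; last by lia.
  by rewrite ifF ?e4 //; lia.
case/andP=> b1 b2; have := IH1 b m b1; rewrite !run_cat; move: (run D (compile b e1) m) => m1 [h1 h2].
have := IH2 b.+1 m1 (below_le (leqnSn b) b2); move: (run D (compile b.+1 e2) m1) => m2 [h3 h4].
rewrite (@eval_ext D m1 m b e2 h2 b2) in h3.
have e3 : m2 b = eval D m e1 by rewrite h4 // h1.
rewrite /run /= /mstep /=; split=> [|x xb].
  do ![rewrite setr_eq | rewrite [setr _ _ _ _]setr_neq; [|by lia]].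
  rewrite h3 e3; case: eqP; lia.
rewrite !setr_neq ?h4 ?h2 //; lia.
Qed.

Definition horner_code (es : seq nat) : nat := foldl (fun a v => a + a + v) 0 es.

Definition code_bits (b : nat) (es : seq expr) : seq instr :=
  IConst b 0 :: flatten [seq compile b.+1 e ++ [:: IAdd b b b; IAdd b b b.+1] | e <- es].

Lemma code_bits_ok (D : pdb ar) b es m : all (below b) es ->
  run D (code_bits b es) m b = horner_code [seq eval D m e | e <- es] /\
  forall x, x < b -> run D (code_bits b es) m x = m x.
Proof.
move=> bes; rewrite /code_bits /horner_code.
have -> : run D (IConst b 0 :: flatten [seq compile b.+1 e ++ [:: IAdd b b b; IAdd b b b.+1] | e <- es]) m =
  run D (flatten [seq compile b.+1 e ++ [:: IAdd b b b; IAdd b b b.+1] | e <- es]) (setr m b 0) by [].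
have : forall x, x < b -> setr m b 0 x = m x by move=> x xb; rewrite setr_neq //; lia.
move: (setr_eq m b 0); move: (setr m b 0) => m1; move: 0 => a.
elim: es a m1 bes => [|e es IH] a m1 //= /andP[be bes] ea H.
have := compile_ok D m1 (below_le (leqnSn b) be); rewrite !run_cat.
move: (run D (compile b.+1 e) m1) => m3 [h1 h2]; set m2 := run D _ m3.
have eb : eval D m1 e = eval D m e by apply: (@eval_ext D m1 m b).
have e2 : m2 b = a + a + eval D m e.
  rewrite /m2 /run /= /mstep /=; do ![rewrite setr_eq | rewrite [setr _ _ _ _]setr_neq; [|by lia]].
  by rewrite (h2 b (ltnSn b)) ea h1 eb.
have H2 x : x < b -> m2 x = m x.
  move=> xb; rewrite /m2 /run /= /mstep /=; do ![rewrite [setr _ _ _ _]setr_neq; [|by lia]].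
  by rewrite h2 ?H // ltnW.
by rewrite -e2; apply: IH.
Qed.

Lemma code_bits_straight b es : all straight (code_bits b es).
Proof. by rewrite /=; elim: es => //= e es IH; rewrite !all_cat compile_straight IH. Qed.

Lemma horner_code_inj s s' : size s = size s' -> all (leq^~ 1) s -> all (leq^~ 1) s' ->
  horner_code s = horner_code s' -> s = s'.
Proof.
rewrite /horner_code; elim/last_ind: s s' => [|s v IH] s'; first by case: s'.
case/lastP: s' => [|s' v']; rewrite !size_rcons //= => -[sz].
rewrite !all_rcons !foldl_rcons => /andP[v1 h] /andP[v1' h'] e.
have ev : v = v' by move: e; move: (foldl _ _ _) (foldl _ _ s') => x y; lia.
by subst v'; rewrite (IH s') //; move: e; move: (foldl _ _ _) (foldl _ _ s') => x y; lia.
Qed.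

Lemma horner_code_lt s : all (leq^~ 1) s -> horner_code s < 2 ^ size s.
Proof.
rewrite /horner_code; elim/last_ind: s => [|s v IH] //; rewrite all_rcons foldl_rcons size_rcons expnS => /andP[v1 /IH].
by move: (foldl _ _ _) => x; lia.
Qed.

(** The register [b.+1] holds the product of the distances of the code to the table entries, which
    vanishes exactly on members of the table. *)
Definition lookup (b : nat) (tab : seq nat) : seq instr :=
  IConst b.+1 1 :: flatten [seq [:: IConst b.+2 c; ISub b.+3 b b.+2; ISub b.+4 b.+2 b; IAdd b.+3 b.+3 b.+4;
    IMul b.+1 b.+1 b.+3] | c <- tab].

Lemma lookup_ok (D : pdb ar) b tab m : (run D (lookup b tab) m b.+1 == 0) = (m b \in tab).
Proof.
rewrite /lookup.
have -> : forall s, run D (IConst b.+1 1 :: s) m = run D s (setr m b.+1 1) by [].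
suff H a m1 : (m1 b.+1 == 0) = a -> m1 b = m b -> (run D (flatten [seq [:: IConst b.+2 c; ISub b.+3 b b.+2;
    ISub b.+4 b.+2 b; IAdd b.+3 b.+3 b.+4; IMul b.+1 b.+1 b.+3] | c <- tab]) m1 b.+1 == 0) = a || (m b \in tab).
  by rewrite (H false) ?setr_eq // setr_neq //; lia.
elim: tab m1 a => [|c tab IH] m1 a e0 eb /=; first by rewrite orbF.
rewrite -[X in run D X m1]/([:: IConst b.+2 c; ISub b.+3 b b.+2; ISub b.+4 b.+2 b; IAdd b.+3 b.+3 b.+4;
  IMul b.+1 b.+1 b.+3] ++ _) run_cat; set m2 := run D _ m1.
rewrite (IH m2 (a || (m b == c))); first by rewrite inE orbA.
  rewrite /m2 /run /= /mstep /= setr_eq muln_eq0; congr orb.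
    by rewrite !setr_neq ?e0 //; lia.
  do ![rewrite setr_eq | rewrite [setr _ _ _ _]setr_neq; [|by lia]].
  rewrite eb.
  by apply/idP/idP; lia.
by rewrite /m2 /run /= /mstep /=; do ![rewrite [setr _ _ _ _]setr_neq; [|by lia]].
Qed.

Lemma lookup_straight b tab : all straight (lookup b tab).
Proof. by rewrite /=; elim: tab. Qed.
Definition placed (prog code : seq instr) (p : nat) : Prop :=
  forall i, i < size code -> nth IReject prog (p + i) = nth IReject code i.

Lemma placed_cons prog i code p : placed prog (i :: code) p -> nth IReject prog p = i /\ placed prog code p.+1.
Proof.
move=> H; split; first by have := H 0 isT; rewrite addn0.
by move=> j jc; have := H j.+1 jc; rewrite addnS -addSn.
Qed.

Lemma placed_cat code1 code2 code3 : placed (code1 ++ code2 ++ code3) code2 (size code1).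
Proof.
move=> i ic; rewrite nth_cat ltnNge leq_addr /= addKn nth_cat ic //.
Qed.

Lemma det_straight (D : pdb ar) i p m : straight i -> det_step D i (Config p m) = Config p.+1 (mstep D m i).
Proof. by case: i. Qed.

Lemma prob_straight (D : pdb ar) prog code p m b fuel : all straight code -> placed prog code p ->
  prob_out prog D b (size code + fuel) (Config p m) = prob_out prog D b fuel (Config (p + size code) (run D code m)).
Proof.
elim: code p m => [|i code IH] p m /=; first by rewrite addn0.
case/andP=> si sc /placed_cons[ei /(IH p.+1 _ sc) e].
transitivity (prob_out prog D b (size code + fuel) (det_step D i (Config p m))).
  by rewrite /= ei; case: i si {ei}.
by rewrite det_straight // e addnS.
Qed.

Lemma bounded_straight (D : pdb ar) prog code p m q fuel Q : all straight code -> placed prog code p ->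
  (forall m' q', Q <= q' -> bounded_run prog D fuel q' (Config (p + size code) m')) -> size code + Q <= q ->
  bounded_run prog D (size code + fuel) q (Config p m).
Proof.
elim: code p m q => [|i code IH] p m q /=; first by rewrite addn0 => _ _ H; apply: H.
case/andP=> si sc /placed_cons[ei pc] H hq.
have {}IH q1 : size code + Q <= q1 -> bounded_run prog D (size code + fuel) q1 (det_step D i (Config p m)).
  by move=> h; rewrite det_straight //; apply: IH => // m' q' h'; rewrite addSnnS; apply: H.
rewrite ei; have h1 := IH q; have h2 := IH q.-1.
by case: i si {ei IH} h1 h2 => //= *; try (split; [lia|]); auto with nocore; (try match goal with h : _ -> ?G |- ?G => apply: h end); lia.
Qed.

Fixpoint cnt (vs : seq nat) (s : nat) (F : seq nat -> bool) : nat :=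
  if s is s'.+1 then \sum_(v <- vs) cnt vs s' (fun tau => F (v :: tau)) else F [::].

Lemma cnt_ext vs s F1 F2 : (forall tau, size tau = s -> F1 tau = F2 tau) -> cnt vs s F1 = cnt vs s F2.
Proof.
elim: s F1 F2 => [|s IH] F1 F2 H /=; first by rewrite H.
by apply: eq_bigr => v _; apply: IH => tau st; apply: H; rewrite /= st.
Qed.

Fixpoint load (i : nat) (tau : seq nat) (m : nat -> nat) : nat -> nat :=
  if tau is v :: tau' then load i.+1 tau' (setr m i.+1 v) else m.

Lemma loadE i tau m x : load i tau m x = if i < x <= i + size tau then nth 0 tau (x - i.+1) else m x.
Proof.
elim: tau i m => [|v tau IH] i m /=; first by rewrite addn0 ifF //; lia.
rewrite IH; case: ifP => h.
  by rewrite ifT; [have -> : x - i.+1 = (x - i.+2).+1 by lia | lia].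
case: (x =P i.+1) => [->|/eqP xi]; first by rewrite setr_eq ifT ?subnn //; lia.
by rewrite setr_neq // ifF //; lia.
Qed.

Lemma foldr_INR (T : Type) (vs : seq T) (f : T -> nat) (c : R) :
  foldr (fun v s => Rplus (Rdiv (INR (f v)) c) s) R0 vs = Rdiv (INR (\sum_(v <- vs) f v)) c.
Proof.
elim: vs => [|v vs IH] /=; first by rewrite big_nil /= /Rdiv Rmult_0_l.
by rewrite IH big_cons plus_INR /Rdiv Rmult_plus_distr_r.
Qed.

Lemma prob_rand (D : pdb ar) prog b fuel s i m (acc : (nat -> nat) -> bool) :
  (forall m', m' 0 = m 0 -> prob_out prog D b fuel (Config (i + s) m') = if acc m' then R1 else R0) ->
  placed prog [seq IRand j.+1 0 | j <- iota i s] i ->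
  prob_out prog D b (s + fuel) (Config i m) =
    Rdiv (INR (cnt (rand_vals (m 0)) s (fun tau => acc (load i tau m)))) (INR (size (rand_vals (m 0)) ^ s)).
Proof.
elim: s i m => [|s IH] i m H.
  by rewrite addn0 in H; rewrite /= H // /Rdiv Rinv_1 Rmult_1_r; case: (acc m).
rewrite [iota _ _]/= [map _ _]/= => /placed_cons[ei pl].
have E v : prob_out prog D b (s + fuel) (Config i.+1 (setr m i.+1 v)) =
    Rdiv (INR (cnt (rand_vals (m 0)) s (fun tau => acc (load i (v :: tau) m)))) (INR (size (rand_vals (m 0)) ^ s)).
  by rewrite IH // => m' h; rewrite addSnnS; apply: H; rewrite h setr_neq.
rewrite addSn /= ei; set vs := rand_vals (m 0) in E *.
have E2 l : foldr (fun v r => Rplus (prob_out prog D b (s + fuel) (Config i.+1 (setr m i.+1 v))) r) R0 l =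
    foldr (fun v r => Rplus (Rdiv (INR (cnt vs s (fun tau => acc (load i (v :: tau) m)))) (INR (size vs ^ s))) r) R0 l.
  by elim: l => //= v l ->; rewrite E.
rewrite E2.
by rewrite foldr_INR expnS mult_INR /Rdiv Rinv_mult -!Rmult_assoc [Rmult (Rinv _) (INR _)]Rmult_comm.
Qed.

Lemma bounded_rand (D : pdb ar) prog fuel s i m q :
  (forall m', bounded_run prog D fuel q (Config (i + s) m')) ->
  placed prog [seq IRand j.+1 0 | j <- iota i s] i -> bounded_run prog D (s + fuel) q (Config i m).
Proof.
elim: s i m => [|s IH] i m H; first by rewrite addn0 in H.
rewrite [iota _ _]/= [map _ _]/= => /placed_cons[ei pl].
by rewrite addSn /= ei => v _; apply: IH => // m'; rewrite addSnnS.
Qed.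

(** The table is obtained classically. Only the finiteness of the range matters, since the table is
    written into the program and never computed. *)
Lemma finite_table (Q : nat -> Prop) N : exists tab : seq nat, forall c, c < N -> c \in tab <-> Q c.
Proof.
elim: N => [|N [tab IH]]; first by exists [::].
case: (classic (Q N)) => [qN|qN].
  exists (N :: tab) => c; rewrite ltnS inE leq_eqVlt; case: (c =P N) => [->|_ /IH] //.
exists [seq c <- tab | c < N] => c; rewrite mem_filter ltnS leq_eqVlt.
by case: (c =P N) => [->|_ /= h]; [rewrite ltnn | rewrite h IH].
Qed.

Definition regs (D : pdb ar) (tau : seq nat) (x : nat) : nat := if x is x'.+1 then nth 0 tau x' else dom D.

(* Any decision depending only on finitely many 0-1 valued expressions is taken by a table. *)
Theorem table_tester (s : nat) (es : seq expr) (Dom : pdb ar -> Prop) (Acc : pdb ar -> seq nat -> Prop) :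
  all (below s.+1) es ->
  (forall D tau, all (leq^~ 1) [seq eval D (regs D tau) e | e <- es]) ->
  (forall D D' tau tau', Dom D -> Dom D' -> size tau = s -> size tau' = s ->
     [seq eval D (regs D tau) e | e <- es] = [seq eval D' (regs D' tau') e | e <- es] -> Acc D tau -> Acc D' tau') ->
  exists prog T q, forall D, bounded_run prog D T q (init_config D) /\
    (Dom D -> exists F : seq nat -> bool, (forall tau, size tau = s -> F tau <-> Acc D tau) /\
      forall b, prob_out prog D b T (init_config D) =
        Rdiv (INR (cnt (rand_vals (dom D)) s (fun tau => F tau == b))) (INR (size (rand_vals (dom D)) ^ s))).
Proof.
move=> bes es1 inv; pose val D tau := [seq eval D (regs D tau) e | e <- es].
(* The table holds the packed bit vectors of all accepting pairs of database and sample; by [inv] a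
   bit vector determines acceptance. *)
have [tab Htab] := finite_table (fun c => exists D tau, [/\ Dom D, size tau = s, Acc D tau & horner_code (val D tau) = c])
  (2 ^ size es).
pose b0 := s.+1; pose SL := code_bits b0 es ++ lookup b0 tab.
pose rnd := [seq IRand j.+1 0 | j <- iota 0 s].
have sr : size rnd = s by rewrite size_map size_iota.
(* The jump goes two places past the [IJz], to [IAccept]; it is taken when the product computed by
   [lookup] is 0. *)
pose tl := [:: IJz b0.+1 (s + size SL + 2); IReject; IAccept].
pose prog := rnd ++ SL ++ tl.
have sSL : all straight SL by rewrite all_cat code_bits_straight lookup_straight.
have pSL : placed prog SL s by rewrite -sr; apply: placed_cat.
have pr : placed prog rnd 0 by apply: (@placed_cat [::]).
have ptl : placed prog tl (s + size SL).
  by have := @placed_cat (rnd ++ SL) tl [::]; rewrite cats0 -catA size_cat sr.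
have [t0 /placed_cons[t1 /placed_cons[t2 _]]] := placed_cons ptl.
rewrite -addn2 in t2.
have Btl (D : pdb ar) m q : bounded_run prog D 2 q (Config (s + size SL) m).
  by rewrite /= t0 /=; case: ifP => _ /=; rewrite ?t1 ?t2.
have Ptl (D : pdb ar) m b : prob_out prog D b 2 (Config (s + size SL) m) = if (m b0.+1 == 0) == b then R1 else R0.
  by rewrite /= t0 /=; case: ifP => _ /=; rewrite ?t1 ?t2; case: b.
exists prog, (s + (size SL + 2)), (size SL) => D; split.
  apply: bounded_rand => // m; apply: (@bounded_straight D prog SL s m (size SL) 2 0) => //; last by rewrite addn0.
move=> DD; exists (fun tau => horner_code (val D tau) \in tab); split.
  move=> tau st; have lt : horner_code (val D tau) < 2 ^ size es.
    by rewrite -(size_map (eval D (regs D tau)) es); apply: horner_code_lt; apply: es1.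
  split=> [/(Htab _ lt)[D' [tau' [DD' st' A' e]]]|A]; last by apply/(Htab _ lt); exists D, tau.
  apply: (inv D' D tau' tau) => //; apply: horner_code_inj e; rewrite ?size_map //; exact: es1.
move=> b; rewrite (@prob_rand D prog b (size SL + 2) s 0 _ (fun m => (run D SL m b0.+1 == 0) == b)) //; last first.
  by move=> m' _; rewrite add0n prob_straight // Ptl.
rewrite /init_config /=; congr (Rdiv (INR _) _).
apply: cnt_ext => tau st; set m := load 0 tau _.
rewrite /SL run_cat lookup_ok; have [-> _] := code_bits_ok D m bes.
congr ((horner_code _ \in tab) == b); apply: (@map_eval_ext D _ _ b0) bes.
move=> [|x]; rewrite /m loadE //= add0n st /b0 ltnS => ->.
by rewrite subn1.
Qed.
End Machine.

From mathcomp Require Import all_order all_algebra ring lra.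
Import Order.TTheory GRing.Theory Num.Theory.

(** * Transport of labellings along views *)

Section ConditionalExpectation.
Local Open Scope ring_scope.
Variables (V : finType).

Definition csize (B : finType) (b : V -> B) (x : V) : nat := #|[set z | b z == b x]|.
Definition favg (B : finType) (b : V -> B) (f : V -> rat) (T : B) : rat :=
  (\sum_(z | b z == T) f z) / #|[set z | b z == T]|%:R.
Definition cexp (B : finType) (b : V -> B) (f : V -> rat) (x : V) : rat := favg b f (b x).

Lemma csize_gt0 (B : finType) (b : V -> B) x : 0 < (csize b x)%:R :> rat.
Proof. by rewrite ltr0n; apply/card_gt0P; exists x; rewrite inE. Qed.

(** Conditional expectation does not change averages against functions that are constant on the
    classes. *)
Lemma cexpE (B : finType) (b : V -> B) (f h : V -> rat) : (forall x y, b x = b y -> h x = h y) ->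
  \sum_x h x * cexp b f x = \sum_x h x * f x.
Proof.
move=> hb.
rewrite (eq_bigr (fun x => \sum_(z | b z == b x) h x * f z / (csize b x)%:R)); last first.
  by move=> x _; rewrite /cexp /favg mulrA big_distrr big_distrl.
rewrite (exchange_big_dep predT) //=; apply: eq_bigr => z _.
rewrite (eq_bigr (fun x => h z * f z / (csize b z)%:R)); last first.
  by move=> x /eqP e; rewrite (hb _ _ e) /csize e.
rewrite sumr_const (_ : #|_| = csize b z); last first.
  by rewrite /csize; apply: eq_card => x; rewrite !inE eq_sym.
by rewrite -[LHS]mulr_natr divfK // gt_eqF // csize_gt0.
Qed.

Lemma cexp_eq (B : finType) (b : V -> B) f x y : b x = b y -> cexp b f x = cexp b f y.
Proof. by move=> e; rewrite /cexp e. Qed.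

Lemma favg_bound (B : finType) (b : V -> B) f T : (forall z, 0 <= f z <= 1) -> 0 <= favg b f T <= 1.
Proof.
move=> H; rewrite /favg; apply/andP; split.
  by apply: divr_ge0; rewrite ?ler0n //; apply: sumr_ge0 => z _; case/andP: (H z).
have [->|c0] := posnP #|[set z | b z == T]|; first by rewrite invr0 mulr0.
rewrite ler_pdivrMr ?ltr0n // mul1r -sum1dep_card natr_sum.
by apply: ler_sum => z _; case/andP: (H z).
Qed.

Lemma cexp_bound (B : finType) (b : V -> B) f x : (forall z, 0 <= f z <= 1) -> 0 <= cexp b f x <= 1.
Proof. exact: favg_bound. Qed.

Definition energy (B : finType) (b : V -> B) f : rat := \sum_x cexp b f x ^+ 2.

Lemma energy_diff (B C : finType) (b : V -> B) (c : V -> C) f : (forall x y, c x = c y -> b x = b y) ->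
  \sum_x (cexp c f x - cexp b f x) ^+ 2 = energy c f - energy b f.
Proof.
move=> cb.
have e1 : \sum_x cexp b f x * cexp c f x = \sum_x cexp b f x * f x.
  by apply: cexpE => x y /cb; apply: cexp_eq.
have e2 : \sum_x cexp b f x * cexp b f x = \sum_x cexp b f x * f x.
  by apply: cexpE => x y; apply: cexp_eq.
have -> : energy c f - energy b f = energy c f - 2 * (\sum_x cexp b f x * cexp c f x) + energy b f.
  rewrite /energy e1 -e2; have -> : \sum_x cexp b f x * cexp b f x = \sum_x cexp b f x ^+ 2 by [].
  ring.
rewrite /energy mulr_sumr -sumrB -big_split /=; apply: eq_bigr => x _; ring.
Qed.

Lemma energy_bound (B : finType) (b : V -> B) f : (forall z, 0 <= f z <= 1) -> 0 <= energy b f <= #|V|%:R.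
Proof.
move=> H; rewrite /energy; apply/andP; split; first by apply: sumr_ge0 => x _; apply: sqr_ge0.
rewrite -sum1_card natr_sum; apply: ler_sum => x _.
have /andP[h0 h1] := cexp_bound b x H; rewrite expr2; nra.
Qed.

(* AM-GM in the form [|z| <= q + z^2 / q]. *)
Lemma sum_abs_le (g : V -> rat) (q th : rat) : 0 < q -> \sum_x g x ^+ 2 <= th * #|V|%:R ->
  \sum_x `|g x| <= (q + th / q) * #|V|%:R.
Proof.
move=> q0 H.
apply: (@le_trans _ _ (\sum_x (q + g x ^+ 2 / q))).
  apply: ler_sum => x _; rewrite -(ler_pM2r q0) mulrDl mulfVK ?gt_eqF //.
  rewrite -real_normK ?num_real //; have := normr_ge0 (g x); move: `|g x| => z z0.
  have := sqr_ge0 (z - q / 2); rewrite !expr2; nra.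
rewrite big_split /= sumr_const -[q *+ _]mulr_natr mulrDl lerD2l -mulr_suml.
by rewrite mulrAC ler_pM2r ?invr_gt0.
Qed.
End ConditionalExpectation.

Section Pigeonhole.
Local Open Scope ring_scope.
(** Telescoping: if all the first [J.+1] increments exceeded [th], the bounded sequence would leave
    its bound. *)
Lemma small_increment (s : nat -> rat) (B th : rat) (J : nat) : (forall j, 0 <= s j <= B) -> B < th * J.+1%:R ->
  exists2 j, (j <= J)%N & s j.+1 - s j <= th.
Proof.
move=> sB H.
have [/existsP[j hj]|nex] := boolP [exists j : 'I_J.+1, s j.+1 - s j <= th].
  by exists j; rewrite // -ltnS.
exfalso; have /andP[s0 _] := sB 0%N; have /andP[_ sJ] := sB J.+1.
have : \sum_(j < J.+1) th <= \sum_(j < J.+1) (s j.+1 - s j).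
  by apply: ler_sum => j _; move/existsPn: nex => /(_ j); rewrite -ltNge => /ltW.
rewrite sumr_const card_ord -[th *+ _]mulr_natr -(big_mkord predT (fun j => s j.+1 - s j)) telescope_sumr //.
lra.
Qed.
End Pigeonhole.

(** * Rounding proportions to counts *)

Section Rounding.
Local Open Scope ring_scope.

Lemma prescribed_counts (V K : finType) (X : {set V}) (c0 : K) (m : K -> nat) : (\sum_c m c)%N = #|X| ->
  exists h : V -> K, (forall x, x \in X -> (0 < m (h x))%N) /\
    forall c, #|[set x in X | h x == c]| = m c.
Proof.
move=> sm; pose L := flatten [seq nseq (m c) c | c <- enum K].
have sL : size L = #|X|.
  rewrite size_flatten /shape -map_comp sumnE big_map big_enum /= -sm.
  by apply: eq_bigr => c _; rewrite size_nseq.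
have cL c : count_mem c L = m c.
  rewrite count_flatten -map_comp sumnE big_map big_enum /= (bigD1 c) //= count_nseq /= eqxx mul1n.
  by rewrite big1 ?addn0 // => c' /negPf c'c; rewrite count_nseq /= c'c.
exists (fun x => nth c0 L (index x (enum X))); split.
  move=> x xX; rewrite -cL -has_count has_pred1 mem_nth // sL cardE index_mem mem_enum //.
move=> c; rewrite -cL.
have eL : L = [seq nth c0 L (index x (enum X)) | x <- enum X].
  apply: (@eq_from_nth _ c0); first by rewrite size_map -cardE.
  move=> i iL; have [x0 _] : exists x0, x0 \in X by apply/card_gt0P; rewrite -sL; case: (L) iL.
  by rewrite (nth_map x0) -?cardE -?sL // index_uniq ?enum_uniq // -cardE -sL.
rewrite [in RHS]eL count_map -size_filter cardE; apply: perm_size; apply: uniq_perm.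
- exact: enum_uniq.
- exact/filter_uniq/enum_uniq.
by move=> x; rewrite [RHS]mem_filter [LHS]mem_enum mem_enum inE andbC.
Qed.

(** Each class gets the floor of its proportional share, and the at most [#|K|] elements left over
    go to the class of [g0]. A class with a positive count is nonempty, so a point of [Y] can be
    chosen in it. *)
Lemma rounding (V V' K : finType) (X : {set V}) (Y : {set V'}) (g0 : V') (kp : V' -> K) : g0 \in Y ->
  exists chi : V -> V', (forall x, x \in X -> chi x \in Y) /\
    forall c, `|#|[set x in X | kp (chi x) == c]|%:R
      - #|X|%:R * #|[set g in Y | kp g == c]|%:R / #|Y|%:R| <= #|K|%:R :> rat.
Proof.
move=> g0Y; pose Yc c := #|[set g in Y | kp g == c]|.
have Y0 : (0 < #|Y|)%N by apply/card_gt0P; exists g0.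
have sY : (\sum_c Yc c)%N = #|Y|.
  rewrite -sum1_card (partition_big kp predT) //=; apply: eq_bigr => c _.
  by rewrite /Yc -sum1dep_card; apply: eq_bigl => g.
pose m c := (#|X| * Yc c %/ #|Y|)%N.
have mle c : (m c * #|Y| <= #|X| * Yc c)%N by apply: leq_trunc_div.
have mge c : (#|X| * Yc c < (m c).+1 * #|Y|)%N by apply: ltn_ceil.
have sm : (\sum_c m c <= #|X|)%N.
  rewrite -(leq_pmul2r Y0) big_distrl /=; apply: (@leq_trans (\sum_c #|X| * Yc c)); first exact: leq_sum.
  by rewrite -big_distrr /= sY.
have sm2 : (#|X| <= \sum_c m c + #|K|)%N.
  have -> : (\sum_c m c + #|K| = \sum_c (m c).+1)%N.
    rewrite [RHS](eq_bigr (fun c => m c + 1)%N); last by move=> c _; rewrite addn1.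
    by rewrite big_split /= sum1_card.
  rewrite -(leq_pmul2r Y0) -{1}sY big_distrr big_distrl /=.
  by apply: leq_sum => c _; apply: ltnW.
pose r := (#|X| - \sum_c m c)%N; have rK : (r <= #|K|)%N by rewrite /r leq_subLR.
have [|h [hpos hc]] := @prescribed_counts V K X (kp g0) (fun c => (m c + (c == kp g0) * r)%N).
  have e : (\sum_c (c == kp g0) * r)%N = r.
    by rewrite (bigD1 (kp g0)) //= eqxx mul1n big1 ?addn0 // => c /negPf->.
  by rewrite big_split /= e /r subnKC.
pose chi x := if [pick g in Y | kp g == h x] is Some g then g else g0.
have chiP x : x \in X -> (chi x \in Y) /\ kp (chi x) = h x.
  move=> xX; rewrite /chi; case: pickP => [g /andP[gY /eqP //]|no].
  exfalso; have := hpos x xX; case: eqP => [e|_]; first by have := no g0; rewrite g0Y e eqxx.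
  rewrite addn0 /m; case: (posnP (Yc (h x))) => [->|]; first by rewrite muln0 div0n.
  by case/card_gt0P=> g; rewrite inE no.
exists chi; split=> [x xX|c]; first by case: (chiP x xX).
have -> : #|[set x in X | kp (chi x) == c]| = (m c + (c == kp g0) * r)%N.
  by rewrite -hc; apply: eq_card => x; rewrite !inE; case xX: (x \in X) => //=; rewrite (chiP x xX).2.
have Yr : 0 < #|Y|%:R :> rat by rewrite ltr0n.
rewrite -(ler_pM2r Yr) -{2}(gtr0_norm Yr) -normrM mulrBl mulfVK ?gt_eqF // -!natrM.
have h1 : ((m c + (c == kp g0) * r) * #|Y| <= #|X| * Yc c + #|K| * #|Y|)%N.
  have := mle c; have := leq_mul rK (leqnn #|Y|); case: (c == _); nia.
have h2 : (#|X| * Yc c <= (m c + (c == kp g0) * r) * #|Y| + #|K| * #|Y|)%N.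
  have := mge c; have : (0 < #|K|)%N by apply/card_gt0P; exists c.
  by case: (c == _); nia.
rewrite ler_norml; move: h1 h2; rewrite -!(ler_nat rat) !natrD -/(Yc c).
move: (_ * #|Y|)%:R (#|X| * Yc c)%:R (#|K| * #|Y|)%:R => x1 x2 x3 h1 h2.
by apply/andP; split; lra.
Qed.
End Rounding.

(** * Rooted views and walks along ports *)

Section Views.
Variable P : finType.

Definition walk (S : Type) (go : S -> P -> option S) (o : option S) (w : seq P) : option S :=
  foldl (fun o p => obind (fun x => go x p) o) o w.

Lemma walk_cat (S : Type) (go : S -> P -> option S) o w w' : walk go o (w ++ w') = walk go (walk go o w) w'.
Proof. exact: foldl_cat. Qed.

Definition same_view (S S' : finType) (go : S -> P -> option S) (go' : S' -> P -> option S') (r : nat)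
    (x : S) (y : S') : Prop :=
  forall w w', size w <= r -> size w' <= r ->
    (walk go (Some x) w == walk go (Some x) w') = (walk go' (Some y) w == walk go' (Some y) w') /\
    (walk go (Some x) w == None) = (walk go' (Some y) w == None).

(* The rooted view of radius [r]; it is rigid because walks are labelled by ports, and it takes
   finitely many values, numbered here by an ordinal. *)
Lemma view_sealed : {N : nat -> nat & {v : forall S : finType, (S -> P -> option S) -> forall r, S -> 'I_(N r) |
  forall (S S' : finType) (go : S -> P -> option S) (go' : S' -> P -> option S') r x y,
    v S go r x = v S' go' r y <-> same_view go go' r x y}}.
Proof.
pose Tv r : finType := ({ffun r.-bseq P * r.-bseq P -> bool} * {ffun r.-bseq P -> bool})%type.
pose vw (S : finType) (go : S -> P -> option S) r (x : S) : Tv r :=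
  ([ffun p : r.-bseq P * r.-bseq P => walk go (Some x) (bseqval p.1) == walk go (Some x) (bseqval p.2)],
   [ffun w : r.-bseq P => walk go (Some x) (bseqval w) == None]).
exists (fun r => #|Tv r|), (fun S go r x => enum_rank (vw S go r x)) => S S' go go' r x y; split.
  move=> /enum_rank_inj [/ffunP e1 /ffunP e2] w w' sw sw'.
  by have := e1 (Bseq sw, Bseq sw'); have := e2 (Bseq sw); rewrite !ffunE.
move=> H; congr enum_rank; rewrite /vw; congr pair; apply/ffunP.
  by move=> [w w']; rewrite !ffunE; case: (H w w' (size_bseq _) (size_bseq _)).
by move=> w; rewrite !ffunE; case: (H w w (size_bseq _) (size_bseq _)).
Qed.

Definition nview := projT1 view_sealed.
Definition view := proj1_sig (projT2 view_sealed).
Arguments view {S} go r x.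

Lemma viewP (S S' : finType) (go : S -> P -> option S) (go' : S' -> P -> option S') r x y :
  view go r x = view go' r y <-> same_view go go' r x y.
Proof. exact: (proj2_sig (projT2 view_sealed)). Qed.

Section TwoStructures.
Variables (S S' : finType) (go : S -> P -> option S) (go' : S' -> P -> option S').

Lemma view_le r r' x y : r <= r' -> view go r' x = view go' r' y -> view go r x = view go' r y.
Proof.
by move=> rr' /viewP H; apply/viewP => w w' sw sw'; apply: H; apply: leq_trans rr'.
Qed.

(** Words from the endpoint are compared by prefixing them with [w], which costs at most [m] of the
    radius. *)
Lemma view_walk r m x y w x1 : view go (r + m) x = view go' (r + m) y -> size w <= m ->
  walk go (Some x) w = Some x1 -> exists2 y1, walk go' (Some y) w = Some y1 & view go r x1 = view go' r y1.
Proof.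
move=> /viewP H sw ex.
have [_] := H w w (leq_trans sw (leq_addl _ _)) (leq_trans sw (leq_addl _ _)).
rewrite ex; case ey: (walk go' (Some y) w) => [y1|] // _; exists y1 => //; apply/viewP => u u' su su'.
have [||e1 e2] := H (w ++ u) (w ++ u'); first by rewrite size_cat addnC leq_add.
  by rewrite size_cat addnC leq_add.
by move: e1 e2; rewrite !walk_cat ex ey.
Qed.

Lemma view_return r x y w : view go r x = view go' r y -> size w <= r ->
  walk go (Some x) w = Some x -> walk go' (Some y) w = Some y.
Proof.
move=> /viewP H sw ex; have [e _] := H w [::] sw (leq0n _).
by move: e; rewrite ex /= eqxx => /esym/eqP.
Qed.
End TwoStructures.
End Views.

(** * Averaging labels over classes of equal views *)

Section Transfer.
Local Open Scope ring_scope.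
Variables (P F : finType) (V V' : finType) (go : V -> P -> option V) (go' : V' -> P -> option V') (f : V' -> F).
Variables (M : nat) (a : V -> V) (wd wr : V -> M.-bseq P).
Hypothesis wdP : forall u, walk go (Some (a u)) (wd u) = Some u.
Hypothesis wrP : forall u, walk go (Some u) (wr u) = Some (a u).
Hypothesis V'0 : (0 < #|V'|)%N.

Local Notation W := (M.-bseq P).
Local Notation n := (#|V|%:R : rat).
Local Notation n' := (#|V'|%:R : rat).
Local Notation vw := (view go).
Local Notation vw' := (view go').

Definition indr (b : bool) : rat := b%:R.

Lemma ind01 b : 0 <= indr b <= 1. Proof. by case: b. Qed.

(** The l1 distance of the two view distributions, which is twice the total variation distance. *)
Definition tvd s : rat :=
  \sum_(T : 'I_(nview P s)) `|#|[set v | vw s v == T]|%:R / n - #|[set g | vw' s g == T]|%:R / n'|.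

Lemma sum_view (S : finType) (B : finType) (b : S -> B) (phi : B -> rat) :
  \sum_x phi (b x) = \sum_T #|[set x | b x == T]|%:R * phi T.
Proof.
rewrite (partition_big b predT) //=; apply: eq_bigr => T _.
rewrite (eq_bigr (fun _ => phi T)); last by move=> x /eqP->.
by rewrite -sum1dep_card natr_sum mulr_suml; apply: eq_bigr => x _; rewrite mul1r.
Qed.

Lemma view_sum s (phi : 'I_(nview P s) -> rat) : (forall T, 0 <= phi T <= 1) -> (0 < #|V|)%N ->
  `|\sum_v phi (vw s v) - n / n' * \sum_g phi (vw' s g)| <= n * tvd s.
Proof.
move=> H V0; have n0 : 0 < n by rewrite ltr0n.
have n0' : 0 < n' by rewrite ltr0n.
rewrite !sum_view mulr_sumr -sumrB /tvd mulr_sumr; apply: le_trans (ler_norm_sum _ _ _) _.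
apply: ler_sum => T _; have /andP[h0 h1] := H T.
move: (#|[set v | vw s v == T]|%:R : rat) (#|[set g | vw' s g == T]|%:R : rat) => x z.
have -> : x * phi T - n / n' * (z * phi T) = n * (x / n - z / n') * phi T.
  have aux (N N' x0 z0 p0 : rat) : N != 0 -> N' != 0 -> x0 * p0 - N / N' * (z0 * p0) = N * (x0 / N - z0 / N') * p0.
    by move=> hN hN'; field; rewrite hN hN'.
  by apply: aux; rewrite gt_eqF.
rewrite !normrM (ger0_norm h0) (gtr0_norm n0); apply: ler_piMr => //.
by rewrite mulr_ge0 ?normr_ge0 // ltW.
Qed.

Definition pt (v : V) : {set W} := [set w | [exists u, (a u == v) && (wd u == w)]].

(** An element is recovered from its anchor and its word, so elements correspond to such pairs. *)
Lemma sum_anchor (G : V -> W -> rat) : \sum_u G (a u) (wd u) = \sum_v \sum_(w in pt v) G v w.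
Proof.
rewrite pair_big_dep /= (reindex_onto (fun u => (a u, wd u)) (fun p => odflt p.1 (walk go (Some p.1) p.2))) /=.
  apply: eq_bigl => u; rewrite wdP /= eqxx andbT; symmetry; rewrite inE.
  by apply/existsP; exists u; rewrite !eqxx.
by move=> [v w] /=; rewrite inE => /existsP[u /andP[/eqP<- /eqP<-]]; rewrite wdP.
Qed.

Variables (r : nat) (y : F).
Hypothesis rM : (M <= r)%N.
Local Notation R := (r + M)%N.

Definition cls (v : V) : {set V'} := [set g | vw' R g == vw R v].
Definition fy (g : V') : rat := indr (f g == y).
Definition tg (w : W) (g : V') : V' := odflt g (walk go' (Some g) w).
Definition fyw (w : W) (g : V') : rat := indr (omap f (walk go' (Some g) w) == Some y).
(** How much the expected label changes when the view radius grows by [2 * M], the length of a walk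
    to an element of a piece and back. *)
Definition vDelta (g : V') : rat := `|cexp (vw' (r + M + M)) fy g - cexp (vw' r) fy g|.

Lemma fy01 z : 0 <= fy z <= 1. Proof. exact: ind01. Qed.

Lemma vDelta01 z : 0 <= vDelta z <= 1.
Proof.
rewrite /vDelta normr_ge0 /=.
have /andP[h0 h1] := cexp_bound (vw' (r + M + M)) z fy01.
have /andP[h2 h3] := cexp_bound (vw' r) z fy01.
by rewrite ler_norml; apply/andP; split; lra.
Qed.

Lemma cls_walk u g : g \in cls (a u) ->
  [/\ walk go' (Some g) (wd u) = Some (tg (wd u) g), walk go' (Some (tg (wd u) g)) (wr u) = Some g
    & vw' r (tg (wd u) g) = vw r u].
Proof.
rewrite inE => /eqP/esym eg.
have [x wx vx] := view_walk eg (size_bseq (wd u)) (wdP u).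
have tx : tg (wd u) g = x by rewrite /tg wx.
have ret : walk go' (Some g) (wd u ++ wr u) = Some g.
  apply: (view_return eg); last by rewrite walk_cat wdP wrP.
  by rewrite size_cat (leq_trans (leq_add (size_bseq _) (size_bseq _))) // leq_add2r.
by rewrite tx; split=> //; move: ret; rewrite walk_cat wx.
Qed.

(** Membership in the image, under the walk [wd u], of the view class of the anchor of [u]; being
    expressed by short walks from [x], it depends only on a view of [x]. *)
Definition imcls (u : V) (x : V') : bool :=
  if walk go' (Some x) (wr u) is Some g then (vw' R g == vw R (a u)) && (walk go' (Some g) (wd u) == Some x) else false.

Lemma imcls_inv u x x' : vw' (R + M) x = vw' (R + M) x' -> imcls u x -> imcls u x'.
Proof.
move=> e; rewrite /imcls; case ew: (walk go' (Some x) (wr u)) => [g|] // /andP[/eqP eg /eqP eb].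
have [g' eg' vg] := view_walk e (size_bseq (wr u)) ew.
rewrite eg' -vg eg eqxx /=.
have := view_return e (w := wr u ++ wd u) _; rewrite !walk_cat ew eb eg' => -> //.
rewrite size_cat (leq_trans (leq_add (size_bseq _) (size_bseq _))) //; lia.
Qed.

Lemma sum_cls u (G : V' -> rat) : \sum_(g in cls (a u)) G (tg (wd u) g) = \sum_(x | imcls u x) G x.
Proof.
symmetry; rewrite (reindex_onto (tg (wd u)) (fun x => odflt x (walk go' (Some x) (wr u)))) /=.
  apply: eq_bigl => g; apply/andP/idP => [[]|gc].
    rewrite /imcls; case ew: (walk _ _ (wr u)) => [g1|] //= /andP[/eqP v1 _] /eqP e1.
    by rewrite inE -e1 v1.
  have [h1 h2 h3] := cls_walk gc.
  by rewrite /imcls h2 h1 !eqxx andbT; move: gc; rewrite inE.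
move=> x; rewrite /imcls; case ew: (walk go' (Some x) (wr u)) => [g|] //= /andP[_ /eqP eb].
by rewrite /tg eb.
Qed.

(** The image of the class under the walk to [u] is a union of classes of views of radius [R + M],
    so labels may be replaced there by their conditional expectations at that radius. These differ
    by [vDelta] from the ones at radius [r], which take the same value at all image points, as these
    share the view of [u]. *)
Lemma cls_average u :
  `|\sum_(g in cls (a u)) fyw (wd u) g - #|cls (a u)|%:R * favg (vw' r) fy (vw r u)|
    <= \sum_(g in cls (a u)) vDelta (tg (wd u) g).
Proof.
have -> : \sum_(g in cls (a u)) fyw (wd u) g = \sum_(g in cls (a u)) fy (tg (wd u) g).
  by apply: eq_bigr => g /cls_walk[h1 _ _]; rewrite /fyw h1.
have -> : \sum_(g in cls (a u)) fy (tg (wd u) g) =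
    \sum_(g in cls (a u)) cexp (vw' (R + M)) fy (tg (wd u) g).
  rewrite !sum_cls [LHS]big_mkcond [RHS]big_mkcond /=.
  rewrite (eq_bigr (fun x => indr (imcls u x) * fy x)); last first.
    by move=> x _; rewrite /indr; case: imcls; rewrite ?mul1r ?mul0r.
  rewrite -(cexpE (b := vw' (R + M))); last first.
    by move=> x x' e; congr indr; apply/idP/idP; apply: imcls_inv.
  by apply: eq_bigr => x _; rewrite /indr; case: imcls; rewrite ?mul1r ?mul0r.
rewrite -sum1_card natr_sum mulr_suml -sumrB; apply: le_trans (ler_norm_sum _ _ _) _.
apply: ler_sum => g /cls_walk[_ _ h3]; rewrite mul1r /vDelta /cexp h3 //.
Qed.

Definition avgcls (v : V) (w : W) : rat := (\sum_(g in cls v) fyw w g) / #|cls v|%:R.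
Definition devcls (u : V) : rat := (\sum_(g in cls (a u)) vDelta (tg (wd u) g)) / #|cls (a u)|%:R.

Lemma avgcls_dev u : `|avgcls (a u) (wd u) - favg (vw' r) fy (vw r u)| <= devcls u + indr (cls (a u) == set0).
Proof.
have [c0|c0] := posnP #|cls (a u)|.
  have e0 : cls (a u) = set0 by apply/eqP; rewrite -cards_eq0 c0.
  rewrite /avgcls /devcls e0 !big_set0 !mul0r sub0r normrN eqxx add0r.
  by have /andP[h0 h1] := favg_bound (vw' r) (vw r u) fy01; rewrite ger0_norm.
have c0' : 0 < #|cls (a u)|%:R :> rat by rewrite ltr0n.
have -> : indr (cls (a u) == set0) = 0 by rewrite -cards_eq0 gtn_eqF.
rewrite addr0 -(ler_pM2r c0') -{1}(gtr0_norm c0') -normrM mulrBl /avgcls /devcls !mulfVK ?gt_eqF //.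
rewrite [favg _ _ _ * _]mulrC; exact: cls_average.
Qed.

Hypothesis V0 : (0 < #|V|)%N.
Variable del : rat.
Hypothesis tvR : tvd R <= del.
Hypothesis tvr : tvd r <= del.

Lemma ratio_ge0 : 0 <= n / n'. Proof. by rewrite divr_ge0 ?ler0n. Qed.

Lemma view_sum_le s (phi : 'I_(nview P s) -> rat) : (forall T, 0 <= phi T <= 1) -> tvd s <= del ->
  `|\sum_v phi (vw s v) - n / n' * \sum_g phi (vw' s g)| <= n * del.
Proof.
move=> H hs; apply: le_trans (view_sum H V0) _; apply: ler_wpM2l => //; exact: ler0n.
Qed.

Definition closedw (w w' : W) (g : V') : bool :=
  if walk go' (Some g) w is Some x then walk go' (Some x) w' == Some g else false.

Lemma sum_closed (w w' : W) : \sum_(g | closedw w w' g) vDelta (tg w g) <= \sum_g vDelta g.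
Proof.
have inj : {in [pred g | closedw w w' g] &, injective (tg w)}.
  move=> g g'; rewrite !inE /closedw /tg.
  case: (walk go' (Some g) w) => [x|] //; case: (walk go' (Some g') w) => [x'|] // /eqP h /eqP h' /= e.
  by move: h; rewrite e h' => -[].
rewrite -(big_imset (fun x => vDelta x) inj) /=.
rewrite [leRHS](bigID (mem [set tg w g | g in [pred g | closedw w w' g]])) /= lerDl.
by apply: sumr_ge0 => g _; case/andP: (vDelta01 g).
Qed.

(** For fixed words to and from the anchor, [u] is determined by its anchor, so the sum is at most a
    sum over all anchors of a function of their views. This moves to [V'] by closeness of the view
    statistics, and there the walk is injective by [sum_closed]. The factor counts the pairs of
    words. *)
Lemma sum_dev : \sum_u devcls u <= (#|{: W}|%:R ^+ 2) * (n / n' * \sum_g vDelta g + n * del).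
Proof.
rewrite (partition_big (fun u => (wd u, wr u)) predT) //=.
apply: (@le_trans _ _ (\sum_(p : W * W) (n / n' * \sum_g vDelta g + n * del))); last first.
  by rewrite sumr_const card_prod -[X in X <= _]mulr_natl natrM expr2.
apply: ler_sum => -[w w'] _ /=.
pose G g : rat := if closedw w w' g then vDelta (tg w g) else 0.
have G01 g : 0 <= G g <= 1 by rewrite /G; case: ifP => _; rewrite ?vDelta01 // lexx ler01.
have phi01 T := favg_bound (vw' R) T G01.
apply: (@le_trans _ _ (\sum_(u | (wd u, wr u) == (w, w')) favg (vw' R) G (vw R (a u)))).
  apply: ler_sum => u /eqP[ew ew']; rewrite /devcls /favg.
  rewrite -/(cls (a u)); apply: ler_wpM2r; first by rewrite invr_ge0 ler0n.
  rewrite [leRHS](eq_bigl (fun g => g \in cls (a u))); last by move=> g; rewrite inE.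
  apply: ler_sum => g /cls_walk[h1 h2 _]; rewrite /G /closedw -ew -ew' h1 h2 eqxx //.
have := view_sum_le phi01 tvR; rewrite ler_norml => /andP[_ h].
apply: (@le_trans _ _ (\sum_v favg (vw' R) G (vw R v))).
  have aI : {in [pred u | (wd u, wr u) == (w, w')] &, injective a}.
    move=> u u'; rewrite !inE => /eqP[e1 _] /eqP[e2 _] e.
    by have := wdP u; rewrite e e1 -e2 wdP => -[].
  rewrite -(big_imset (fun v => favg (vw' R) G (vw R v)) aI) /=.
  rewrite [leRHS](bigID (mem [set a u | u in [pred u | (wd u, wr u) == (w, w')]])) /= lerDl.
  by apply: sumr_ge0 => v _; case/andP: (phi01 (vw R v)).
have e : \sum_g favg (vw' R) G (vw' R g) = \sum_(g | closedw w w' g) vDelta (tg w g).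
  have := cexpE (b := vw' R) G (h := fun _ => 1) (fun _ _ _ => erefl).
  rewrite (eq_bigr (fun g => favg (vw' R) G (vw' R g))); last by move=> g _; rewrite mul1r.
  by move->; rewrite [RHS]big_mkcond /=; apply: eq_bigr => g _; rewrite mul1r.
rewrite e in h; have := ler_wpM2l ratio_ge0 (sum_closed w w'); lra.
Qed.

Lemma sum_empty : \sum_u indr (cls (a u) == set0) <= #|{: W}|%:R * (n * del).
Proof.
rewrite (sum_anchor (fun v _ => indr (cls v == set0))).
apply: (@le_trans _ _ (\sum_v #|{: W}|%:R * indr (cls v == set0))).
  apply: ler_sum => v _; rewrite sumr_const -[leLHS]mulr_natl.
  have /andP[h0 _] := ind01 (cls v == set0).
  by rewrite ler_wpM2r // ler_nat max_card.
rewrite -mulr_sumr ler_wpM2l ?ler0n //.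
pose phi T : rat := indr ([set g | vw' R g == T] == set0).
have := view_sum_le (s := R) (phi := phi) (fun T => ind01 _) tvR.
rewrite ler_norml => /andP[_]; rewrite [X in _ - _ / _ * X]big1 ?mulr0 ?subr0 //.
by move=> g _; rewrite /phi; case: eqP => // /setP/(_ g); rewrite !inE eqxx.
Qed.

Lemma sum_avgcls : `|\sum_u avgcls (a u) (wd u) - n / n' * #|[set g | f g == y]|%:R| <=
  (#|{: W}|%:R ^+ 2) * (n / n' * \sum_g vDelta g + n * del) + #|{: W}|%:R * (n * del) + n * del.
Proof.
have h1 : `|\sum_u avgcls (a u) (wd u) - \sum_u favg (vw' r) fy (vw r u)| <=
    (#|{: W}|%:R ^+ 2) * (n / n' * \sum_g vDelta g + n * del) + #|{: W}|%:R * (n * del).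
  rewrite -sumrB; apply: le_trans (ler_norm_sum _ _ _) _.
  apply: le_trans (lerD sum_dev sum_empty); rewrite -big_split; apply: ler_sum => u _.
  exact: avgcls_dev.
have h2 := view_sum_le (fun T => favg_bound (vw' r) T fy01) tvr.
have e : \sum_g favg (vw' r) fy (vw' r g) = #|[set g | f g == y]|%:R.
  have := cexpE (b := vw' r) fy (h := fun _ => 1) (fun _ _ _ => erefl).
  rewrite (eq_bigr (fun g => favg (vw' r) fy (vw' r g))); last by move=> g _; rewrite mul1r.
  move->; rewrite -sum1dep_card natr_sum [RHS]big_mkcond /=; apply: eq_bigr => g _.
  by rewrite mul1r /fy /indr; case: eqP.
rewrite e in h2; move: h1 h2; rewrite !ler_norml => /andP[h1 h1'] /andP[h2 h2'].
by apply/andP; split; lra.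
Qed.
End Transfer.

(** * Choosing an image for every anchor *)

Section Selection.
Local Open Scope ring_scope.
Variables (P F : finType) (V V' : finType) (go : V -> P -> option V) (go' : V' -> P -> option V') (f : V' -> F).
Variables (M : nat) (a : V -> V) (wd : V -> M.-bseq P).
Hypothesis wdP : forall u, walk go (Some (a u)) (wd u) = Some u.
Variable r : nat.
Local Notation R := (r + M)%N.
Local Notation W := (M.-bseq P).
Local Notation K := {ffun W -> option F}.
Local Notation grp := ('I_(nview P R) * {set W})%type.
Local Notation avgc := (avgcls go go' f r).
Local Notation pt := (pt a wd).

Definition image_type (o : option V') (w : W) : option F := omap f (obind (fun g => walk go' (Some g) w) o).

Definition err : nat := (#|{: grp}| * #|{: W}| * (#|{: K}| * #|{: K}|))%N.

Definition Xg (c : grp) : {set V} := [set v | (view go R v == c.1) && (pt v == c.2)].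
Definition Yg (c : grp) : {set V'} := [set g | view go' R g == c.1].

(** Rounding is applied to the whole vector [kp g] of labels at the ends of all words. One choice of
    images then gets the frequencies right for all words at once, with error [#|K|] for each of at
    most [#|K|] vectors. *)
Lemma select_group (c : grp) : exists ch : V -> option V',
  (forall x g, x \in Xg c -> ch x = Some g -> g \in Yg c) /\
  forall w y, `|\sum_(x in Xg c) indr (image_type (ch x) w == Some y)
     - #|Xg c|%:R * ((\sum_(g in Yg c) fyw go' f y w g) / #|Yg c|%:R)| <= (#|{: K}| * #|{: K}|)%:R.
Proof.
have [Y0|[g0 g0Y]] := set_0Vmem (Yg c).
  exists (fun _ => None); split=> // w y; rewrite Y0 big_set0 mul0r mulr0 subr0 big1 ?normr0 ?ler0n //.
pose kp g : K := [ffun w : W => omap f (walk go' (Some g) w)].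
have [chi [chiY H]] := rounding (Xg c) kp g0Y.
exists (fun x => Some (chi x)); split=> [x g xX [<-]|w y]; first exact: chiY.
have e1 (S : finType) (A : {set S}) (k : S -> K) :
    \sum_(x in A) indr (k x w == Some y) = \sum_(q : K | q w == Some y) #|[set x in A | k x == q]|%:R.
  rewrite (eq_bigr (fun q : K => \sum_(x in A | k x == q) 1)); last first.
    by move=> q _; rewrite -sum1dep_card natr_sum; apply: eq_bigl => x.
  rewrite (exchange_big_dep (mem A)) /=; last by move=> q x _ /andP[].
  apply: eq_bigr => x xA; rewrite /indr; case: eqP => h.
    rewrite (big_pred1 (k x)) // => q; rewrite xA /= [q == k x]eq_sym.
    by case: (k x =P q) => [<-|_]; rewrite ?andbF ?h ?eqxx.
  rewrite big_pred0 // => q; rewrite xA /=.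
  by case: (k x =P q) => [<-|_]; rewrite ?andbF ?andbT //; apply/eqP.
have -> : \sum_(x in Xg c) indr (image_type (Some (chi x)) w == Some y) =
    \sum_(q : K | q w == Some y) #|[set x in Xg c | kp (chi x) == q]|%:R.
  by rewrite -(e1 _ _ (fun x => kp (chi x))); apply: eq_bigr => x _; rewrite ffunE.
have -> : \sum_(g in Yg c) fyw go' f y w g = \sum_(q : K | q w == Some y) #|[set g in Yg c | kp g == q]|%:R.
  by rewrite -(e1 _ _ kp); apply: eq_bigr => x _; rewrite ffunE.
rewrite mulrA mulr_sumr mulr_suml -sumrB; apply: le_trans (ler_norm_sum _ _ _) _.
apply: (@le_trans _ _ (\sum_(q : K) #|{: K}|%:R)).
  by rewrite big_mkcond /=; apply: ler_sum => q _; case: ifP => _; rewrite ?ler0n.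
by rewrite sumr_const natrM -[leLHS]mulr_natl.
Qed.

Lemma sum_groups (G : V -> W -> rat) :
  \sum_v \sum_(w in pt v) G v w = \sum_(c : grp) \sum_(w in c.2) \sum_(x in Xg c) G x w.
Proof.
rewrite (partition_big (fun v => (view go R v, pt v)) predT) //=; apply: eq_bigr => -[T A] _ /=.
rewrite [RHS]exchange_big /=.
rewrite (eq_bigl (fun v => v \in Xg (T, A))); last by move=> v; rewrite inE.
by apply: eq_bigr => v; rewrite inE => /andP[_ /eqP->].
Qed.

(** Anchors with the same view and the same set of words are treated together; the number of such
    groups does not depend on [V], and neither does the error. *)
Lemma selection : exists chi : V -> option V',
  (forall v g, chi v = Some g -> view go R v = view go' R g) /\
  forall y, `|\sum_u indr (image_type (chi (a u)) (wd u) == Some y) - \sum_u avgc y (a u) (wd u)| <= err%:R.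
Proof.
have [ch chP] := fin_all_exists select_group.
pose chi v := ch (view go R v, pt v) v.
exists chi; split=> [v g|y].
  rewrite /chi => e; have [h _] := chP (view go R v, pt v).
  by have := h v g _ e; rewrite !inE !eqxx => /(_ isT) /eqP.
rewrite (sum_anchor wdP (fun v w => indr (image_type (chi v) w == Some y))) (sum_anchor wdP) !sum_groups -sumrB.
apply: le_trans (ler_norm_sum _ _ _) _.
apply: (@le_trans _ _ (\sum_(c : grp) \sum_(w : W) (#|{: K}| * #|{: K}|)%:R)); last first.
  rewrite !sumr_const /err -!mulrnA ler_nat; apply: eq_leq.
  by rewrite [RHS]mulnC [in RHS](mulnC #|{: grp}|) mulnA.
apply: ler_sum => c _; rewrite -sumrB; apply: le_trans (ler_norm_sum _ _ _) _.
rewrite big_mkcond /=; apply: ler_sum => w _; case: ifP => _; last exact: ler0n.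
have [_ h] := chP c; apply: le_trans (h w y); rewrite le_eqVlt; apply/orP; left; apply/eqP.
congr `|_ - _|.
  apply: eq_bigr => x; rewrite inE => /andP[/eqP e1 /eqP e2].
  by rewrite /chi e1 e2 -surjective_pairing.
rewrite -sum1_card natr_sum mulr_suml; apply: eq_bigr => x; rewrite inE => /andP[/eqP e1 _].
rewrite mul1r /avgcls; have -> : cls go go' M r x = Yg c by apply/setP=> g; rewrite !inE e1.
by [].
Qed.
End Selection.

Definition rad (Rmin M j : nat) : nat := Rmin + M + (M + M) * j.

Lemma radS Rmin M j : rad Rmin M j.+1 = rad Rmin M j + M + M.
Proof. by rewrite /rad; lia. Qed.

Lemma rad_ge Rmin M j : M <= rad Rmin M j /\ Rmin <= rad Rmin M j + M.
Proof. by rewrite /rad; lia. Qed.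

Lemma rad_le Rmin M j J : j <= J -> rad Rmin M j + M <= rad Rmin M J.+1 /\ rad Rmin M j <= rad Rmin M J.+1.
Proof. by rewrite /rad; nia. Qed.

Section DivrScale.
Local Open Scope ring_scope.

Lemma divr_scale (N N' z : rat) : N' != 0 -> N / N' * (z * N') = z * N.
Proof. by move=> h; field. Qed.

Lemma divrM_quarter (e w : rat) : w != 0 -> w * (2 * (e / (8 * w))) = e / 4.
Proof. by move=> h; field. Qed.

Lemma divrM_cancel (e w : rat) : w != 0 -> w * (e / (24 * w)) = e / 24.
Proof. by move=> h; field. Qed.

End DivrScale.

Section TransferTheorem.
Local Open Scope ring_scope.

(* Newman-Sohler for port structures: if [V] and [V'] have similar statistics of views, then a labelling
   of [V'] can be transported to [V] along view-preserving partial maps, one for each part of a partition of [V]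
   into bounded pieces, keeping the label frequencies.  At a radius where the conditional expectations
   of the labels given the views have almost stopped changing, they look the same from all points of a piece. *)
Theorem transfer (P F : finType) (M Rmin : nat) (eta : rat) : 0 < eta ->
  exists (Rmax N0 : nat) (del : rat), 0 < del /\
  forall (V V' : finType) (go : V -> P -> option V) (go' : V' -> P -> option V') (f : V' -> F)
    (a : V -> V) (wd wr : V -> M.-bseq P), (N0 <= #|V|)%N -> (0 < #|V|)%N -> (0 < #|V'|)%N ->
    (forall s, (s <= Rmax)%N -> tvd go go' s <= del) ->
    (forall u, walk go (Some (a u)) (wd u) = Some u) ->
    (forall u, walk go (Some u) (wr u) = Some (a u)) ->
  exists (R : nat) (chi : V -> option V'), [/\ (Rmin <= R)%N,
    forall v g, chi v = Some g -> view go R v = view go' R g &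
    forall y, `|#|[set u | image_type go' f (chi (a u)) (wd u) == Some y]|%:R
       - #|V|%:R / #|V'|%:R * #|[set g | f g == y]|%:R| <= eta * #|V|%:R :> rat].
Proof.
move=> eta0; pose nW : rat := #|{: M.-bseq P}|%:R.
have nW1 : 1 <= nW.
  rewrite /nW (ler_nat _ 1); apply/card_gt0P; by exists (Bseq (isT : (size ([::] : seq P) <= M)%N)).
have nW2 : 0 < nW ^+ 2 by rewrite exprn_gt0 // (lt_le_trans ltr01).
(* Budget: [eta / 4] for the change of conditional expectations, [eta / 24] for each of three errors
   from the view statistics, and [eta / 2] for rounding. *)
pose kap : rat := eta / (8 * nW ^+ 2); pose del : rat := eta / (24 * nW ^+ 2).
have c8 : 0 < 8%:R :> rat by rewrite ltr0n.
have c24 : 0 < 24%:R :> rat by rewrite ltr0n.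
have kap0 : 0 < kap by exact: (divr_gt0 eta0 (mulr_gt0 c8 nW2)).
have del0 : 0 < del by exact: (divr_gt0 eta0 (mulr_gt0 c24 nW2)).
pose th : rat := kap ^+ 2; have th0 : 0 < th by rewrite exprn_gt0.
pose J := Num.bound (#|F|%:R / th).
have HJ : #|F|%:R < th * J.+1%:R.
  rewrite mulrC -ltr_pdivrMr //; apply: lt_le_trans (archi_boundP _) _.
    exact: divr_ge0 (ler0n _ _) (ltW th0).
  by rewrite ler_nat leqnSn.
pose rr j := rad Rmin M j.
have rrS j : rr j.+1 = (rr j + M + M)%N by apply: radS.
(* The radius is chosen only after [V'] is known, so the rounding errors of all candidate radii are
   added up in advance. *)
pose C2 := (\sum_(j < J.+1) err P F M (rr j))%N.
pose N0 := Num.bound (2 * C2%:R / eta).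
exists (rr J.+1), N0, del; split=> // V V' go go' f a wd wr VN V0 V'0 Htv wdP wrP.
have n0 : 0 < #|V|%:R :> rat by rewrite ltr0n.
have n0' : 0 < #|V'|%:R :> rat by rewrite ltr0n.
have C2n : C2%:R <= eta / 2 * #|V|%:R.
  have : 2 * C2%:R / eta <= #|V|%:R.
    apply: le_trans (ltW (archi_boundP _)) _; last by rewrite ler_nat.
    by rewrite divr_ge0 ?mulr_ge0 ?ler0n // ltW.
  by rewrite ler_pdivrMr //; lra.
pose en j y := energy (view go' (rr j)) (fy f y).
have fy01' y z : 0 <= fy f y z <= 1 by apply: fy01.
have enD j y : en j.+1 y - en j y = \sum_x (cexp (view go' (rr j + M + M)) (fy f y) x - cexp (view go' (rr j)) (fy f y) x) ^+ 2.
  rewrite /en rrS; symmetry; apply: energy_diff => x x'; apply: view_le.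
  by rewrite -addnA leq_addr.
(* The energies of all label indicators are summed, so that a single radius serves every label. *)
have [||j jJ Hj] := @small_increment (fun j => \sum_y en j y) (#|F|%:R * #|V'|%:R) (th * #|V'|%:R) J.
- move=> j; apply/andP; split.
    by apply: sumr_ge0 => y _; case/andP: (energy_bound (view go' (rr j)) (fy01' y)).
  rewrite mulr_natl -sumr_const; apply: ler_sum => y _.
  by case/andP: (energy_bound (view go' (rr j)) (fy01' y)).
- by rewrite mulrAC ltr_pM2r.
have HD y : \sum_g vDelta go' f M (rr j) y g <= 2 * kap * #|V'|%:R.
  have -> : 2 * kap = kap + th / kap by rewrite /th expr2 mulfK ?gt_eqF //; ring.
  apply: sum_abs_le => //.
  have ed : en j.+1 y - en j y <= th * #|V'|%:R.
    have hs : \sum_y (en j.+1 y - en j y) <= th * #|V'|%:R by rewrite sumrB.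
    apply: le_trans hs; rewrite [leRHS](bigD1 y) //= -[leLHS]addr0 lerD2l; apply: sumr_ge0 => y' _.
    by rewrite enD; apply: sumr_ge0 => x _; apply: sqr_ge0.
  by rewrite enD in ed.
have [chi [chiV Hchi]] := selection go' f wdP (rr j).
exists (rr j + M)%N, chi; split=> //; first by case: (rad_ge Rmin M j).
move=> y; have h1 := Hchi y.
have rM : (M <= rr j)%N by case: (rad_ge Rmin M j).
have tv1 : tvd go go' (rr j + M) <= del by apply: Htv; case: (rad_le Rmin M jJ).
have tv2 : tvd go go' (rr j) <= del by apply: Htv; case: (rad_le Rmin M jJ).
have h2 := sum_avgcls f wdP wrP V'0 y rM V0 tv1 tv2.
have errC : (err P F M (rr j))%:R <= C2%:R :> rat.
  have jS : (j < J.+1)%N by [].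
  by rewrite ler_nat /C2 (bigD1 (Ordinal jS)) //= leq_addr.
have eS : \sum_u indr (image_type go' f (chi (a u)) (wd u) == Some y) =
    #|[set u | image_type go' f (chi (a u)) (wd u) == Some y]|%:R.
  rewrite -sum1dep_card natr_sum [RHS]big_mkcond /=; apply: eq_bigr => u _.
  by rewrite /indr; case: eqP.
rewrite eS in h1.
have HD2 : #|V|%:R / #|V'|%:R * (\sum_g vDelta go' f M (rr j) y g) <= 2 * kap * #|V|%:R.
  apply: le_trans (ler_wpM2l _ (HD y)) _; first by rewrite divr_ge0 ?ler0n.
  by rewrite divr_scale // gt_eqF.
have k1 : nW ^+ 2 * (2 * kap) = eta / 4 by apply: divrM_quarter; rewrite gt_eqF.
have k2 : nW ^+ 2 * del = eta / 24 by apply: divrM_cancel; rewrite gt_eqF.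
have k3 : nW * del <= eta / 24.
  rewrite -k2 ler_wpM2r ?(ltW del0) // expr2 ler_peMr // (le_trans ler01) //.
have k4 : del <= eta / 24 by apply: le_trans k3; rewrite ler_peMl // ltW.
rewrite -/nW in h2.
have b1 : nW ^+ 2 * (#|V|%:R / #|V'|%:R * (\sum_g vDelta go' f M (rr j) y g)) <= eta / 4 * #|V|%:R.
  by rewrite -k1 -[leRHS]mulrA; exact: (ler_wpM2l (ltW nW2) HD2).
have b1' : nW ^+ 2 * (#|V|%:R * del) <= eta / 24 * #|V|%:R.
  by rewrite -k2 mulrCA mulrC.
rewrite mulrDr in h2.
have b2 : nW * (#|V|%:R * del) <= eta / 24 * #|V|%:R by rewrite mulrCA mulrC ler_wpM2r // ler0n.
have b3 : #|V|%:R * del <= eta / 24 * #|V|%:R by rewrite mulrC ler_wpM2r // ler0n.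
have b0 : 0 < eta * #|V|%:R by rewrite mulr_gt0.
move: h1 h2; rewrite !ler_norml => /andP[h1 h1'] /andP[h2 h2'].
by apply/andP; split; lra.
Qed.
End TransferTheorem.

(** * Views of databases *)

Section Ports.
Variables (k : nat) (ar : 'I_k -> nat) (d amx : nat).
Hypothesis har : forall R, 0 < ar R <= amx.

Lemma oracle_sound (D : pdb ar) (R : 'I_k) (x : 'I_(dom D)) j s : oracle D R x.+1 j.+1 = Some s ->
  exists u : (ar R).-tuple 'I_(dom D), [/\ u \in rels D R, x \in (u : seq _) & s = [seq (nat_of_ord y).+1 | y <- u]].
Proof.
rewrite /oracle /= !valK /=; case: ifP => // sl [es].
have : s \in sort lexle [seq [seq (nat_of_ord y).+1 | y <- tval u] | u <- enum (rels D R) & x \in tval u].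
  by rewrite -es mem_nth.
by rewrite mem_sort => /mapP[u]; rewrite mem_filter mem_enum => /andP[xu uD] ->; exists u.
Qed.

Lemma oracle_complete (D : pdb ar) (R : 'I_k) (x : 'I_(dom D)) (u : (ar R).-tuple 'I_(dom D)) : deg_le d D ->
  u \in rels D R -> x \in (u : seq _) -> exists j : 'I_d, oracle D R x.+1 j.+1 = Some [seq (nat_of_ord y).+1 | y <- u].
Proof.
move=> dD uD xu.
pose l := sort lexle [seq [seq (nat_of_ord y).+1 | y <- tval u] | u <- enum (rels D R) & x \in tval u].
have ul : [seq (nat_of_ord y).+1 | y <- u] \in l.
  by rewrite mem_sort; apply/mapP; exists u => //; rewrite mem_filter mem_enum uD xu.
have jl : index [seq (nat_of_ord y).+1 | y <- u] l < size l by rewrite index_mem.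
have ld : size l <= d.
  rewrite size_sort size_map; apply: leq_trans (dD x); rewrite /deg_el (bigD1 R) //=.
  apply: leq_trans (leq_addr _ _).
  have /card_uniqP<- : uniq [seq u <- enum (rels D R) | x \in tval u] by rewrite filter_uniq ?enum_uniq.
  by apply/subset_leq_card/subsetP => v; rewrite mem_filter mem_enum inE andbC.
exists (Ordinal (leq_trans jl ld)); rewrite /oracle /= !valK /= -/l jl nth_index //.
Qed.

(** A port names a relation, the number of one of its tuples at the current element, and a position
    in that tuple. In degree at most [d] every tuple is reachable by ports, with finitely many ports
    in all. *)
Definition port : finType := ('I_k * 'I_d * 'I_amx)%type.

Definition go (D : pdb ar) (x : 'I_(dom D)) (p : port) : option 'I_(dom D) :=
  if p.2 < ar p.1.1 then obind (fun s => insub (nth 0 s p.2).-1) (oracle D p.1.1 x.+1 p.1.2.+1) else None.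

Lemma go_oracle (D : pdb ar) (x : 'I_(dom D)) (p : port) (u : (ar p.1.1).-tuple 'I_(dom D)) :
  oracle D p.1.1 x.+1 p.1.2.+1 = Some [seq (nat_of_ord y).+1 | y <- u] -> p.2 < ar p.1.1 -> go x p = Some (nth x u p.2).
Proof.
rewrite /go => -> la; rewrite la /= (nth_map x) ?size_tuple //=; exact: valK.
Qed.

Lemma ports_tuple (D : pdb ar) x (p : port) y : go x p = Some y ->
  exists u : (ar p.1.1).-tuple 'I_(dom D), [/\ u \in rels D p.1.1, x \in (u : seq _), y = nth x u p.2, p.2 < ar p.1.1 &
    forall l : 'I_amx, l < ar p.1.1 -> go x (p.1, l) = Some (nth x u l)].
Proof.
case la: (p.2 < ar p.1.1); last by rewrite /go la.
case eo: (oracle D p.1.1 x.+1 p.1.2.+1) => [s|]; last by rewrite /go eo /= if_same.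
have [u [uD xu es]] := oracle_sound eo; rewrite es in eo.
rewrite (go_oracle eo la) => -[<-]; exists u; split=> // l lr.
exact: (@go_oracle D x (p.1, l) u).
Qed.

(** The database is recovered from the port structure: a tuple through [x] is exactly what is read
    from [x] when the position runs over the arity. *)
Lemma tuple_ports (D : pdb ar) (R : 'I_k) s x0 x : deg_le d D -> x \in s ->
  (R, s) \in dblist (rels D) <->
  size s = ar R /\ exists j : 'I_d, forall l : 'I_amx, l < ar R -> go x (R, j, l) = Some (nth x0 s l).
Proof.
move=> dD xs; split.
  case/dblistP=> R' [u [uD [eR es]]]; subst R' s; rewrite size_tuple; split=> //.
  have [j oj] := oracle_complete dD uD xs; exists j => l lR.
  by rewrite (@go_oracle D x (R, j, l) u) // (set_nth_default x) ?size_tuple.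
case=> sz [j H].
have a0 : 0 < amx by case/andP: (har R) => h1 h2; apply: leq_trans h1 h2.
have r0 : 0 < ar R by case/andP: (har R).
have := H (Ordinal a0) r0 => /ports_tuple /= [u [uD xu _ _ Hu]].
have -> : s = tval u.
  apply: (@eq_from_nth _ x0) => [|l]; rewrite sz ?size_tuple // => lR.
  have la : l < amx by case/andP: (har R) => _ h; apply: leq_trans lR h.
  have := Hu (Ordinal la) lR; rewrite H //= => -[->].
  by apply: set_nth_default; rewrite size_tuple.
by rewrite mem_dblist.
Qed.

Lemma tuple_port (D : pdb ar) (t : 'I_k * seq 'I_(dom D)) x y : deg_le d D -> t \in dblist (rels D) ->
  x \in t.2 -> y \in t.2 -> exists p : port, go x p = Some y.
Proof.
case: t => R s dD tD /= xs ys; have [sz [j H]] := (tuple_ports R x dD xs).1 tD.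
have ly : index y s < ar R by rewrite -sz index_mem.
have la : index y s < amx by case/andP: (har R) => _ h; apply: leq_trans ly h.
by exists (R, j, Ordinal la); rewrite H //= nth_index.
Qed.

Lemma port_tuple (D : pdb ar) x (p : port) y : go x p = Some y ->
  exists t, [/\ t \in dblist (rels D), x \in t.2 & y \in t.2].
Proof.
case/ports_tuple=> u [uD xu -> la _]; exists (p.1.1, tval u); rewrite mem_dblist; split=> //=.
by rewrite mem_nth // size_tuple.
Qed.

(* Two views which agree beyond the depth of [Q] identify [Q] with an induced substructure. *)
Section LocalIso.
Variables (H G : pdb ar) (M R : nat) (r : 'I_(dom H)) (g : 'I_(dom G)) (Q : {set 'I_(dom H)}).
Variables (wd : 'I_(dom H) -> M.-bseq port) (phi : 'I_(dom H) -> 'I_(dom G)).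
Hypothesis dH : deg_le d H.
Hypothesis dG : deg_le d G.
Hypothesis MR : M < R.
Hypothesis vw : view (@go H) R r = view (@go G) R g.
Hypothesis wdP : forall u, u \in Q -> walk (@go H) (Some r) (wd u) = Some u.
Hypothesis phiP : forall u, u \in Q -> walk (@go G) (Some g) (wd u) = Some (phi u).

Let wsz u : size (wd u) <= R.
Proof. by apply: leq_trans (size_bseq _) (ltnW MR). Qed.

Lemma phi_inj : {in Q &, injective phi}.
Proof.
move=> u v uQ vQ e; have [h _] := (viewP _ _ _ _ _).1 vw _ _ (wsz u) (wsz v).
move: h; rewrite !wdP // !phiP // e eqxx => /eqP[] //.
Qed.

Let wsz1 u p : size (wd u ++ [:: p]) <= R.
Proof. by rewrite size_cat addn1; apply: leq_trans MR; rewrite ltnS size_bseq. Qed.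

Lemma phi_port u v p : u \in Q -> v \in Q -> (go u p == Some v) = (go (phi u) p == Some (phi v)).
Proof.
move=> uQ vQ; have [h _] := (viewP _ _ _ _ _).1 vw _ _ (wsz1 u p) (wsz v).
by move: h; rewrite !walk_cat !wdP // !phiP.
Qed.

Lemma phi_port_inv u p w : u \in Q -> go (phi u) p = Some w ->
  exists2 v, go u p = Some v & v \in Q -> phi v = w.
Proof.
move=> uQ e; have [_ h] := (viewP _ _ _ _ _).1 vw _ _ (wsz1 u p) (wsz1 u p).
move: h; rewrite !walk_cat wdP // phiP //= e; case ev: (go u p) => [v|] // _; exists v => // vQ.
by have := phi_port p uQ vQ; rewrite ev e eqxx => /esym/eqP[].
Qed.

Lemma phi_tuple S s : all (mem Q) s -> s != [::] ->
  ((S, s) \in dblist (rels H)) = ((S, map phi s) \in dblist (rels G)).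
Proof.
case: s => // x s sQ _; have xQ : x \in Q by case/andP: sQ.
have e l : l < size (x :: s) -> nth x (x :: s) l \in Q by move=> lt; apply: (allP sQ); apply: mem_nth.
have xs : x \in x :: s by rewrite inE eqxx.
have pxs : phi x \in map phi (x :: s) by apply: map_f.
apply/idP/idP => /(tuple_ports S _) => [/(_ x x dH xs)|/(_ (phi x) (phi x) dG pxs)] [sz [j Hj]].
  apply/(tuple_ports S (phi x) dG pxs); rewrite size_map; split=> //; exists j => l lS.
  have lt : l < size (x :: s) by rewrite sz.
  by rewrite (nth_map x) //; apply/eqP; rewrite -phi_port ?e // Hj.
rewrite size_map in sz; apply/(tuple_ports S x dH xs); split=> //; exists j => l lS.
have lt : l < size (x :: s) by rewrite sz.
by apply/eqP; rewrite phi_port ?e // Hj // (nth_map x).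
Qed.
End LocalIso.
End Ports.

(** * Pulling components back along relocated pieces *)

Section Parts.
Variables (k : nat) (ar : 'I_k -> nat) (d amx : nat).
Hypothesis har : forall R, 0 < ar R <= amx.

Lemma wf_dblist (D : pdb ar) : wf amx (dblist (rels D)).
Proof.
move=> t /dblistP[R [u [_ ->]]] /=; rewrite size_tuple -size_eq0 size_tuple.
by case/andP: (har R) => h ->; rewrite -lt0n h.
Qed.

Section Pieces.
Variables (H : pdb ar) (A0 : {set 'I_(dom H)}) (M : nat).
Hypothesis dH : deg_le d H.
Local Notation LH := (dblist (rels H)).
Local Notation goH := (@go k ar d amx H).
Local Notation good u := (@cty k amx M _ LH A0 u != None).

Lemma word_in_piece x y : good x -> y \in cpnt LH A0 x ->
  exists w : M.-bseq (port k d amx), walk goH (Some x) w = Some y.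
Proof.
move=> gx; have cx : #|cpnt LH A0 x| <= M by move: gx; rewrite ctyE; case: ifP => // /andP[].
rewrite in_cpnt => /connectP[p0 ep0 ->]; case/shortenP: ep0 => p ep up _.
have szp : size p <= M.
  apply: leq_trans cx; apply: leq_trans (leqnSn _) _; rewrite -[(size p).+1]/(size (x :: p)) -(card_uniqP up).
  apply/subset_leq_card/subsetP => z; rewrite in_cpnt inE => /orP[/eqP->|zp]; first exact: connect0.
  case/splitPr: zp ep => p1 p2; rewrite -cat_rcons cat_path => /andP[e1 _].
  by apply/connectP; exists (rcons p1 z); rewrite ?last_rcons.
suff [w sw ew] : exists2 w : seq (port k d amx), size w = size p & walk goH (Some x) w = Some (last x p).
  have sM : size w <= M by rewrite sw.
  by exists (Bseq sM).
elim: p x ep {up szp gx cx} => [|z p IH] x /=; first by exists [::].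
case/andP=> /adjP[t [tL _ xt zt]] /IH[w sw ew].
have [q eq] := tuple_port har dH tL xt zt.
by exists (q :: w); rewrite /= ?sw // /walk /= eq.
Qed.

Lemma pieces : exists (a : 'I_(dom H) -> 'I_(dom H)) (wd wr : 'I_(dom H) -> M.-bseq (port k d amx)),
  [/\ forall u, walk goH (Some (a u)) (wd u) = Some u, forall u, walk goH (Some u) (wr u) = Some (a u) &
      forall u v, good u -> v \in cpnt LH A0 u -> a v = a u].
Proof.
(* Each good piece gets one common anchor inside it; all other elements are their own anchors, with
   empty words. *)
pose a u := if good u then odflt u [pick v in cpnt LH A0 u] else u.
have aC u : good u -> a u \in cpnt LH A0 u.
  by move=> gu; rewrite /a gu; case: pickP => //= _; apply: comp_refl.
have goodC u v : good u -> v \in cpnt LH A0 u -> good v.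
  by move=> gu vu; rewrite (cty_comp _ _ _ vu) //; move: gu; rewrite ctyE; case: ifP => // /andP[].
have w0 : size ([::] : seq (port k d amx)) <= M by [].
have [wd wdP] : exists wd : 'I_(dom H) -> M.-bseq (port k d amx), forall u, walk goH (Some (a u)) (wd u) = Some u.
  apply: (@fin_all_exists _ _ (fun u (w : M.-bseq (port k d amx)) => walk goH (Some (a u)) w = Some u)) => u.
  case gu: (good u); last by exists (Bseq w0); rewrite /a gu.
  apply: word_in_piece; first exact: goodC (aC _ gu).
  by rewrite (comp_eq (aC _ gu)) comp_refl.
have [wr wrP] : exists wr : 'I_(dom H) -> M.-bseq (port k d amx), forall u, walk goH (Some u) (wr u) = Some (a u).
  apply: (@fin_all_exists _ _ (fun u (w : M.-bseq (port k d amx)) => walk goH (Some u) w = Some (a u))) => u.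
  case gu: (good u); last by exists (Bseq w0); rewrite /a gu.
  by apply: word_in_piece => //; apply: aC.
exists a, wd, wr; split=> // u v gu vu; rewrite /a gu (goodC u v) // (comp_eq vu).
by case: pickP => //= /(_ u); rewrite comp_refl.
Qed.
End Pieces.

Section Labels.
Variables (H G : pdb ar) (A0 : {set 'I_(dom H)}) (AG : {set 'I_(dom G)}) (M K R : nat).
Hypothesis dH : deg_le d H.
Hypothesis dG : deg_le d G.
Hypothesis K0 : 0 < K.
Hypothesis MR : M < R.
Local Notation LH := (dblist (rels H)).
Local Notation LG := (dblist (rels G)).
Local Notation goH := (@go k ar d amx H).
Local Notation goG := (@go k ar d amx G).
Local Notation good u := (@cty k amx M _ LH A0 u != None).
Local Notation f := (@cty k amx K _ LG AG).
Variables (a : 'I_(dom H) -> 'I_(dom H)) (wd : 'I_(dom H) -> M.-bseq (port k d amx)).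
Variable chi : 'I_(dom H) -> option 'I_(dom G).
Hypothesis wdP : forall u, walk goH (Some (a u)) (wd u) = Some u.
Hypothesis aP : forall u v, good u -> v \in cpnt LH A0 u -> a v = a u.
Hypothesis chiP : forall v g, chi v = Some g -> view goH R v = view goG R g.

(** The whole piece of [u] is sent to [G] rigidly: its anchor goes to [chi (a u)] and the others
    follow along their words. *)
Definition reloc u : option 'I_(dom G) := obind (fun g => walk goG (Some g) (wd u)) (chi (a u)).

(** An element survives if the component of its image in [G] is entirely covered by the image of its
    piece; then the component can be pulled back. *)
Definition kept : {set 'I_(dom H)} := [set u | good u &&
  (if reloc u is Some g then (f g != None) && (cpnt LG AG g \subset [set w | [exists v in cpnt LH A0 u, reloc v == Some w]])
   else false)].

Section OnePiece.
Variables (u : 'I_(dom H)) (g : 'I_(dom G)).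
Hypothesis gu : good u.
Hypothesis ug : reloc u = Some g.
Local Notation Q := (cpnt LH A0 u).
Local Notation phi := (fun v => odflt g (reloc v)).

Lemma good_in : u \in A0.
Proof. by move: gu; rewrite ctyE; case: ifP => // /andP[]. Qed.

Lemma good_piece v : v \in Q -> good v.
Proof. by move=> vu; rewrite (cty_comp _ _ good_in vu). Qed.

Lemma anchor_image : exists g0, [/\ chi (a u) = Some g0, view goH R (a u) = view goG R g0 &
  forall v, v \in Q -> walk goH (Some (a u)) (wd v) = Some v /\ walk goG (Some g0) (wd v) = Some (phi v) ].
Proof.
case ec: (chi (a u)) => [g0|]; last by move: ug; rewrite /reloc ec.
exists g0; split=> //; first exact: chiP.
move=> v vQ; have av := aP gu vQ; have := wdP v; rewrite av => e; split=> //.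
have [_] := (viewP _ _ _ _ _).1 (chiP ec) _ _ (leq_trans (size_bseq (wd v)) (ltnW MR)) (leq_trans (size_bseq (wd v)) (ltnW MR)).
by rewrite e /reloc av ec /=; case: (walk goG _ _).
Qed.

Lemma reloc_piece v : v \in Q -> reloc v = Some (phi v).
Proof.
move=> vQ; have [g0 [ec _ /(_ v vQ)[_ e]]] := anchor_image.
by rewrite /reloc (aP gu vQ) ec /= e.
Qed.

Lemma reloc_inj : {in Q &, injective phi}.
Proof.
have [g0 [_ vw H0]] := anchor_image.
exact: (phi_inj MR vw (fun v vQ => (H0 v vQ).1) (fun v vQ => (H0 v vQ).2)).
Qed.

Lemma reloc_tuple S s : all (mem Q) s -> s != [::] -> ((S, s) \in LH) = ((S, map phi s) \in LG).
Proof.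
have [g0 [_ vw H0]] := anchor_image.
exact: (phi_tuple har dH dG MR vw (fun v vQ => (H0 v vQ).1) (fun v vQ => (H0 v vQ).2)).
Qed.

Lemma reloc_port_inv v p w : v \in Q -> goG (phi v) p = Some w -> exists2 v', goH v p = Some v' & v' \in Q -> phi v' = w.
Proof.
have [g0 [_ vw H0]] := anchor_image.
exact: (phi_port_inv MR vw (fun v vQ => (H0 v vQ).1) (fun v vQ => (H0 v vQ).2)).
Qed.

(** Equal views make relocation an isomorphism of the piece onto an induced substructure. The
    preimage of the component of [g] consists of kept elements and is a component there, hence has
    the same type. *)
Lemma kept_cty : u \in kept -> @cty k amx K _ LH kept u = f g.
Proof.
rewrite inE gu ug /= => /andP[fg /subsetP cov].
pose C := [set v in Q | phi v \in cpnt LG AG g].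
have gA : g \in AG by move: fg; rewrite ctyE; case: ifP => // /andP[].
have keptA v : v \in kept -> v \in A0.
  by rewrite inE => /andP[+ _]; rewrite ctyE; case: ifP => // /andP[].
have keptG v : v \in Q -> v \in kept -> phi v \in AG.
  move=> vQ; rewrite inE (reloc_piece vQ) => /and3P[_ + _]; rewrite ctyE; case: ifP => // /andP[] //.
have CK v : v \in C -> v \in kept.
  rewrite inE => /andP[vQ vg]; rewrite inE good_piece // (reloc_piece vQ) (cty_comp _ _ gA vg) fg /=.
  apply/subsetP=> w; rewrite (comp_eq vg) (comp_eq vQ); exact: cov.
have pu : phi u = g by rewrite /= ug.
rewrite -{1}pu; symmetry.
apply: (cty_emb amx K0 (C := C) (f := phi)).
- move=> v w; rewrite inE => /andP[vQ vg] /adjP[t [tL tA vt wt]].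
  have tQ : {subset t.2 <= Q}.
    by move=> z zt; rewrite -(comp_eq vQ); apply: (comp_tuple tL _ vt) => // y yt; apply: keptA; apply: tA.
  rewrite inE tQ //=; rewrite -(comp_eq vg).
  have tG : (t.1, map phi t.2) \in LG.
    rewrite -reloc_tuple -?surjective_pairing //; first by apply/allP.
    by case: (t.2) vt.
  apply: (comp_tuple tG) => /=.
  + by move=> _ /mapP[z zt ->]; apply: keptG; [exact: tQ | exact: tA].
  + by apply/mapP; exists v.
  + by apply/mapP; exists w.
- by move=> v w; rewrite !inE => /andP[vQ _] /andP[wQ _]; apply: reloc_inj.
- move=> v vC; rewrite CK //; move: vC; rewrite inE => /andP[_]; exact: (subsetP (comp_sub _ gA)).
- move=> t tL _ tC; rewrite /mapt -reloc_tuple -?surjective_pairing //.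
    by apply/allP=> z /tC; rewrite inE => /andP[].
  by case/andP: (wf_dblist tL).
- by move=> t /wf_dblist /andP[].
- move=> t' tL' tA' v; rewrite inE => /andP[vQ vg] vt.
  have tC' : {subset t'.2 <= cpnt LG AG g} by rewrite -(comp_eq vg); apply: comp_tuple tL' tA' vt.
  have : all (mem (phi @: Q)) t'.2.
    apply/allP=> w /tC' /cov; rewrite inE => /existsP[v' /andP[v'Q /eqP ev]].
    by apply/imsetP; exists v' => //; rewrite ev.
  case/imset_seqP=> s sQ es; exists (t'.1, s); split=> /=.
  + rewrite reloc_tuple // -?es -?surjective_pairing //.
    by case: (s) es => // es; move: vt; rewrite es.
  + by rewrite /mapt /= -es -surjective_pairing.
  + move=> z zs; have zQ : z \in Q := allP sQ _ zs; rewrite inE zQ /=; apply: tC'; rewrite es; exact: map_f.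
- by rewrite inE comp_refl /= ug comp_refl.
Qed.

Definition exposed : {set 'I_(dom H)} := [set v | [exists z in ~: A0, exists p, goH z p == Some v]].

(** Explore the component of [g] from [g] and lift each step to [H]. The lifted step stays in the
    piece unless its tuple meets the complement of [A0]; so an uncovered component contains the
    image of an exposed element. *)
Lemma not_kept : f g != None -> u \notin kept -> exists v, [/\ v \in Q, v \in exposed & phi v \in cpnt LG AG g].
Proof.
move=> fg; rewrite inE gu ug fg /= => ncov; apply: NNPP => nex; case/negP: ncov.
have gA : g \in AG by move: fg; rewrite ctyE; case: ifP => // /andP[].
apply/subsetP=> w wg; rewrite inE; move: (wg); rewrite in_cpnt => cw.
suff [v [vQ ev _]] : exists v, [/\ v \in Q, phi v = w & w \in cpnt LG AG g].
  by apply/existsP; exists v; rewrite vQ reloc_piece // ev eqxx.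
move: w cw {wg}; apply: connect_closed_ind.
  by exists u; rewrite ug; split=> //; apply: comp_refl.
move=> y z [v [vQ ey vg]] az; subst y; have zg : z \in cpnt LG AG g by rewrite -(comp_eq vg) in_cpnt; apply: connect1.
case/adjP: az => t' [tL' _ vt zt]; have [p ep] := tuple_port har dG tL' vt zt.
have [v' ev' ez] := reloc_port_inv vQ ep.
have [t [tL vt1 vt1']] := port_tuple ev'.
have tA : {subset t.2 <= A0}.
  move=> x xt; apply/negPn/negP => xA; apply: nex; exists v; split=> //; rewrite inE.
  have [q eq] := tuple_port har dH tL xt vt1.
  by apply/existsP; exists x; rewrite inE xA; apply/existsP; exists q; rewrite eq.
have v'Q : v' \in Q by rewrite -(comp_eq vQ); apply: comp_tuple tL tA vt1 _ vt1'.
by exists v'; split=> //; apply: ez.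
Qed.
End OnePiece.

Lemma card_exposed : #|exposed| <= #|port k d amx| * #|~: A0|.
Proof.
pose gz zp := odflt zp.1 (goH zp.1 zp.2).
apply: leq_trans (_ : #|gz @: setX (~: A0) [set: port k d amx]| <= _).
  apply/subset_leq_card/subsetP => v; rewrite inE => /existsP[z /andP[zA /existsP[p /eqP ep]]].
  by apply/imsetP; exists (z, p); rewrite ?inE /= ?andbT /gz /= ?ep //; rewrite inE in zA.
by apply: leq_trans (leq_imset_card _ _) _; rewrite cardsX cardsT mulnC.
Qed.

Definition hit : {set 'I_(dom H)} := [set u | if reloc u is Some g then f g != None else false].

(** A lost element is bad or is charged to an exposed one, as in [not_kept]. At most [K] elements
    are charged to one [v]: they lie in one piece and go injectively into one component of [G].
    Exposed elements number at most [#|port|] per element outside [A0]. *)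
Lemma card_lost : #|hit :\: kept| <= (1 + K * #|port k d amx|) * @vec k amx M _ LH A0 None.
Proof.
pose S v := [set u in hit | [&& good u, v \in cpnt LH A0 u &
   [exists g, exists g', [&& reloc u == Some g, reloc v == Some g' & g' \in cpnt LG AG g]]]].
have cS v : #|S v| <= K.
  have [->|[u0]] := set_0Vmem (S v); first by rewrite cards0.
  rewrite !inE => /and4P[h0 g0 v0 /existsP[g /existsP[g' /and3P[/eqP eg /eqP eg' cg]]]].
  have cK : #|cpnt LG AG g| <= K by move: h0; rewrite eg ctyE; case: ifP => // /andP[].
  apply: leq_trans cK; rewrite -(card_in_imset (f := fun u => odflt g (reloc u)) (D := mem (S v))).
    apply/subset_leq_card/subsetP => _ /imsetP[w + ->].
    rewrite !inE => /and4P[_ _ _ /existsP[g1 /existsP[g1' /and3P[/eqP e1 /eqP e1' c1]]]].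
    move: e1'; rewrite eg' => -[?]; subst g1'; rewrite e1 /= -(comp_eq cg) (comp_eq c1); exact: comp_refl.
  move=> w w'; rewrite !inE => /and4P[_ _ vw _] /and4P[_ _ vw' _].
  by apply: (reloc_inj g0 eg); rewrite -(comp_eq v0); [rewrite (comp_eq vw) | rewrite (comp_eq vw')];
    apply: comp_refl.
have A0b : #|~: A0| <= @vec k amx M _ LH A0 None.
  by apply/subset_leq_card/subsetP => z; rewrite !inE => /cty_notin->.
apply: leq_trans (_ : #|[set u | @cty k amx M _ LH A0 u == None] :|: \bigcup_(v in exposed) S v| <= _).
  apply/subset_leq_card/subsetP => u; rewrite in_setD => /andP[uk uh]; rewrite in_setU.
  case gu: (good u); last by rewrite inE (negbFE gu).
  move: (uh); rewrite inE; case ug: (reloc u) => [g|] // fg.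
  have [v [vQ ve vg]] := not_kept gu ug fg uk; apply/orP; right; apply/bigcupP; exists v => //.
  rewrite inE uh gu vQ /=; apply/existsP; exists g; apply/existsP; exists (odflt g (reloc v)).
  by rewrite ug eqxx (reloc_piece gu ug vQ) /= vg eqxx.
apply: leq_trans (leq_card_setU _ _) _; rewrite mulnDl mul1n leq_add2l.
apply: leq_trans (_ : \sum_(v in exposed) #|S v| <= _).
  apply: (big_ind2 (fun (A : {set 'I_(dom H)}) m => #|A| <= m)) => [|A m B m' hA hB|//]; first by rewrite cards0.
  by apply: leq_trans (leq_card_setU _ _) _; apply: leq_add.
apply: leq_trans (leq_sum _ _) _; first by move=> v _; exact: cS v.
rewrite sum_nat_const mulnC -mulnA leq_mul2l; apply/orP; right.
by apply: leq_trans card_exposed _; rewrite leq_mul2l A0b orbT.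
Qed.
End Labels.
End Parts.

(** * Databases with similar views *)

Section HistogramArithmetic.
Local Open Scope ring_scope.

(** In the application [v] is the histogram of the kept part of [H], [x] that of the transported
    labels, [w] that of the pumped forest and [g] that of [G]; [la] is the ratio of the sizes. Both
    [x] and [w] are close to [la * g], and [v] is [x] without few lost elements. *)
Lemma hist_close (Y : finType) (v w x g : Y -> rat) (vN wN gN n m e dl la : rat) :
  0 < m -> 0 <= dl -> n = la * m -> (#|Y|.+1)%:R * dl <= e ->
  (forall y, `|x y - la * g y| <= dl) -> (forall y, `|w y - la * g y| <= dl) ->
  (forall y, v y <= x y) -> \sum_y (x y - v y) <= e -> wN <= la * gN + dl -> la * gN - dl <= wN -> la * gN <= e ->
  gN + \sum_y g y = m -> vN + \sum_y v y = n ->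
  vN + wN + \sum_y `|v y - w y| <= 8 * e /\ n - e <= wN + \sum_y w y.
Proof.
move=> m0 dl0 en he hx hw hv hs hwN hwN' hgN eg ev.
have s0 : \sum_(y : Y) dl = #|Y|%:R * dl by rewrite sumr_const mulr_natl.
have he' : #|Y|%:R * dl + dl <= e by move: he; rewrite -addn1 natrD mulrDl mul1r.
have sx : la * \sum_y g y - #|Y|%:R * dl <= \sum_y x y.
  rewrite -s0 mulr_sumr -sumrB; apply: ler_sum => y _; move: (hx y); rewrite ler_norml => /andP[]; lra.
have sw : la * \sum_y g y - #|Y|%:R * dl <= \sum_y w y.
  rewrite -s0 mulr_sumr -sumrB; apply: ler_sum => y _; move: (hw y); rewrite ler_norml => /andP[]; lra.
have svw : \sum_y `|v y - w y| <= e + 2 * (#|Y|%:R * dl).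
  apply: le_trans (_ : \sum_y ((x y - v y) + 2 * dl) <= _).
    apply: ler_sum => y _; move: (hw y) (hx y) (hv y); rewrite !ler_norml => /andP[a1 a2] /andP[b1 b2] c1.
    by apply/andP; split; lra.
  by rewrite big_split /= -mulr_sumr s0 lerD2r.
rewrite sumrB in hs.
have e1 : la * gN + la * \sum_y g y = n by rewrite -mulrDr eg.
have c0 : 0 <= #|Y|%:R * dl by rewrite mulr_ge0 // ler0n.
by split; lra.
Qed.
End HistogramArithmetic.

Lemma nd_mark k c K1 (T : tree k c) : nd (mark K1 T) = nd T.
Proof.
elim: T => [|i own x a IHa b IHb|a IH] //=.
by case: ifP => _ /=; rewrite IHa IHb.
Qed.

Section Close.
Variables (k : nat) (ar : 'I_k -> nat) (d t : nat) (phi : formula ar).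
Hypothesis har : forall R, 0 < ar R.
Hypothesis hphi : sentence phi.

(** The bridge from databases to forests: one marked forest together with the set [A] of elements
    outside the bags of its marks, carried over by the isomorphism. *)
Lemma marked_tree (D : pdb ar) K1 : class_C d t D -> 0 < K1 -> exists (T : tree k t.+1) (A : {set 'I_(dom D)}),
  [/\ wft ar T, okK K1.*2 T, osz T <= K1.*2, marks T * K1 <= dom D & nd T = dom D] /\
  [/\ degok d T, forall amx K (y : option 'I_(ncode k amx K)), (forall R, 0 < ar R <= amx) -> 0 < K ->
        vec (dblist (rels D)) A y = hv T y &
      0 < dom D -> models D phi = msat (cl T) (fun _ => set0) phi].
Proof.
move=> CD K10; have [T0 /(built_mark K1) bT] := tree_of_db har CD.
have [o1 o2 o3] := markP T0 K10; have [f [fB fL fd]] := built_iso bT.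
have ed := nd_mark K1 T0.
have end' : nd (mark K1 T0) = dom D by rewrite -card_El_nd (bij_eq_card fB) card_ord.
have [_ _ wT] := bT; exists (mark K1 T0), (f @: AT (mark K1 T0)); do 2!split=> //.
- by apply: leq_trans (ltnW o1) _; rewrite -addnn leq_addr.
- by rewrite -end' ed; apply: leq_trans o3; rewrite leq_addr.
- by apply: fd; case: CD.
- move=> amx K y har' K0; have fI := bij_inj fB; have [f' fK f'K] := fB.
  have wD : wf amx (dblist (rels D)) := wf_dblist har' (D := D).
  have ct u : cty amx K (dblist (rels D)) (f @: AT (mark K1 T0)) (f u) = cty amx K (cl (mark K1 T0)) (AT (mark K1 T0)) u.
    apply: (cty_emb amx K0 (C := [set: El (mark K1 T0)])) => //.
    + by move=> x z _ _; apply: fI.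
    + by move=> x _; apply/imsetP/idP => [[z zA /fI->]|xA] //; exists x.
    + by move=> [R s] sL _ _; rewrite /mapt /= -fL.
    + by move=> s /wD/andP[].
    + move=> [R s] sL _ x _ _; exists (R, map f' s); rewrite /mapt /= -map_comp (eq_map f'K) map_id.
      by rewrite fL -map_comp (eq_map f'K) map_id; split.
  rewrite /hv /vec -(card_imset _ fI); apply: eq_card => u; rewrite inE.
  apply/idP/imsetP => [hu|[z]]; last by rewrite inE => hz ->; rewrite ct.
  by exists (f' u); rewrite ?inE ?f'K // -ct f'K.
move=> D0; have /andP[/eqP fo0 /eqP so0] := hphi.
pose S (z : nat + nat) : {set El (mark K1 T0)} := match z with
  | inl _ => [set v | f v == 0 :> nat] | inr _ => set0 end.
have -> : msat (cl (mark K1 T0)) (fun _ => set0) phi = msat (cl (mark K1 T0)) S phi.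
  by apply: msat_free => x; rewrite ?fo0 ?so0.
apply: (sat_msat (f := f)) => //.
by move=> X; apply/setP=> v; rewrite !inE.
Qed.
Definition maxar := \max_R ar R.

Lemma maxarP R : 0 < ar R <= maxar.
Proof. by rewrite har /=; apply: (leq_bigmax R). Qed.

Lemma card_Some (V F : finType) (c : V -> option F) :
  \sum_y #|[set u | c u == Some y]| = #|[set u | c u != None]|.
Proof.
rewrite -(eq_bigr _ (fun y _ => sum1dep_card _)) -sum1dep_card [in RHS]big_mkcond /=.
rewrite (eq_bigr _ (fun y _ => big_mkcond _ _)) exchange_big /=; apply: eq_bigr => u _.
case: (c u) => [z|] /=; last by rewrite big1.
rewrite (bigD1 z) //= eqxx big1 ?addn0 // => y yz; rewrite ifF //; apply/negP=> /eqP[e].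
by rewrite e eqxx in yz.
Qed.

Lemma card_option (V F : finType) (c : V -> option F) :
  #|[set u | c u == None]| + \sum_y #|[set u | c u == Some y]| = #|V|.
Proof.
rewrite card_Some -cardsUI -[RHS]cardsT -[RHS]addn0; congr addn.
  by apply: eq_card => u; rewrite !inE; case: (c u).
by apply: eq_card0 => u; rewrite !inE andbN.
Qed.

Section ScaleError.
Local Open Scope ring_scope.

Lemma eq_le (p q : rat) : p = q -> p <= q.
Proof. by move->. Qed.

Lemma mulr_divM (i j z : rat) : i != 0 -> j != 0 -> i * (z / (i * j)) = z / j.
Proof. by move=> i0 j0; field; apply/andP. Qed.

Lemma ratio_le (n m g r : rat) : 0 < m -> 0 < r -> 0 <= n -> g * r <= m -> n / m * g <= n / r.
Proof.
move=> m0 r0 n0 h; rewrite -mulrA; apply: ler_wpM2l => //.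
by rewrite -[r^-1]mul1r ler_pdivlMr // -mulrA ler_pdivrMl // mulr1.
Qed.

Lemma le_mul16 (e n m : rat) : 0 < e -> 1 <= m -> e * (16 * m) = n -> e * 16 <= n.
Proof. by move=> e0 m1 <-; nra. Qed.

Lemma gt0_of_close (e n z : rat) : 0 < e -> e * 16 <= n -> n - e <= z -> 0 < z.
Proof. by move=> e0 h1 h2; lra. Qed.

Lemma dist_bound (e n m b : rat) : 1 <= m -> e * (16 * m) = n -> b <= 8 * e -> m * b * 2 <= n.
Proof. by move=> m1 <- h; nra. Qed.

Lemma dist_bound_min (e n m b z : rat) : 0 < e -> e * 16 <= n -> n - e <= z -> m * b * 2 <= n -> m * b <= n /\ m * b <= z.
Proof. by move=> e0 h1 h2 h3; split; lra. Qed.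

Lemma natr_absdiff (i j : nat) : ((i - j) + (j - i))%:R = `|i%:R - j%:R| :> rat.
Proof.
wlog ij : i j / (i <= j)%N => [H|].
  by case/orP: (leq_total i j) => /H // e; rewrite addnC e distrC.
have /eqP-> : (i - j == 0)%N by rewrite subn_eq0.
by rewrite add0n natrB // distrC ger0_norm // subr_ge0 ler_nat.
Qed.

Lemma scale_err (m n w g W r : rat) : 0 < m -> 0 < r -> 2 * W * r <= n -> 2 * W * r <= m -> 0 <= W -> 0 <= n ->
  m * w <= n * g + (m + n) * W -> n * g <= m * w + (m + n) * W -> `|w - n / m * g| <= n / r.
Proof.
move=> m0 r0 hn hm W0 n0 h1 h2; set z := w - _.
have ez : m * z = m * w - n * g by rewrite /z; field; rewrite gt_eqF.
have az : m * `|z| <= (m + n) * W by rewrite -{1}(gtr0_norm m0) -normrM ez ler_norml; apply/andP; split; lra.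
rewrite ler_pdivlMr // -(ler_pM2l m0) mulrA; apply: le_trans (_ : (m + n) * W * r <= _).
  by rewrite ler_wpM2r // ltW.
have a1 : m * (2 * W * r) <= m * n by rewrite ler_wpM2l // ltW.
have a2 : n * (2 * W * r) <= n * m by rewrite ler_wpM2l.
by lra.
Qed.
End ScaleError.

Lemma card_setC_rank (V : finType) (B : {set V}) : #|~: (enum_rank @: B)| = #|~: B|.
Proof.
apply: (@addnI #|B|); rewrite cardsC -[RHS]card_ord -(cardsC (enum_rank @: B)).
by rewrite (card_imset _ enum_rank_inj).
Qed.

(** The types of [G] are transported to [H], and the forest of [G] is rescaled to the size of [H]
    without change of state. Both histograms are near the rescaled histogram of [G], so matching
    components makes [H] and the rescaled member isomorphic after few deletions. *)
Theorem close_of_views m1 : 0 < m1 -> exists (Rmax N0 : nat) (del : rat), (0 < del)%R /\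
  forall H G, class_C d t H -> class_C d t G -> models G phi -> N0 <= dom H -> N0 <= dom G ->
  (forall s, s <= Rmax -> (tvd (@go k ar d maxar H) (@go k ar d maxar G) s <= del)%R) ->
  exists D' b, [/\ class_C d t D', models D' phi, dist_le H D' b & m1 * b <= minn (dom H) (dom D')].
Proof.
(* The errors are measured in units of [n / kk]. The distance comes out as at most 8 units, so
   [kk = 16 * m1] leaves a factor 2 for the new domain being slightly smaller than that of [H]. *)
move=> m10; pose kk := 16 * m1; have kk0 : 0 < kk by rewrite muln_gt0.
have [Q [F [FX [FM FP]]]] := tree_state t.+1 phi d.
pose K1 := t.+1 * kk; have K10 : 0 < K1 by rewrite muln_gt0.
pose K := K1.*2; have K0 : 0 < K by rewrite double_gt0.
pose am := maxar; have har' : forall R, 0 < ar R <= am := maxarP.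
pose N := ncode k am K; pose P := port k d am.
(* The pieces of [H] are larger than the components of [G]: the factor [1 + K * #|P|] absorbs the
   loss of [card_lost] at their boundaries. *)
pose KH1 := t.+1 * kk * (1 + K * #|P|); have KH10 : 0 < KH1 by rewrite /KH1 muln_gt0 -/K1 K10.
pose M := KH1.*2; have M0 : 0 < M by rewrite double_gt0.
pose r : rat := (N.+1 * kk)%:R%R.
have r0 : (0 < r)%R by rewrite ltr0n muln_gt0.
have eta0 : (0 < r^-1)%R by rewrite invr_gt0.
(* The minimal radius [M.+1] lets the views see one step beyond the words of a piece, as local
   isomorphism requires. The error is divided among the [N.+1] labels. *)
have [Rmax [N0 [del [del0 HT]]]] := transfer P (option 'I_N : finType) M M.+1 eta0.
pose W := Wp k Q K am K.
(* This size makes the constant error of [scaling] negligible for both databases. *)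
exists Rmax, (N0 + 2 * W * (N.+1 * kk)).+1, del; split=> // H G CH CG phiG nN0 mN0 Htv.
have n0 : 0 < dom H by apply: leq_ltn_trans nN0.
have m0 : 0 < dom G by apply: leq_ltn_trans mN0.
have [dH _] := CH; have [dG _] := CG.
have [TG [AG [[wG okG oG mG nG] [dgG hG modG]]]] := marked_tree CG K10.
have [TH [AH [[wH okH oH mH nH] [_ hH _]]]] := marked_tree CH KH10.
have [a [wd [wr [wdP wrP aP]]]] := pieces har' AH M dH.
pose LH := dblist (rels H); pose LG := dblist (rels G).
pose f : 'I_(dom G) -> (option 'I_N : finType) := fun g => cty am K LG AG g.
have [|||R [chi [MR chiP Hchi]]] := HT 'I_(dom H) 'I_(dom G) (@go k ar d am H) (@go k ar d am G) f a wd wr _ _ _ Htv wdP wrP.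
- by rewrite card_ord; apply: leq_trans (ltnW nN0); apply: leq_addr.
- by rewrite card_ord.
- by rewrite card_ord.
have [T' [wT' FT' hT']] := scaling FX FM har' K0 (dom H) wG okG oG.
pose kp : {set 'I_(dom H)} := kept AH AG K a wd chi.
have kpf u y : cty am K LH kp u = Some y -> obind f (reloc a wd chi u) = Some y.
  move=> cu; have uk : u \in kp by case: (cty_Some cu).
  move: (uk); rewrite inE => /andP[gu]; case ug: (reloc a wd chi u) => [g|] // _ /=.
  exact: etrans (esym (kept_cty har' dH dG K0 MR wdP aP chiP gu ug uk)) cu.
pose c u := obind f (reloc a wd chi u).
pose v y : rat := (vec LH kp (Some y : option 'I_N))%:R%R.
pose x y : rat := #|[set u | c u == Some y]|%:R%R.
pose w y : rat := (hv T' (Some y : option 'I_N))%:R%R.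
pose g y : rat := (hv TG (Some y : option 'I_N))%:R%R.
pose n : rat := (dom H)%:R%R; pose m : rat := (dom G)%:R%R.
have cK u : u \in kp -> cty am K LH kp u != None.
  move=> uk; move: (uk); rewrite inE => /andP[gu]; case ug: (reloc a wd chi u) => [h|] // /andP[fh _].
  by apply: contra_neq fh => e; exact: etrans (esym (kept_cty har' dH dG K0 MR wdP aP chiP gu ug uk)) e.
have hgy (y : option 'I_N) : hv TG y = #|[set h | f h == y]| by rewrite -hG.
have m0' : (0 < m)%R by rewrite ltr0n.
have hx y : (`|x y - n / m * g y| <= n / r)%R.
  have := Hchi (Some y); rewrite !card_ord -hgy [(r^-1 * _)%R]mulrC.
  have -> // : [set u | image_type (@go k ar d am G) f (chi (a u)) (wd u) == Some (Some y)] = [set u | c u == Some y].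
  apply/setP=> u; rewrite !inE /c /image_type -/(reloc a wd chi u).
  by case: (reloc a wd chi u).
have big0 : (2 * W%:R * r <= n /\ 2 * W%:R * r <= m)%R.
  rewrite -!natrM !ler_nat; split; [apply: leq_trans (ltnW nN0)|apply: leq_trans (ltnW mN0)]; exact: leq_addl.
have hw (y : option 'I_N) : (`|(hv T' y)%:R - n / m * (hv TG y)%:R| <= n / r)%R.
  have [h1 h2] := hT' y; rewrite nG in h1 h2.
  apply: (@scale_err _ _ _ _ W%:R) => //; try by [case: big0 | exact: ler0n].
    by rewrite /n /m -!natrM -!natrD -natrM -natrD ler_nat.
  by rewrite /n /m -!natrM -!natrD -natrM -natrD ler_nat.
have hlost : #|hit AG K a wd chi :\: kp| * kk <= dom H.
  have h1 := card_lost har' AG K dH dG MR wdP aP chiP.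
  have h2 : vec LH AH (None : option 'I_(ncode k am M)) <= t.+1 * marks TH.
    by rewrite hH //; apply: hv_None => //; exact: har'.
  apply: leq_trans (leq_mul h1 (leqnn kk)) _; apply: leq_trans mH.
  apply: leq_trans (leq_mul (leq_mul (leqnn _) h2) (leqnn kk)) _; rewrite /KH1; apply: eq_leq; ring.
have hgN : hv TG (None : option 'I_N) * kk <= dom G.
  have h1 : hv TG (None : option 'I_N) <= t.+1 * marks TG by apply: hv_None => //; exact: har'.
  by apply: leq_trans (leq_mul h1 (leqnn kk)) _; apply: leq_trans mG; rewrite /K1; apply: eq_leq; ring.
pose e : rat := (n / kk%:R)%R.
have kk0' : (0 < kk%:R :> rat)%R by rewrite ltr0n.
have n0' : (0 < n)%R by rewrite ltr0n.
have hsum : (\sum_y (x y - v y) <= e)%R.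
  rewrite sumrB -!natr_sum card_Some; have -> : \sum_y vec LH kp (Some y : option 'I_N) = #|kp|.
    rewrite card_Some; apply: eq_card => u; rewrite inE; apply/idP/idP => [|uk]; last exact: cK.
    by apply: contraLR => uk; rewrite cty_notin.
  rewrite /e ler_pdivlMr //; have hh : #|[set u | c u != None]| <= #|hit AG K a wd chi :\: kp| + #|kp|.
    rewrite -(cardsID kp [set u | c u != None]) addnC; apply: leq_add; last by rewrite subset_leq_card // subsetIr.
    apply/subset_leq_card/subsetP=> u; rewrite !inE => /andP[-> ]; rewrite /c.
    by case: (reloc a wd chi u).
  apply: le_trans (_ : #|hit AG K a wd chi :\: kp|%:R * kk%:R <= _)%R; last by rewrite -natrM ler_nat.
  by rewrite ler_wpM2r ?ler0n // lerBlDr -natrD ler_nat.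
have [|||||||||b1 b2] := @hist_close 'I_N v w x g (vec LH kp (None : option 'I_N))%:R%R (hv T' (None : option 'I_N))%:R%R
  (hv TG (None : option 'I_N))%:R%R n m e (n / r)%R (n / m)%R m0' _ _ _ hx (fun y => hw (Some y)) _ hsum.
- by rewrite divr_ge0 ?ltW.
- by rewrite divfK // gt_eqF.
- by rewrite card_ord /e /r natrM; apply: eq_le; apply: mulr_divM; rewrite pnatr_eq0 // -lt0n.
- by move=> y; rewrite ler_nat; apply/subset_leq_card/subsetP=> u; rewrite !inE => /eqP/kpf; rewrite /c => ->.
- by move: (hw None); rewrite ler_norml lerBlDr => /andP[_]; rewrite addrC.
- by move: (hw None); rewrite ler_norml lerBrDr => /andP[+ _]; rewrite addrC.
- by apply: ratio_le => //; rewrite -?natrM ?ler_nat ?ltW.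
- rewrite /g -natr_sum -natrD; congr (_%:R)%R.
  by rewrite hgy (eq_bigr _ (fun y _ => hgy (Some y))) card_option card_ord.
- rewrite /v -natr_sum -natrD; congr (_%:R)%R.
  by have := card_option (cty am K LH kp); rewrite card_ord.
have kk16 : (kk%:R = 16 * m1%:R :> rat)%R by rewrite natrM.
have m1' : (1 <= m1%:R :> rat)%R by rewrite ler1n.
have en : (e * (16 * m1%:R) = n)%R by rewrite /e kk16 divfK // mulf_neq0 ?gt_eqF // (lt_le_trans ltr01).
have e0 : (0 < e)%R by rewrite divr_gt0.
have dT : (n - e <= (nd T')%:R)%R.
  apply: le_trans b2 _; rewrite /w -natr_sum -natrD ler_nat -card_El_nd.
  by rewrite -(card_option (cty am K (cl T') (AT T'))).
have e1 : (e * 16 <= n)%R by exact: le_mul16 e0 m1' en.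
have nT0 : 0 < nd T' by rewrite -(ltr0n rat); exact: gt0_of_close e0 e1 dT.
have [v0] : exists v0 : El T', true.
  by move: nT0; rewrite -card_El_nd => /card_gt0P[v0 _]; exists v0.
have wLH : wf am LH := wf_dblist har' (D := H).
have [A1 [A1' [h [[hI hA hL] hc]]]] := match_parts K0 kp (AT T') v0 wLH (wft_wf har' wT') => _.
pose b := #|~: A1| + #|~: A1'|.
have cB := card_setC_rank A1'.
exists (pdb_of ar T'), b.
have [eqm eqd] := FP _ _ FT'.
have CD' : class_C d t (pdb_of ar T') by split; [apply: pdb_of_deg => //; rewrite eqd | apply: pdb_of_tw].
split=> //.
- by rewrite pdb_of_models // eqm -modG.
- have iso : isoon (dblist (rels H)) (dblist (rels (pdb_of ar T'))) A1 (enum_rank @: A1')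
      (fun u => enum_rank (h u) : 'I_(dom (pdb_of ar T'))).
    split; first by move=> u z uA zA /enum_rank_inj; apply: hI.
      by rewrite -hA -imset_comp.
    by move=> R0 s sA; rewrite hL // (db_of_list _ _ wT') -map_comp.
  by have := isoon_dist iso; rewrite cB.
have disc : (b%:R <= 8 * e)%R.
  apply: le_trans b1; apply: le_trans (_ : (vec LH kp (None : option 'I_N) + hv T' (None : option 'I_N) +
    @discrepancy k am K _ _ LH (cl T') kp (AT T'))%:R <= _)%R; first by rewrite ler_nat; exact: hc.
  rewrite !natrD lerD2l /discrepancy natr_sum; apply: ler_sum => y _; apply: eq_le; exact: natr_absdiff.
have [h1 h2] := dist_bound_min e0 e1 dT (dist_bound m1' en disc).
rewrite leq_min -!(ler_nat rat) natrM; apply/andP; split; first exact: h1.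
by have -> : dom (pdb_of ar T') = nd T' by exact: card_El_nd.
Qed.
End Close.

(** * Sampling *)

Section Sampling.
Local Open Scope ring_scope.

Lemma sum_const_seq (vs : seq nat) (z : rat) : \sum_(v <- vs) z = (size vs)%:R * z.
Proof.
elim: vs => [|v vs IH]; first by rewrite big_nil mul0r.
by rewrite big_cons IH /= -[in RHS]add1n natrD mulrDl mul1r.
Qed.

Fixpoint nsum (vs : seq nat) (s : nat) (F : seq nat -> rat) : rat :=
  if s is s'.+1 then \sum_(v <- vs) nsum vs s' (fun tau => F (v :: tau)) else F [::].

Lemma natr_cnt vs s F : (cnt vs s F)%:R = nsum vs s (fun tau => (F tau)%:R).
Proof.
elim: s F => //= s IH F; rewrite natr_sum; apply: eq_bigr => v _; exact: IH.
Qed.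

Lemma nsum_le vs s F F' : (forall tau, size tau = s -> F tau <= F' tau) -> nsum vs s F <= nsum vs s F'.
Proof.
elim: s F F' => [|s IH] F F' H /=; first exact: H.
by apply: ler_sum => v _; apply: IH => tau st; apply: H; rewrite /= st.
Qed.

Lemma nsumM vs s F z : nsum vs s (fun tau => z * F tau) = z * nsum vs s F.
Proof. by elim: s F => //= s IH F; rewrite mulr_sumr; apply: eq_bigr => v _; apply: IH. Qed.

Lemma nsum_sum (C : finType) vs s (F : C -> seq nat -> rat) :
  nsum vs s (fun tau => \sum_c F c tau) = \sum_c nsum vs s (F c).
Proof.
elim: s F => //= s IH F; rewrite exchange_big /=; apply: eq_bigr => v _; exact: (IH (fun c tau => F c (v :: tau))).
Qed.

Lemma nsum_ext vs s F F' : F =1 F' -> nsum vs s F = nsum vs s F'.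
Proof. by elim: s F F' => [|s IH] F F' H /=; [apply: H | apply: eq_bigr => v _; apply: IH => tau; apply: H]. Qed.

(* The variance of a sum of independent centred variables. *)
Lemma nsum_var vs s (g : nat -> rat) b : \sum_(v <- vs) g v = 0 ->
  (size vs)%:R * nsum vs s (fun tau => (b + \sum_(v <- tau) g v) ^+ 2) =
  (size vs)%:R ^+ s.+1 * b ^+ 2 + s%:R * (size vs)%:R ^+ s * \sum_(v <- vs) g v ^+ 2.
Proof.
move=> g0; set n : rat := (size vs)%:R; set G := \sum_(v <- vs) g v ^+ 2.
elim: s b => [|s IH] b /=; first by rewrite big_nil addr0 mulr0n !mul0r addr0 expr1.
rewrite mulr_sumr (eq_bigr (fun v => n ^+ s.+1 * b ^+ 2 + s%:R * n ^+ s * G + n ^+ s.+1 * (2 * b) * g v + n ^+ s.+1 * g v ^+ 2)).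
  rewrite !big_split /= -!mulr_sumr g0 mulr0 addr0 -/G !sum_const_seq -/n -[in s.+1%:R]addn1 natrD !exprS; ring.
move=> v _; rewrite (@nsum_ext _ _ _ (fun tau => ((b + g v) + \sum_(v <- tau) g v) ^+ 2)).
  by rewrite IH; ring.
by move=> tau; rewrite big_cons addrA.
Qed.

Section Classes.
Variables (C : finType).

Definition freq (n : nat) (cl : nat -> C) (c : C) : rat := (\sum_(v <- iota 0 n) (cl v == c))%:R / n%:R.

Definition dev (p : C -> rat) (ks : seq C) : rat := \sum_c ((count_mem c ks)%:R - (size ks)%:R * p c) ^+ 2.

(** The expected squared deviation is at most [s], as the variances of the indicators of all classes
    sum to at most 1 per draw; Markov's inequality gives the bound 1/3. *)
Lemma sampling n (cl : nat -> C) s : (0 < n)%N -> (0 < s)%N ->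
  (3 * cnt (iota 0 n) s (fun tau => (3 * s%:R < dev (freq n cl) (map cl tau))%R) <= n ^ s)%N.
Proof.
move=> n0 s0; set vs := iota 0 n; pose p := freq n cl.
have n0' : 0 < n%:R :> rat by rewrite ltr0n.
have s0' : 0 < s%:R :> rat by rewrite ltr0n.
have sz : (size vs)%:R = n%:R :> rat by rewrite size_iota.
pose g c v : rat := (cl v == c)%:R - p c.
have sI c : \sum_(v <- vs) (cl v == c)%:R = n%:R * p c :> rat.
  by rewrite /p /freq natr_sum mulrCA mulfV ?mulr1 // gt_eqF.
have sC (z : rat) : \sum_(v <- vs) z = n%:R * z.
  by rewrite sum_const_seq sz.
have g0 c : \sum_(v <- vs) g c v = 0 by rewrite sumrB sI sC subrr.
have G c : \sum_(v <- vs) g c v ^+ 2 <= \sum_(v <- vs) (cl v == c)%:R.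
  have -> : \sum_(v <- vs) g c v ^+ 2 = \sum_(v <- vs) ((cl v == c)%:R - 2 * p c * (cl v == c)%:R + p c ^+ 2).
    by apply: eq_bigr => v _; rewrite /g; case: (cl v == c) => /=; ring.
  rewrite big_split sumrB /= -mulr_sumr sI sC; have := mulr_ge0 (ltW n0') (sqr_ge0 (p c)); lra.
have Gs : \sum_c \sum_(v <- vs) g c v ^+ 2 <= n%:R.
  apply: le_trans (ler_sum _ (fun c _ => G c)) _; rewrite exchange_big /=.
  rewrite (eq_bigr (fun _ => 1)); first by rewrite sC mulr1.
  move=> v _; rewrite (bigD1 (cl v)) //= eqxx big1 ?addr0 // => c /negPf; rewrite eq_sym => ->.
  by [].
have D : nsum vs s (fun tau => dev p (map cl tau)) <= s%:R * n%:R ^+ s.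
  have -> : nsum vs s (fun tau => dev p (map cl tau)) = nsum vs s (fun tau => \sum_c (0 + \sum_(v <- tau) g c v) ^+ 2).
    apply: nsum_ext => tau; apply: eq_bigr => c _; rewrite add0r sumrB sum_const_seq.
    rewrite size_map count_map -sum1_count natr_sum big_mkcond /=; congr ((_ - _) ^+ 2).
    by apply: eq_bigr => v _; case: (cl v == c).
  rewrite nsum_sum -(ler_pM2l n0') mulr_sumr.
  rewrite (eq_bigr (fun c => s%:R * n%:R ^+ s * \sum_(v <- vs) g c v ^+ 2)); last first.
    by move=> c _; rewrite -sz nsum_var // expr0n mulr0 add0r.
  by rewrite -mulr_sumr [leRHS]mulrC; apply: ler_wpM2l Gs; rewrite mulr_ge0 ?exprn_ge0 ?ler0n.
rewrite -(ler_nat rat) natrM natrX -(ler_pM2l s0'); apply: le_trans D.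
rewrite natr_cnt mulrA [s%:R * 3]mulrC -nsumM; apply: nsum_le => tau _.
case: ltP => h; rewrite ?mulr1 ?mulr0; first exact: ltW.
by apply: sumr_ge0 => c _; apply: sqr_ge0.
Qed.

(** Two distributions that fit the same sample are close in l2, by [(x - y)^2 <= 2 x^2 + 2 y^2]
    scaled by the sample size. *)
Lemma dev_triangle p p' (ks : seq C) s : (0 < s)%N -> size ks = s -> dev p ks <= 3 * s%:R -> dev p' ks <= 3 * s%:R ->
  \sum_c (p c - p' c) ^+ 2 <= 12 / s%:R.
Proof.
move=> s0 sz h h'; have s0' : 0 < s%:R :> rat by rewrite ltr0n.
rewrite ler_pdivlMr // -(ler_pM2l s0').
apply: le_trans (_ : 2 * dev p ks + 2 * dev p' ks <= _); last by lra.
rewrite mulrA [s%:R * _]mulrC -mulrA mulr_suml /dev !mulr_sumr -big_split /=; apply: ler_sum => c _.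
rewrite sz; move: (count_mem c ks)%:R (s%:R) (p c) (p' c) => x z y y'.
have := sqr_ge0 (2 * x - z * y - z * y'); nra.
Qed.
End Classes.

Section ViewClasses.
Variables (P C : finType) (V V' : finType) (go : V -> P -> option V) (go' : V' -> P -> option V') (r : nat).
Variables (cl : V -> C) (cl' : V' -> C).
Hypothesis h1 : forall x y, cl x = cl y -> view go r x = view go r y.
Hypothesis h2 : forall x y, cl' x = cl' y -> view go' r x = view go' r y.
Hypothesis h3 : forall x y, cl x = cl' y -> view go r x = view go' r y.

(** The classes refine the views consistently on both sides, and merging classes can only decrease
    the l1 distance. *)
Lemma tvd_classes : tvd go go' r <= \sum_c `|#|[set x | cl x == c]|%:R / #|V|%:R - #|[set y | cl' y == c]|%:R / #|V'|%:R|.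
Proof.
pose vc c : option 'I_(nview P r) := if [pick x | cl x == c] is Some x then Some (view go r x) else
  if [pick y | cl' y == c] is Some y then Some (view go' r y) else None.
have v1 x : vc (cl x) = Some (view go r x).
  by rewrite /vc; case: pickP => [z /eqP/h1->|/(_ x)] //; rewrite eqxx.
have v2 y : vc (cl' y) = Some (view go' r y).
  rewrite /vc; case: pickP => [z /eqP/h3->|_] //.
  by case: pickP => [z /eqP/h2->|/(_ y)] //; rewrite eqxx.
have card (S : finType) (b : S -> C) (w : S -> 'I_(nview P r)) T : (forall x, vc (b x) = Some (w x)) ->
    #|[set x | w x == T]|%:R = \sum_(c | vc c == Some T) #|[set x | b x == c]|%:R :> rat.
  move=> hb; rewrite -natr_sum -sum1dep_card (partition_big b (fun c => vc c == Some T)) /=; last first.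
    by move=> x /eqP<-; rewrite hb.
  congr (_%:R); apply: eq_bigr => c /eqP hc; rewrite -sum1dep_card; apply: eq_bigl => x.
  by case: (b x =P c) => [e|]; rewrite ?andbF // andbT; move: (hb x); rewrite e hc => -[->]; rewrite eqxx.
rewrite /tvd; apply: le_trans (_ : \sum_T \sum_(c | vc c == Some T)
   `|#|[set x | cl x == c]|%:R / #|V|%:R - #|[set y | cl' y == c]|%:R / #|V'|%:R| <= _).
  apply: ler_sum => T _; rewrite (card _ cl _ T v1) (card _ cl' _ T v2) !mulr_suml -sumrB; exact: ler_norm_sum.
rewrite (exchange_big_dep predT) //=; apply: ler_sum => c _; rewrite sumr_const.
case: (vc c) => [T|]; last by rewrite (eq_card0 (A := fun T => None == Some T)) // mulr0n normr_ge0.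
by rewrite (eq_card1 (x := T)) // => T'; rewrite inE /= eq_sym.
Qed.
End ViewClasses.
End Sampling.

(** * The tester *)

Section Exploration.
Variables (k : nat) (ar : 'I_k -> nat) (d amx : nat).
Hypothesis har : forall R, 0 < ar R <= amx.
Local Notation P := (port k d amx).

(** Elements are numbered from 1 as in oracle queries; 0 stands for an undefined walk, and a query
    at 0 is again undefined. *)
Definition enc n (o : option 'I_n) : nat := if o is Some y then y.+1 else 0.

Lemma enc_inj n : injective (@enc n).
Proof. by case=> [x|] [y|] //= [] /val_inj->. Qed.

Lemma enc_le n (o : option 'I_n) : enc o <= n.
Proof. by case: o => /=. Qed.

Definition stepE (e : expr) (p : P) : expr := if p.2 < ar p.1.1 then EComp p.1.1 p.2 p.1.2.+1 e else ECon 0.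

Lemma stepE_ok (D : pdb ar) m e (o : option 'I_(dom D)) (p : P) : eval D m e = enc o ->
  eval D m (stepE e p) = enc (obind (fun x => go x p) o).
Proof.
rewrite /stepE => ee; case: o ee => [x|] /= ee; last first.
  by case: ifP => // _; rewrite /= ee /oracle /= valK /=; case: (insub _).
rewrite /go; case la: (p.2 < ar p.1.1) => //=; rewrite ee.
case eo: (oracle D p.1.1 x.+1 p.1.2.+1) => [s|] //=.
have [u [_ _ ->]] := oracle_sound eo.
by rewrite (nth_map x) ?size_tuple //= valK.
Qed.

Lemma stepE_ext (D : pdb ar) m m' e e' p : eval D m e = eval D m' e' -> eval D m (stepE e p) = eval D m' (stepE e' p).
Proof. by rewrite /stepE; case: ifP => //= _ ->. Qed.

Lemma below_stepE b e p : below b e -> below b (stepE e p).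
Proof. by rewrite /stepE; case: ifP. Qed.

Definition walkE (e : expr) (w : seq P) : expr := foldl stepE e w.

Lemma walkE_ok (D : pdb ar) m w e (o : option 'I_(dom D)) : eval D m e = enc o ->
  eval D m (walkE e w) = enc (walk (@go k ar d amx D) o w).
Proof. by elim: w e o => //= p w IH e o ee; apply: IH; apply: stepE_ok. Qed.

Lemma walkE_ext (D : pdb ar) m m' w e e' : eval D m e = eval D m' e' -> eval D m (walkE e w) = eval D m' (walkE e' w).
Proof. by elim: w e e' => //= p w IH e e' ee; apply: IH; apply: stepE_ext. Qed.

Lemma below_walkE b w e : below b e -> below b (walkE e w).
Proof. by elim: w e => //= p w IH e be; apply: IH; apply: below_stepE. Qed.

Lemma in_enum (T : finType) (z : T) : z \in Finite.enum T.
Proof. by rewrite -enumT mem_enum. Qed.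

Section Bits.
Variable r : nat.

Definition sampleE (i : nat) : expr := ESuc (EReg i.+1).

(** These bits are the data of [same_view]: which pairs of words end at the same element, and which
    words are undefined. *)
Definition bitsE (i : nat) : seq expr :=
  [seq EEq (walkE (sampleE i) w.1) (walkE (sampleE i) w.2) | w : r.-bseq P * r.-bseq P <- enum {: r.-bseq P * r.-bseq P}] ++
  [seq EEq (walkE (sampleE i) w) (ECon 0) | w : r.-bseq P <- enum {: r.-bseq P}].

Definition bits (D : pdb ar) (v : nat) : seq nat := [seq eval D (fun _ => v) e | e <- bitsE 0].

Lemma below_bitsE b i : i.+1 < b -> all (below b) (bitsE i).
Proof.
move=> ib; rewrite all_cat; apply/andP; split; rewrite all_map; apply/allP => w _ /=.
  by apply/andP; split; apply: below_walkE.
by rewrite andbT; apply: below_walkE.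
Qed.

Lemma size_bitsE i j : size (bitsE i) = size (bitsE j).
Proof. by rewrite /bitsE !size_cat !size_map. Qed.

Lemma eval_bitsE (D : pdb ar) m i : [seq eval D m e | e <- bitsE i] = bits D (m i.+1).
Proof.
rewrite /bits /bitsE !map_cat -!map_comp; congr (_ ++ _); apply: eq_map => w /=;
  rewrite !(@walkE_ext D m (fun _ => m i.+1) _ (sampleE i) (sampleE 0)) //.
Qed.

Lemma bits1 (D : pdb ar) v : all (leq^~ 1) (bits D v).
Proof.
rewrite /bits /bitsE map_cat all_cat -!map_comp !all_map; apply/andP.
by split; apply/allP => w _ /=; case: eqP.
Qed.

Lemma bits_lt (D : pdb ar) v : horner_code (bits D v) < 2 ^ size (bitsE 0).
Proof. by have := horner_code_lt (bits1 D v); rewrite size_map. Qed.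

Definition viewcls (D : pdb ar) (v : nat) : 'I_(2 ^ size (bitsE 0)) := Ordinal (bits_lt D v).

Lemma viewcls_bits (D D' : pdb ar) v v' : viewcls D v = viewcls D' v' <-> bits D v = bits D' v'.
Proof.
split=> [[e]|e]; last by apply: val_inj; rewrite /= e.
by apply: horner_code_inj e; rewrite ?bits1 // !size_map.
Qed.

Lemma eqn_bool (b b' : bool) : (b : nat) = b' -> b = b'.
Proof. by case: b; case: b'. Qed.

Lemma viewcls_view (D D' : pdb ar) (x : 'I_(dom D)) (y : 'I_(dom D')) : viewcls D x = viewcls D' y ->
  view (@go k ar d amx D) r x = view (@go k ar d amx D') r y.
Proof.
move/viewcls_bits; rewrite /bits /bitsE !map_cat -!map_comp => /eqP.
rewrite eqseq_cat ?size_map // => /andP[/eqP/eq_in_map h1 /eqP/eq_in_map h2]; apply/viewP => w w' sw sw'.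
have ok (E : pdb ar) (z : 'I_(dom E)) u : eval E (fun _ => nat_of_ord z) (walkE (sampleE 0) u) = enc (walk (@go k ar d amx E) (Some z) u).
  exact: walkE_ok.
have := h1 (Bseq sw, Bseq sw') (in_enum _); have := h2 (Bseq sw) (in_enum _).
rewrite /= !ok => /eqn_bool e2 /eqn_bool e1; split; first by rewrite !(inj_eq (@enc_inj _)) in e1.
by rewrite -!(inj_eq (@enc_inj _)).
Qed.
End Bits.

Section Small.
Variable N0 : nat.

(** The first bits reveal the size if it is below [N0]; the others then list the complete port
    structure. *)
Definition smallE : seq expr :=
  [seq EEq (EReg 0) (ECon n0) | n0 <- iota 0 N0] ++
  [seq EEq (stepE (ECon (q.1.1 : 'I_N0).+1) q.1.2) (ECon (q.2 : 'I_N0.+1)) | q : 'I_N0 * P * 'I_N0.+1 <- enum {: 'I_N0 * P * 'I_N0.+1}].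

Lemma smallE1 (D : pdb ar) m : all (leq^~ 1) [seq eval D m e | e <- smallE].
Proof.
rewrite /smallE map_cat all_cat -!map_comp !all_map; apply/andP.
by split; apply/allP => w _ /=; case: eqP.
Qed.

Lemma below_smallE b : 0 < b -> all (below b) smallE.
Proof.
move=> b0; rewrite all_cat; apply/andP; split; rewrite all_map; apply/allP => w _ /=; first by rewrite b0.
by rewrite andbT; apply: below_stepE.
Qed.

Lemma small_eq (D D' : pdb ar) m m' : deg_le d D -> deg_le d D' -> m 0 = dom D -> m' 0 = dom D' ->
  [seq eval D m e | e <- smallE] = [seq eval D' m' e | e <- smallE] ->
  (dom D < N0) = (dom D' < N0) /\ (dom D < N0 -> D = D').
Proof.
move=> dD dD' m0 m0' /eqP; rewrite /smallE !map_cat -!map_comp eqseq_cat ?size_map //.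
case/andP=> /eqP/eq_in_map h1 /eqP/eq_in_map h2.
have h n0 : n0 < N0 -> (dom D == n0) = (dom D' == n0).
  by move=> lt; apply: eqn_bool; have := h1 n0; rewrite mem_iota add0n /= m0 m0'; apply.
have e1 : (dom D < N0) = (dom D' < N0).
  by apply/idP/idP => lt; [have := h _ lt | have := h _ lt]; rewrite eqxx; [move/esym|] => /eqP e; rewrite ?e // -e.
split=> // lt; have := h _ lt; rewrite eqxx => /esym/eqP en.
case: D dD m0 h1 h2 h e1 lt en => n D dD _ _ h2 _ _ /= lt; case: D' dD' m0' h2 => n' D' /= dD' _ h2 en.
subst n'.
have G (x : 'I_n) (p : P) : @go k ar d amx (PDB D) x p = @go k ar d amx (PDB D') x p.
  apply: enc_inj; apply/eqP; rewrite eq_sym.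
  have xN : x < N0 by apply: ltn_trans lt.
  have vN : enc (@go k ar d amx (PDB D) x p) < N0.+1 by rewrite ltnS; apply: leq_trans (enc_le _) (ltnW lt).
  have := h2 (Ordinal xN, p, Ordinal vN) (in_enum _) => /=.
  rewrite (@stepE_ok (PDB D) m _ (Some x)) // (@stepE_ok (PDB D') m' _ (Some x)) //= eqxx.
  by case: eqP.
congr PDB; apply: functional_extensionality_dep => R; apply/setP => u.
have := size_tuple u; have /andP[r0 _] := har R; case eu: (tval u) => [|x s]; first by move=> e; rewrite -e in r0.
move=> _; have xu : x \in tval u by rewrite eu inE eqxx.
rewrite -!mem_dblist; apply/idP/idP => h3.
  apply/(tuple_ports (D := PDB D') har R x dD' xu); have [sz [j hj]] := (tuple_ports (D := PDB D) har R x dD xu).1 h3.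
  by split=> //; exists j => l lR; rewrite -G hj.
apply/(tuple_ports (D := PDB D) har R x dD xu); have [sz [j hj]] := (tuple_ports (D := PDB D') har R x dD' xu).1 h3.
by split=> //; exists j => l lR; rewrite G hj.
Qed.
End Small.
End Exploration.

Lemma cnt_compl vs s F : cnt vs s (fun tau => F tau == true) + cnt vs s (fun tau => F tau == false) = size vs ^ s.
Proof.
elim: s F => [|s IH] F /=; first by case: (F _).
rewrite -big_split /= (eq_bigr (fun _ => size vs ^ s)); last by move=> v _; apply: (IH (fun tau => F (v :: tau))).
by rewrite big_const_seq count_predT iter_addn_0 expnS mulnC.
Qed.

Lemma cnt_le vs s (F F' : seq nat -> bool) : (forall tau, size tau = s -> F tau -> F' tau) -> cnt vs s F <= cnt vs s F'.
Proof.
elim: s F F' => [|s IH] F F' H /=; first by case e: (F [::]); rewrite // H.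
by apply: leq_sum => v _; apply: IH => tau st; apply: H; rewrite /= st.
Qed.

Lemma cnt_none vs s F b : (forall tau, size tau = s -> F tau = b) -> cnt vs s (fun tau => F tau == ~~ b) = 0.
Proof.
elim: s F => [|s IH] F H /=; first by rewrite H //; case: b {H}.
by rewrite big1_seq // => v _; apply: (IH (fun tau => F (v :: tau))) => tau st; apply: H; rewrite /= st.
Qed.

Lemma sample_bound x y z n : x + y = n -> 3 * z <= n -> y <= z -> 2 * n <= 3 * x.
Proof. by lia. Qed.

Lemma two_thirds a b : 0 < b -> 2 * b <= 3 * a -> Rle (Rdiv 2 3) (Rdiv (INR a) (INR b)).
Proof.
move=> /ssrnat.ltP/lt_0_INR b0 /ssrnat.leP/le_INR; rewrite !mult_INR [INR 2]/= [INR 3]/= => h.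
apply: (Rmult_le_reg_r (INR b)) => //; rewrite /Rdiv (Rmult_assoc (INR a)) Rinv_l; last exact: Rgt_not_eq.
rewrite Rmult_1_r; move: h b0; move: (INR a) (INR b) => x y h y0; Lra.lra.
Qed.

Lemma size_rand_vals_gt0 n : 0 < size (rand_vals n).
Proof. by rewrite /rand_vals; case: n. Qed.

Lemma freq_card (C : finType) n (cl : nat -> C) c :
  (#|[set v : 'I_n | cl v == c]|%:R / #|'I_n|%:R = freq n cl c)%R.
Proof.
have e : iota 0 n = index_iota 0 n by rewrite /index_iota subn0.
rewrite /freq e card_ord; congr (_%:R / _)%R; rewrite -sum1dep_card big_mkcond.
by rewrite big_mkord; apply: eq_bigr => v _; case: eqP.
Qed.

Section NormComparison.
Local Open Scope ring_scope.

Lemma l2_threshold (N del s z : rat) : 0 < N -> 0 < del -> 0 < s -> z <= 12 / s -> 48 * N / del ^+ 2 <= s ->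
  z <= del ^+ 2 / (4 * N ^+ 2) * N.
Proof.
move=> N0 del0 s0 hz hs; have d2 : 0 < del ^+ 2 by apply: exprn_gt0.
have N4 : 0 < 4 * N by apply: mulr_gt0.
rewrite (_ : _ * N = del ^+ 2 / (4 * N)); last by field; rewrite gt_eqF.
apply: le_trans hz _; rewrite (ler_pdivlMr _ _ N4) mulrAC (ler_pdivrMr _ _ s0).
rewrite (ler_pdivrMr _ _ d2) in hs; rewrite (_ : 12 * (4 * N) = 48 * N); last by ring.
by rewrite [leRHS]mulrC.
Qed.

Lemma exists_nat_ge (x : rat) : 0 <= x -> exists s : nat, (0 < s)%N /\ x <= s%:R.
Proof.
move=> x0; exists (Num.bound x).+1; split=> //.
by apply: le_trans (ltW (archi_boundP x0)) _; rewrite ler_nat.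
Qed.

Lemma l1_threshold (N del : rat) : 0 < N -> 0 < del ->
  (del / (2 * N) + del ^+ 2 / (4 * N ^+ 2) / (del / (2 * N))) * N = del.
Proof. by move=> N0 del0; field; rewrite !gt_eqF. Qed.
End NormComparison.

(** The l2 bound from the sample turns into an l1 bound on the class frequencies by [sum_abs_le],
    and then into one on views of any smaller radius. *)
Lemma freq_tvd (P C : finType) (r Rmax n n' s : nat) (del : rat) (go : 'I_n -> P -> option 'I_n)
    (go' : 'I_n' -> P -> option 'I_n') (cl cl' : nat -> C) : 0 < n -> (0 < del)%R -> r <= Rmax -> 0 < s ->
  (forall x y : 'I_n, cl x = cl y -> view go Rmax x = view go Rmax y) ->
  (forall x y : 'I_n', cl' x = cl' y -> view go' Rmax x = view go' Rmax y) ->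
  (forall (x : 'I_n) (y : 'I_n'), cl x = cl' y -> view go Rmax x = view go' Rmax y) ->
  (\sum_c (freq n cl c - freq n' cl' c) ^+ 2 <= 12 / s%:R)%R ->
  (48 * #|C|%:R / del ^+ 2 <= s%:R)%R -> (tvd go go' r <= del)%R.
Proof.
move=> n0 del0 rR s0 h1 h2 h3 hd hs.
have C0 : (0 < #|C|%:R :> rat)%R by rewrite ltr0n; apply/card_gt0P; exists (cl 0).
have s0' : (0 < s%:R :> rat)%R by rewrite ltr0n.
apply: le_trans (@tvd_classes P C 'I_n 'I_n' go go' r (fun x => cl x) (fun y => cl' y) _ _ _) _.
- by move=> x y /h1; apply: view_le.
- by move=> x y /h2; apply: view_le.
- by move=> x y /h3; apply: view_le.
rewrite (eq_bigr (fun c => `|freq n cl c - freq n' cl' c|)%R); last by move=> c _; rewrite !freq_card.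
have q0 : (0 < del / (2 * #|C|%:R))%R.
  by apply: divr_gt0 del0 _; apply: mulr_gt0 C0.
have := sum_abs_le q0 (l2_threshold C0 del0 s0' hd hs).
by rewrite (l1_threshold C0 del0).
Qed.

Lemma dist_refl k (ar : 'I_k -> nat) (D : pdb ar) : dist_le D D 0.
Proof.
exists 0, 0, D, D; do 3!split=> //; exists id; split; first by exists id.
by move=> R u; have -> : map_tuple id u = u by apply: val_inj; rewrite /= map_id.
Qed.

Section Tester.
Variables (k : nat) (ar : 'I_k -> nat) (d t : nat) (phi : formula ar).
Hypothesis har : forall R, 0 < ar R.
Hypothesis hd : 2 <= d.
Hypothesis hphi : sentence phi.
Local Notation mx := (maxar ar).

Section Acceptance.
Variables (Rmax N0 s : nat).

(** For large inputs this is an existence statement over all members of the property; it can be used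
    because the decision is only looked up. *)
Definition accepts (D : pdb ar) (tau : seq nat) : Prop :=
  (dom D < N0 /\ models D phi) \/
  (N0 <= dom D /\ exists G, [/\ class_C d t G, models G phi, N0 <= dom G &
     (dev (freq (dom G) (@viewcls k ar d mx Rmax G)) [seq @viewcls k ar d mx Rmax D v | v <- tau] <= 3 * s%:R)%R]).

Definition testE : seq expr := smallE ar d mx N0 ++ flatten [seq bitsE ar d mx Rmax i | i <- iota 0 s].

Lemma accepts_inv (D D' : pdb ar) tau tau' : class_C d t D -> class_C d t D' -> size tau = s -> size tau' = s ->
  [seq eval D (regs D tau) e | e <- testE] = [seq eval D' (regs D' tau') e | e <- testE] ->
  accepts D tau -> accepts D' tau'.
Proof.
move=> [dD _] [dD' _] st st'; rewrite /testE (map_cat _ (smallE _ _ _ _)) (map_cat (eval D' _) (smallE _ _ _ _)).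
move/eqP; rewrite eqseq_cat ?size_map // => /andP[/eqP e1 /eqP e2].
have [lt eqD] := small_eq (maxarP har) dD dD' (erefl _) (erefl _) e1.
have ec : [seq @viewcls k ar d mx Rmax D v | v <- tau] = [seq @viewcls k ar d mx Rmax D' v | v <- tau'].
  apply: (@eq_from_nth _ (@viewcls k ar d mx Rmax D 0)) => [|i]; rewrite ?size_map st ?st' // => ilt.
  rewrite !(nth_map 0) ?st ?st' //; apply/viewcls_bits.
  have -> : nth 0 tau i = regs D tau i.+1 by [].
  have -> : nth 0 tau' i = regs D' tau' i.+1 by [].
  rewrite -!eval_bitsE; move: e2; rewrite !map_flatten -!map_comp.
  have : i \in iota 0 s by rewrite mem_iota.
  elim: (iota 0 s) => // j l IH; rewrite inE /= => il /eqP.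
  rewrite eqseq_cat ?size_map // => /andP[/eqP ej /eqP el].
  by case/orP: il => [/eqP->//|il]; apply: IH.
case=> [[h m]|[h [G [CG mG nG dv]]]].
  by left; rewrite -lt h -eqD.
by right; split; [rewrite leqNgt -lt -leqNgt | exists G; rewrite -ec].
Qed.

Lemma testE1 (D : pdb ar) tau : all (leq^~ 1) [seq eval D (regs D tau) e | e <- testE].
Proof.
rewrite /testE map_cat all_cat smallE1 /=; elim: (iota 0 s) => //= i l IH.
by rewrite map_cat all_cat eval_bitsE bits1.
Qed.

Lemma below_testE : all (below s.+1) testE.
Proof.
rewrite /testE all_cat below_smallE //=; have : all (fun i => i < s) (iota 0 s).
  by apply/allP => i; rewrite mem_iota.
elim: (iota 0 s) => //= i l IH /andP[lt /IH]; rewrite all_cat => ->; rewrite andbT.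
by apply: below_bitsE; rewrite ltnS.
Qed.
End Acceptance.

Lemma small_close (eps : R) (D D' : pdb ar) m1 b : Rlt 0 eps -> 0 < m1 -> Rlt (Rinv (INR m1)) eps ->
  dist_le D D' b -> m1 * b <= minn (dom D) (dom D') -> eps_close d eps D D'.
Proof.
move=> eps0 m10 hm db /ssrnat.leP/le_INR; rewrite mult_INR => hb; exists b; split=> //.
have m0 : Rlt 0 (INR m1) by apply: lt_0_INR; apply/ssrnat.ltP.
have d1 : Rle 1 (INR d) by apply: (le_INR 1); apply/ssrnat.leP; apply: ltnW.
move: hb; have := pos_INR (minn (dom D) (dom D')); move: (INR (minn _ _)) (INR b) (INR d) d1 => x y z z1 x0 hb.
have h1 : Rle y (Rmult (Rinv (INR m1)) x).
  apply: (Rmult_le_reg_l (INR m1)) => //; rewrite -Rmult_assoc Rinv_r ?Rmult_1_l //; exact: Rgt_not_eq.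
apply: Rle_trans h1 _; apply: Rmult_le_compat_r => //.
apply: Rle_trans (Rlt_le _ _ hm) _; rewrite -{1}[eps]Rmult_1_r; apply: Rmult_le_compat_l => //; exact: Rlt_le.
Qed.

(** Completeness takes the input itself as [G] and uses [sampling]. For soundness, a typical sample
    that is accepted fits both the input and a member [G], so their views are close and
    [close_of_views] contradicts farness. *)
Lemma tester : uniformly_testable_const_time d (class_C d t) (fun D => class_C d t D /\ models D phi).
Proof.
move=> eps eps0 _; have [m1 [hm m10']] := archimed_cor1 eps eps0.
have m10 : 0 < m1 by apply/ssrnat.ltP.
have [Rmax [N1 [del [del0 HC]]]] := close_of_views d t har hphi m10.
pose N0 := N1.+1; pose C : finType := 'I_(2 ^ size (bitsE ar d mx Rmax 0)).
(* The sample size is such that the l2 bound [12 / s] of [dev_triangle] yields distance at most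
   [del] between the view statistics. *)
have [s [s0 hs]] : exists s, 0 < s /\ (48 * #|C|%:R / del ^+ 2 <= s%:R :> rat)%R.
  apply: exists_nat_ge; apply: divr_ge0; last by apply: ltW; apply: exprn_gt0.
  by apply: mulr_ge0; apply: ler0n.
have [prog [T [q Hp]]] := table_tester (below_testE Rmax N0 s) (testE1 Rmax N0 s) (@accepts_inv Rmax N0 s).
exists prog, T, q => D CD; have [bd /(_ CD)[F [FA HF]]] := Hp D.
have rv0 : 0 < size (rand_vals (dom D)) ^ s by rewrite expn_gt0 size_rand_vals_gt0.
have cc := cnt_compl (rand_vals (dom D)) s F.
pose dv G tau := dev (freq (dom G) (@viewcls k ar d mx Rmax G)) [seq @viewcls k ar d mx Rmax D v | v <- tau].
have smp : N0 <= dom D -> 3 * cnt (rand_vals (dom D)) s (fun tau => (3 * s%:R < dv D tau)%R) <= size (rand_vals (dom D)) ^ s.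
  move=> nD; have n0 : 0 < dom D by apply: leq_ltn_trans nD.
  rewrite /rand_vals ifF ?size_iota; last by case: (dom D) n0.
  exact: sampling.
split; [exact: bd | move=> [_ mD] | move=> far]; rewrite HF; apply: (two_thirds rv0).
- case: (ltnP (dom D) N0) => nD.
    rewrite (@cnt_none _ _ F true) ?addn0 in cc; first by rewrite cc leq_mul2r orbT.
    by move=> tau st; apply/(FA _ st); left; split; [exact: nD | exact: mD].
  apply: (sample_bound cc (smp nD)); apply: cnt_le => tau st; apply: contraLR; rewrite -leNgt => hd'.
  rewrite eqbF_neg negbK; apply/(FA _ st); right; split; first exact: nD.
  by exists D; split; [exact: CD | exact: mD | exact: nD | exact: hd'].
case: (ltnP (dom D) N0) => nD.
  rewrite (@cnt_none _ _ F false) ?add0n in cc; first by rewrite cc leq_mul2r orbT.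
  move=> tau st; apply/negP => /(FA _ st) [[_ mD]|[h' _]]; last by rewrite leqNgt nD in h'.
  (* A small accepted input satisfies the sentence, so it is a member at distance 0 from itself. *)
  apply: far; exists D; split; [by split | exists 0; split; first exact: dist_refl].
  have := pos_INR (minn (dom D) (dom D)); have := pos_INR d; move: (INR _) (INR _) => x y x0 y0.
  by apply: Rmult_le_pos; [apply: Rmult_le_pos; [exact: Rlt_le | exact: x0] | exact: y0].
rewrite addnC in cc; apply: (sample_bound cc (smp nD)).
apply: cnt_le => tau st /eqP /(FA _ st) [[h' _]|[_ [G [CG mG nG dvG]]]]; first by rewrite ltnNge nD in h'.
rewrite ltNge; apply/negP => dvD; apply: far.
have nD0 : 0 < dom D by apply: leq_ltn_trans nD.
have tri := dev_triangle s0 (etrans (size_map _ _) st) dvD dvG.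
have [||r rR|D' [b [CD' mD' db hb]]] := HC D G CD CG mG.
- exact: ltnW.
- exact: ltnW.
- by apply: (freq_tvd nD0 del0 rR s0 _ _ _ tri hs) => x y /viewcls_view; apply.
by exists D'; split; [split | exact: (small_close eps0 m10 hm db hb)].
Qed.
End Tester.

Theorem theorem13 (k : nat) (ar : 'I_k -> nat) (har : forall R, 0 < ar R)
  (d t : nat) (hd : 2 <= d) (phi : formula ar) (hphi : sentence phi) :
  uniformly_testable_const_time d (class_C d t)
    (fun D => class_C d t D /\ models D phi).
Proof. exact: tester. Qed.
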